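(* Let $(\Omega,\rho)$ be a geometric homogeneous space and let $\Theta$ be a bounded domain with $\overline\Theta\subset\Omega$. Assume that the local Poincaré inequality of order $p=2$ holds and that the global weak Poincaré inequality with gain $\omega>1$ holds on $\Theta$. Let $X u=-\mathrm{div}(P\nabla u)+\mathbf{H}\mathbf{R}u+\mathbf{S}'(\mathbf{G}u)+Fu$ be a second order linear degenerate elliptic operator with rough coefficients in $\Theta$. Assume that $F\in L^t(\Theta)$ with $t>\omega'=\frac{\omega}{\omega-1}$ and that $\mathbf{G},\mathbf{H}\in[L^q(\Theta)]^N$ with $q>2\omega'$. For $f\in L^2(\Theta)$, $K\in\mathbb{N}$, a $K$-tuple $\mathbf{T}$ of subunit vector fields and $\mathbf{g}\in[L^2(\Theta)]^K$ consider the $X$-Neumann problem $$(\mathrm{NP})\quad Xu=f+\mathbf{T}'\mathbf{g}\ \text{ in }\Theta,\qquad \langle\nu,P\nabla u+u\mathbf{G}\mathbf{S}-\mathbf{g}\mathbf{T}\rangle=0\ \text{ on }\partial\Theta .$$ Then: 1) One and only one of the following alternatives holds: either (I) for every $f\in L^2(\Theta)$, $K\in\mathbb{N}$, every $K$-tuple $\mathbf{T}$ of subunit vector fields and every $\mathbf{g}\in[L^2(\Theta)]^K$ there exists a unique weak solution $u\in QH^1(\Theta)$ of (NP); or (II) there exist nontrivial weak solutions $u\in QH^1(\Theta)\setminus\{(0,\mathbf{0})\}$ of the homogeneous problem $Xu=0$ in $\Theta$, $\langle\nu,P\nabla u+u\mathbf{G}\mathbf{S}\rangle=0$ on $\partial\Theta$.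 2) If (II) holds, then the dimension of the subspace $\mathcal{N}\subset QH^1(\Theta)$ of weak solutions of the homogeneous problem in (II) is finite and equals the dimension of the subspace $\mathcal{N}^*\subset QH^1(\Theta)$ of weak solutions $w$ of the adjoint homogeneous problem $X^*w=0$ in $\Theta$, $\langle\nu,P\nabla w+w\mathbf{H}\mathbf{R}\rangle=0$ on $\partial\Theta$. 3) If (II) holds, then (NP) admits a weak solution $u\in QH^1(\Theta)$ for given $f\in L^2(\Theta)$, $K\in\mathbb{N}$, $\mathbf{T}$ a $K$-tuple of subunit vector fields and $\mathbf{g}\in[L^2(\Theta)]^K$ if and only if $$\int_\Theta \big(fw+\mathbf{g}\mathbf{T}w\big)\,dx=0\quad\text{for every } w\in\mathcal{N}^*.$$
   Context: Geometric homogeneous space: $\Omega\subset\mathbb{R}^n$ is a bounded open set and $\rho:\Omega\times\Omega\to[0,\infty)$ is a symmetric quasimetric, i.e. for some $\kappa\ge1$ and all $x,y,z\in\Omega$: $\rho(x,y)=0$ iff $x=y$; $\rho(x,y)=\rho(y,x)$; $\rho(x,y)\le\kappa[\rho(x,z)+\rho(z,y)]$. Put $B(x,r)=\{y\in\Omega:\rho(x,y)<r\}$. $(\Omega,\rho)$ is a geometric homogeneous space if: (a) every $B(x,r)$, $x\in\Omega$, $r>0$, is open in the Euclidean topology; (b) for $x,y\in\Omega$, $|x-y|\to0$ if $\rho(x,y)\to0$ (equivalently, for every $x\in\Omega$ and $\epsilon>0$ there is $\delta>0$ with $B(x,\delta)\subset\{y\in\Omega:|x-y|<\epsilon\}$);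 (c) the $\rho$-balls are locally geometrically doubling: for every compact $E\subset\Omega$ there is $\delta=\delta(E)>0$ such that for all $x\in E$ and $0<r'\le r<\delta$, $B(x,r)$ contains at most $C(r/r')$ disjoint $\rho$-balls of radius $r'$, where $C(r/r')$ is independent of $x$ and $E$. Degenerate Sobolev space: $Q=Q(x)$ is a nonnegative definite symmetric $n\times n$ matrix of measurable functions on $\Omega$ with $|Q|\in L^\infty_{loc}(\Omega)$. For open $\Theta\subset\Omega$, $Lip_Q(\Theta)$ is the set of locally Lipschitz functions $\varphi$ on $\Theta$ with $\|\varphi\|_{QH^1(\Theta)}=\big(\int_\Theta|\varphi|^2dx+\int_\Theta|\sqrt{Q}\nabla\varphi|^2dx\big)^{1/2}<\infty$, and $QH^1(\Theta)$ is its completion in this norm. Elements of $QH^1(\Theta)$ are identified with pairs $(u,\nabla u)$ (limits of pairs $(\varphi_j,\nabla\varphi_j)$), where $u\in L^2(\Theta)$ and $\nabla u$ is a measurable $\mathbb{R}^n$-valued function with $\sqrt{Q}\nabla u\in L^2$, two such functions being identified if $\sqrt{Q}$ times their difference vanishes a.e.; $\nabla u$ need not be determined by $u$. One writes $u$ for $(u,\nabla u)$. Local Poincaré inequality of order $p$: a continuous function $r_1:\Omega\to(0,\infty)$ is fixed, and there are $C_2>0$, $\mathfrak{b}\ge1$ such that for every $y\in\Omega$ and $r>0$ with $\mathfrak{b}r\in(0,r_1(y))$, writing $B_r=B(y,r)$ and $f_{B_r}=\frac1{|B_r|}\int_{B_r}f\,dx$, $$\Big(\tfrac{1}{|B_r|}\int_{B_r}|f-f_{B_r}|^pdx\Big)^{1/p}\le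 C_2\,r\Big(\tfrac{1}{|B_{\mathfrak{b}r}|}\int_{B_{\mathfrak{b}r}}|\sqrt{Q}\nabla f|^pdx\Big)^{1/p}\quad\text{for all } f\in Lip_{loc}(\Omega).$$ Global weak Poincaré inequality with gain $\omega>1$ on $\Theta$: there is $C_4>0$ with $\big(\int_\Theta|f|^{2\omega}dx\big)^{1/(2\omega)}\le C_4\big(\int_\Theta|\sqrt{Q}\nabla f|^2dx+\int_\Theta|f|^2dx\big)^{1/2}$ for all $f\in Lip_Q(\Theta)$. Subunit vector fields: a measurable vector field $W=(w_1,\dots,w_n)$ is subunit if $\big(\sum_iw_i(x)\xi_i\big)^2\le\langle\xi,Q(x)\xi\rangle$ for all $\xi\in\mathbb{R}^n$ and a.e. $x\in\Theta$. For $(u,\nabla u)\in QH^1(\Theta)$, $Wu=\sum_iw_i(\nabla u)_i\in L^2(\Theta)$. $W'u=-\sum_i\partial_{x_i}(w_iu)$ is the formal adjoint. For tuples, $\mathbf{G}\mathbf{W}u=\sum_ig_iW_iu$ and $\mathbf{W}'(\mathbf{G}u)=\sum_iW_i'(g_iu)$. Second order linear degenerate elliptic operator with rough coefficients: $Xu=-\mathrm{div}(P\nabla u)+\mathbf{H}\mathbf{R}u+\mathbf{S}'(\mathbf{G}u)+Fu$ in $\Theta$, where $P=P(x)$ is a bounded measurable nonnegative definite symmetric $n\times n$ matrix with $c_1\langle\xi,Q(x)\xi\rangle\le\langle\xi,P(x)\xi\rangle\le C_1\langle\xi,Q(x)\xi\rangle$ for some $c_1,C_1>0$, all $\xi\in\mathbb{R}^n$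 and a.e. $x\in\Theta$; $\mathbf{R},\mathbf{S}$ are $N$-tuples of subunit vector fields; $\mathbf{G},\mathbf{H}$ are $\mathbb{R}^N$-valued measurable functions and $F$ is a real measurable function on $\Theta$. Its bilinear form is $$\mathcal{L}(u,v)=\int_\Theta\big[\langle\nabla v,P\nabla u\rangle+v\,\mathbf{H}\mathbf{R}u+u\,\mathbf{G}\mathbf{S}v+Fuv\big]dx,\quad u,v\in QH^1(\Theta).$$ Weak solutions: $\nu$ denotes the outward unit normal; the boundary condition is only formal. $u\in QH^1(\Theta)$ is a weak solution of (NP) iff $\mathcal{L}(u,v)=\int_\Theta(fv+\mathbf{g}\mathbf{T}v)\,dx$ for every $v\in QH^1(\Theta)$ (homogeneous case: $\mathcal{L}(u,v)=0$ for all $v$). The adjoint operator is $X^*u=-\mathrm{div}(P\nabla u)+\mathbf{G}\mathbf{S}u+\mathbf{R}'(\mathbf{H}u)+Fu$, with bilinear form $\mathcal{L}^*(u,v)=\mathcal{L}(v,u)$; $w\in QH^1(\Theta)$ is a weak solution of the adjoint homogeneous problem iff $\mathcal{L}(v,w)=0$ for every $v\in QH^1(\Theta)$. *)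

(* Defs.v *)
From HB Require Import structures.
From mathcomp Require Import all_boot all_order all_algebra.
From mathcomp Require Import all_classical all_reals all_analysis.

Set Implicit Arguments.
Unset Strict Implicit.
Unset Printing Implicit Defensive.

Import Order.TTheory GRing.Theory Num.Theory.
Import numFieldNormedType.Exports.
Local Open Scope classical_set_scope.
Local Open Scope ring_scope.

(* Lebesgue measure on R^n, as the n-fold product of the one-dimensional
   Lebesgue measure. *)
Section tuple_lebesgue_measure.
Context {R : realType}.
Local Notation T := (measurableTypeR R).
Local Open Scope ereal_scope.

Definition cons_pair n (p : T * n.-tuple T) : n.+1.-tuple T :=
  cons_tuple p.1 p.2.

Lemma measurable_cons_pair n : measurable_fun setT (@cons_pair n).
Proof. exact: measurable_cons. Qed.

Section step.
Variables (n : nat) (m : {sigma_finite_measure set (n.-tuple T) -> \bar R}).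

Definition cons_measure : set (n.+1.-tuple T) -> \bar R :=
  pushforward (lebesgue_measure \x m) (@cons_pair n).

Let cons_measure0 : cons_measure set0 = 0.
Proof. by rewrite /cons_measure /pushforward preimage_set0; exact: measure0. Qed.

Let cons_measure_ge0 A : 0 <= cons_measure A.
Proof. exact: (measure_ge0 (lebesgue_measure \x m)). Qed.

Let cons_measure_sigma_additive : semi_sigma_additive cons_measure.
Proof.
move=> F mF tF mUF; rewrite /cons_measure /pushforward preimage_bigcup.
apply: (@measure_semi_sigma_additive _ _ _ (lebesgue_measure \x m)).
- by move=> k; rewrite -[_ @^-1` _]setTI; exact: measurable_cons_pair.
- by apply/trivIsetP => i j _ _ ij; rewrite -preimage_setI;
    move/trivIsetP: tF => /(_ _ _ _ _ ij) ->//; rewrite preimage_set0.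
- rewrite -preimage_bigcup -[_ @^-1` _]setTI; exact: measurable_cons_pair.
Qed.

HB.instance Definition _ := isMeasure.Build _ _ _ cons_measure
  cons_measure0 cons_measure_ge0 cons_measure_sigma_additive.

Let cons_measure_sigma_finite : sigma_finite setT cons_measure.
Proof.
have /sigma_finiteP[F [TF ndF Foo]] := sigma_finiteT (@lebesgue_measure R).
have /sigma_finiteP[G [TG ndG Goo]] := sigma_finiteT m.
exists (fun k => [set t : n.+1.-tuple T |
    F k (tnth t ord0) /\ G k [tuple of behead t]]).
  apply/esym; rewrite -subTset => t _.
  have [i _ Fi] : (\bigcup_k F k) (tnth t ord0) by rewrite -TF.
  have [j _ Gj] : (\bigcup_k G k) [tuple of behead t] by rewrite -TG.
  exists (maxn i j) => //; split.
  - by move: Fi; exact/subsetPset/ndF/leq_maxl.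
  - by move: Gj; exact/subsetPset/ndG/leq_maxr.
move=> k; have [mF Fk] := Foo k; have [mG Gk] := Goo k; split.
  rewrite [X in measurable X](_ : _ =
    (setT `&` (@tnth _ T ^~ ord0) @^-1` F k) `&`
    (setT `&` (fun t : n.+1.-tuple T => [tuple of behead t]) @^-1` G k)).
    apply: measurableI; first exact: measurable_tnth.
    exact: measurable_behead.
  by rewrite !setTI.
rewrite /cons_measure /pushforward (_ : _ @^-1` _ = F k `*` G k).
  by rewrite product_measure1E// lte_mul_pinfty// ge0_fin_numE.
have bK (p : T * n.-tuple T) : [tuple of behead (cons_pair p)] = p.2 :> n.-tuple T.
  exact/val_inj.
by apply/seteqP; split => p; rewrite /= bK.
Qed.

HB.instance Definition _ := Measure_isSigmaFinite.Build _ _ _ cons_measure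
  cons_measure_sigma_finite.

End step.

Fixpoint tuple_lebesgue_measure n :
    {sigma_finite_measure set (n.-tuple T) -> \bar R} :=
  if n is k.+1 then cons_measure (tuple_lebesgue_measure k)
  else dirac [tuple].

Lemma tuple_lebesgue_measure_box n (A : 'I_n -> set T) :
  (forall i, measurable (A i)) ->
  let B := [set t : n.-tuple T | forall i, A i (tnth t i)] in
  measurable B /\
  tuple_lebesgue_measure n B = \big[*%E/1%E]_i lebesgue_measure (A i).
Proof.
elim: n A => [|n IH] A mA /=.
  rewrite big_ord0 /=.
  have -> : [set t : 0.-tuple T | forall i, A i (tnth t i)] = setT.
    by apply/seteqP; split => // t _ [].
  by split => //; rewrite diracT.
have [m1 m2] := IH (fun i => A (lift ord0 i)) (fun i => mA _).
split.
  have -> : [set t : n.+1.-tuple T | forall i, A i (tnth t i)] =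
      \bigcap_(i in [set: 'I_n.+1]) (setT `&` (@tnth _ T ^~ i) @^-1` A i).
    apply/seteqP; split => t h i; first by split => //; exact: h.
    by have [] := h i I.
  by apply: fin_bigcap_measurable => // i _; exact: measurable_tnth.
rewrite /cons_measure /pushforward.
rewrite [X in _ X = _](_ : _ =
    A ord0 `*` [set t : n.-tuple T | forall i, A (lift ord0 i) (tnth t i)]).
  by rewrite product_measure1E// big_ord_recl m2.
apply/seteqP; split => -[x t]; rewrite /cons_pair /=.
  move=> h; split; first exact: (h ord0).
  by move=> i; have := h (lift ord0 i); rewrite tnthS.
by move=> [h0 h] i; case: (unliftP ord0 i) => [j|] -> //; rewrite tnthS.
Qed.

End tuple_lebesgue_measure.

Section lebesgue_rV.
Context {R : realType} (n : nat).
Local Notation T := (measurableTypeR R).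
Local Open Scope ereal_scope.

Definition tuple_of_row (v : 'rV[R]_n.+1) : n.+1.-tuple T :=
  [tuple v ord0 i | i < n.+1].

Definition lebesgue_rV_outer : set 'rV[R]_n.+1 -> \bar R :=
  fun A => ((tuple_lebesgue_measure n.+1)^*)%mu (tuple_of_row @` A).

Let lebesgue_rV_outer0 : lebesgue_rV_outer set0 = 0.
Proof. by rewrite /lebesgue_rV_outer image_set0 outer_measure0. Qed.

Let lebesgue_rV_outer_ge0 A : 0 <= lebesgue_rV_outer A.
Proof. exact: outer_measure_ge0. Qed.

Let le_lebesgue_rV_outer : {homo lebesgue_rV_outer : A B / A `<=` B >-> A <= B}.
Proof. by move=> A B AB; exact/le_outer_measure/image_subset. Qed.

Let lebesgue_rV_outer_sigma_subadditive : sigma_subadditive lebesgue_rV_outer.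
Proof.
move=> F; rewrite /lebesgue_rV_outer image_bigcup.
exact: outer_measure_sigma_subadditive.
Qed.

HB.instance Definition _ := isOuterMeasure.Build R _ lebesgue_rV_outer
  lebesgue_rV_outer0 lebesgue_rV_outer_ge0 le_lebesgue_rV_outer
  lebesgue_rV_outer_sigma_subadditive.

(* The sigma-algebra carried by R^n is that of all Lebesgue measurable sets
   (not only the Borel ones): the sets that are Caratheodory measurable for the
   outer measure generated by the product measure. *)
HB.instance Definition _ :=
  Measurable.copy 'rV[R]_n.+1 (caratheodory_type lebesgue_rV_outer).

Definition lebesgue_rV : set 'rV[R]_n.+1 -> \bar R := lebesgue_rV_outer.
HB.instance Definition _ := isMeasure.Build _ _ _ lebesgue_rV
  (@caratheodory_measure0 _ _ lebesgue_rV_outer)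
  (@caratheodory_measure_ge0 _ _ lebesgue_rV_outer)
  (@caratheodory_measure_sigma_additive _ _ lebesgue_rV_outer).

Lemma tuple_of_row_inj : injective tuple_of_row.
Proof.
move=> u v /(congr1 (fun t => tnth t)) uv; apply/rowP => i.
by have := congr1 (@^~ i) uv; rewrite !tnth_mktuple.
Qed.

Lemma measurable_rV (A : set 'rV[R]_n.+1) :
  measurable (tuple_of_row @` A) -> measurable A.
Proof.
move=> mA; change (caratheodory_measurable lebesgue_rV_outer A) => X.
rewrite /= /lebesgue_rV_outer.
have mA' : measurable.-sigma.-measurable (tuple_of_row @` A).
  exact: (@sub_sigma_algebra _ setT measurable _ mA).
rewrite (@sub_caratheodory _ _ _ (tuple_lebesgue_measure n.+1) _ mA').
congr (_ + _); congr (_ _); apply/seteqP; split=> t /=.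
- by move=> [[x Xx <-] [y Ay /tuple_of_row_inj e]]; subst y; exists x.
- by move=> [x [Xx Ax] <-]; split; exists x.
- by move=> [[x Xx <-] h]; exists x => //; split => // Ax; apply: h; exists x.
- by move=> [x [Xx Ax] <-]; split; [exists x
    | move=> [y Ay /tuple_of_row_inj e]; subst y].
Qed.

Lemma lebesgue_rV_box (A : 'I_n.+1 -> set T) :
  (forall i, measurable (A i)) ->
  let B := [set x : 'rV[R]_n.+1 | forall i, A i (x 0%R i)] in
  measurable B /\ lebesgue_rV B = \big[*%E/1%E]_i lebesgue_measure (A i).
Proof.
move=> mA B; have [mB muB] := tuple_lebesgue_measure_box mA.
have BE : tuple_of_row @` B =
    [set t : n.+1.-tuple T | forall i, A i (tnth t i)].
  apply/seteqP; split => [_ [x Bx <-] i|t At].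
    by rewrite tnth_mktuple; exact: Bx.
  exists (\row_i tnth t i)%R; first by move=> i; rewrite mxE; exact: At.
  by apply/eq_from_tnth => i; rewrite tnth_mktuple mxE.
split; first by apply: measurable_rV; rewrite BE.
by rewrite /lebesgue_rV /lebesgue_rV_outer measurable_mu_extE BE.
Qed.

End lebesgue_rV.

Section Euclidean_structure.
Context {R : realType}.

Definition dotv m (u v : 'rV[R]_m) : R := \sum_(i < m) u 0 i * v 0 i.

(* The library norm on row vectors is the max norm. *)
Definition enorm m (u : 'rV[R]_m) : R := Num.sqrt (dotv u u).

Definition psdmx m (A : 'M[R]_m) : Prop :=
  A^T = A /\ forall xi : 'rV[R]_m, 0 <= dotv xi (xi *m A).

(* Vectors are rows, so a matrix acts on the right; the matrices involved are
   symmetric. *)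
Definition sqrtmx m (A : 'M[R]_m.+1) : 'M[R]_m.+1 :=
  get [set B : 'M[R]_m.+1 | psdmx B /\ B *m B = A].

End Euclidean_structure.

Section geometric_homogeneous_spaces.
Context {R : realType} {n : nat}.
Local Notation E := 'rV[R]_n.+1.
Implicit Types (Om : set E) (rho : E -> E -> R).

Definition symmetric_quasimetric Om rho : Prop :=
  exists2 kappa : R, 1 <= kappa &
  forall x y z : E, Om x -> Om y -> Om z ->
    [/\ 0 <= rho x y,
        rho x y = 0 <-> x = y,
        rho x y = rho y x &
        rho x y <= kappa * (rho x z + rho z y)].

Definition qball Om rho (x : E) (r : R) : set E := [set y | Om y /\ rho x y < r].

Definition locally_geometrically_doubling Om rho : Prop :=
  exists C : R -> R, forall K : set E, compact K -> K `<=` Om ->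
  exists2 delta : R, 0 < delta &
  forall (x : E) (r' r : R), K x -> 0 < r' -> r' <= r -> r < delta ->
  forall (m : nat) (z : 'I_m -> E),
    (forall i, Om (z i) /\ qball Om rho (z i) r' `<=` qball Om rho x r) ->
    (forall i j, i != j ->
      qball Om rho (z i) r' `&` qball Om rho (z j) r' = set0) ->
    m%:R <= C (r / r').

Definition geometric_homogeneous_space Om rho : Prop :=
  [/\ open Om /\ bounded_set Om,
      symmetric_quasimetric Om rho,
      forall x r, Om x -> 0 < r -> open (qball Om rho x r),
      forall x eps, Om x -> 0 < eps -> exists2 delta : R, 0 < delta &
        qball Om rho x delta `<=` [set y | Om y /\ enorm (x - y) < eps] &
      locally_geometrically_doubling Om rho].

End geometric_homogeneous_spaces.

Section degenerate_Sobolev_space.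
Context {R : realType} {n : nat}.
Local Notation E := 'rV[R]_n.+1.
Local Notation mu := (@lebesgue_rV R n).
Implicit Types (Om Th : set E) (Q : E -> 'M[R]_n.+1) (f phi : E -> R).
Implicit Types (u v w : (E -> R) * (E -> E)).

Definition measurable_vec m D (U : E -> 'rV[R]_m) : Prop :=
  forall i, measurable_fun D (fun x => U x 0 i).

Definition measurable_mx D (A : E -> 'M[R]_n.+1) : Prop :=
  forall i j, measurable_fun D (fun x => A x i j).

Definition ess_bounded_on D (A : E -> 'M[R]_n.+1) : Prop :=
  exists M : R, {ae mu, forall x, D x -> `|A x| <= M}.

Definition degenerate_matrix Om Q : Prop :=
  [/\ measurable_mx Om Q,
      forall x, Om x -> psdmx (Q x) &
      forall K, compact K -> K `<=` Om -> ess_bounded_on K Q].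

Definition Lp_on Th (p : \bar R) f : Prop := f \_ Th \in Lfun mu p.

Definition locally_lipschitz Th f : Prop :=
  forall x, Th x -> exists2 U, nbhs x U &
    [lipschitz (f y : R^o) | y in U `&` Th].

(* For a locally Lipschitz function the partial derivatives exist almost
   everywhere; elsewhere ['D_v f x] is an unspecified value. *)
Definition grad f (x : E) : E := \row_i 'D_(delta_mx 0 i) (f : E -> R^o) x.

Definition sqrtQ Q (U : E -> E) (x : E) : E := U x *m sqrtmx (Q x).

Definition QHnorm Q Th u : \bar R :=
  ((\int[mu]_(x in Th) (`|u.1 x| ^+ 2)%:E
    + \int[mu]_(x in Th) (enorm (sqrtQ Q u.2 x) ^+ 2)%:E) `^ 2^-1)%E.

Definition LipQ Q Th phi : Prop :=
  locally_lipschitz Th phi /\ (QHnorm Q Th (phi, grad phi) < +oo)%E.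

(* QH^1(Th) is the completion of LipQ, realized as the closure of the pairs
   (phi, grad phi) among the pairs (u, U) with u and sqrt(Q) U in L^2(Th);
   elements of QH^1(Th) are such pairs up to [QHeq]. *)
Definition QH1 Q Th u : Prop :=
  [/\ Lp_on Th 2%:E u.1,
      measurable_vec Th u.2,
      Lp_on Th 2%:E (fun x => enorm (sqrtQ Q u.2 x)) &
      exists phi : nat -> E -> R, (forall j, LipQ Q Th (phi j)) /\
        QHnorm Q Th (fun x => phi j x - u.1 x, fun x => grad (phi j) x - u.2 x)
          @[j --> \oo] --> 0%E].

Definition QHeq Q Th u v : Prop :=
  {ae mu, forall x, Th x -> u.1 x = v.1 x} /\
  {ae mu, forall x, Th x -> sqrtQ Q (fun y => u.2 y - v.2 y) x = 0}.

Definition QH0 : (E -> R) * (E -> E) := (fun=> 0, fun=> 0).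

Definition QHlincomb d (c : 'I_d -> R) (e : 'I_d -> (E -> R) * (E -> E)) :
    (E -> R) * (E -> E) :=
  (fun x => \sum_i c i * (e i).1 x, fun x => \sum_i c i *: (e i).2 x).

(* The image of the set S in QH^1(Th) has a basis of d elements. *)
Definition QHdim Q Th (S : set ((E -> R) * (E -> E))) (d : nat) : Prop :=
  exists e : 'I_d -> (E -> R) * (E -> E),
    [/\ forall i, S (e i),
        forall c, QHeq Q Th (QHlincomb c e) QH0 -> forall i, c i = 0 &
        forall u, S u -> exists c, QHeq Q Th u (QHlincomb c e)].

Definition avg (B : set E) f : R := (fine (mu B))^-1 * \int[mu]_(x in B) f x.

Definition eavg (B : set E) (f : E -> \bar R) : \bar R :=
  (((fine (mu B))^-1)%:E * \int[mu]_(x in B) f x)%E.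

Definition local_Poincare Om rho Q (r1 : E -> R) (p : R) : Prop :=
  exists C2 b : R, 0 < C2 /\ 1 <= b /\
  forall (y : E) (r : R), Om y -> 0 < r -> b * r < r1 y ->
  forall f, locally_lipschitz Om f ->
    let B := qball Om rho y r in
    let bB := qball Om rho y (b * r) in
    (eavg B (fun x => (`|f x - avg B f| `^ p)%:E) `^ p^-1
     <= (C2 * r)%:E *
        eavg bB (fun x => (enorm (sqrtQ Q (grad f) x) `^ p)%:E) `^ p^-1)%E.

Definition global_weak_Poincare Q Th (omega : R) : Prop :=
  exists2 C4 : R, 0 < C4 & forall f, LipQ Q Th f ->
    ((\int[mu]_(x in Th) (`|f x| `^ (2 * omega))%:E) `^ (2 * omega)^-1
     <= C4%:E * (\int[mu]_(x in Th) (enorm (sqrtQ Q (grad f) x) ^+ 2)%:E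
                 + \int[mu]_(x in Th) (`|f x| ^+ 2)%:E) `^ 2^-1)%E.

Definition subunit Q Th (W : E -> E) : Prop :=
  measurable_vec Th W /\
  {ae mu, forall x, Th x -> forall xi : E,
    dotv (W x) xi ^+ 2 <= dotv xi (xi *m Q x)}.

End degenerate_Sobolev_space.

Section Neumann_problem.
Context {R : realType} {n : nat}.
Local Notation E := 'rV[R]_n.+1.
Local Notation mu := (@lebesgue_rV R n).
Variables (Q : E -> 'M[R]_n.+1) (Th : set E).

Definition elliptic_matrix (P : E -> 'M[R]_n.+1) : Prop :=
  [/\ measurable_mx Th P,
      ess_bounded_on Th P,
      forall x, Th x -> psdmx (P x) &
      exists c1 C1 : R, 0 < c1 /\ 0 < C1 /\
      {ae mu, forall x, Th x -> forall xi : E,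
        c1 * dotv xi (xi *m Q x) <= dotv xi (xi *m P x)
          <= C1 * dotv xi (xi *m Q x)}].

(* [tuple_vf g W U] is g W u when U is the gradient component of u. *)
Definition tuple_vf K (g : 'I_K -> E -> R) (W : 'I_K -> E -> E) (U : E -> E)
    (x : E) : R :=
  \sum_i g i x * dotv (W i x) (U x).

Definition Neumann_rhs (f : E -> R) K (T : 'I_K -> E -> E) (g : 'I_K -> E -> R)
    (v : (E -> R) * (E -> E)) : R :=
  \int[mu]_(x in Th) (f x * v.1 x + tuple_vf g T v.2 x).

Definition Neumann_data (f : E -> R) K (T : 'I_K -> E -> E)
    (g : 'I_K -> E -> R) : Prop :=
  [/\ Lp_on Th 2%:E f,
      forall i, subunit Q Th (T i) &
      forall i, Lp_on Th 2%:E (g i)].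

Variables (P : E -> 'M[R]_n.+1) (N : nat).
Variables (Rv Sv : 'I_N -> E -> E) (G H : 'I_N -> E -> R) (F : E -> R).

(* The bilinear form of X u = - div (P grad u) + H R u + S'(G u) + F u. *)
Definition bilinear_form (u v : (E -> R) * (E -> E)) : R :=
  \int[mu]_(x in Th) (dotv (v.2 x) (u.2 x *m P x)
                      + v.1 x * tuple_vf H Rv u.2 x
                      + u.1 x * tuple_vf G Sv v.2 x
                      + F x * u.1 x * v.1 x).

Definition adjoint_form u v : R := bilinear_form v u.

Definition weak_solution (f : E -> R) K (T : 'I_K -> E -> E)
    (g : 'I_K -> E -> R) (u : (E -> R) * (E -> E)) : Prop :=
  QH1 Q Th u /\
  forall v, QH1 Q Th v -> bilinear_form u v = Neumann_rhs f T g v.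

Definition homogeneous_solutions : set ((E -> R) * (E -> E)) :=
  [set u | QH1 Q Th u /\ forall v, QH1 Q Th v -> bilinear_form u v = 0].

Definition adjoint_solutions : set ((E -> R) * (E -> E)) :=
  [set w | QH1 Q Th w /\ forall v, QH1 Q Th v -> adjoint_form w v = 0].

Definition uniquely_solvable : Prop :=
  forall (f : E -> R) (K : nat) (T : 'I_K -> E -> E) (g : 'I_K -> E -> R),
    Neumann_data f T g ->
    (exists u, weak_solution f T g u) /\
    (forall u u', weak_solution f T g u -> weak_solution f T g u' ->
      QHeq Q Th u u').

Definition has_nontrivial_solution : Prop :=
  exists u, homogeneous_solutions u /\ ~ QHeq Q Th u QH0.

End Neumann_problem.

(* Main.v *)
From HB Require Import structures.
Require Import Defs.
From mathcomp Require Import all_boot all_order all_algebra.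
From mathcomp Require Import all_classical all_reals all_analysis.
From mathcomp Require Import measurable_realfun ess_sup_inf ring lra.
From mathcomp Require complex.

Set Implicit Arguments.
Unset Strict Implicit.
Unset Printing Implicit Defensive.

Import Order.TTheory GRing.Theory Num.Theory.
Import numFieldNormedType.Exports.
Local Open Scope classical_set_scope.
Local Open Scope ring_scope.

(** The theorem is a Fredholm alternative, and its reason is that the bilinear
    form of the operator is a finite rank perturbation of a coercive form on a
    Hilbert space.

    The Hilbert space is [QH1] with the inner product [ipQ]. It consists of pairs
    of a function and a gradient, not of classes of pairs, so that [ipQ] is only
    positive semidefinite; what vanishes for it is what [QHeq] identifies with
    zero ([ipQ_eq0]). Completeness ([QH1_complete]) is the Riesz-Fischer argument.
    As [Q] may degenerate, gradients converge only after multiplication by the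
    square root of [Q], and the limit gradient has to be selected measurably; this
    is done by regularized inverses of [Q] ([resolvent_cvg], [pair_lim_cvg]).
    With it come the Riesz and Lax-Milgram theorems ([Riesz_on],
    [Lax_Milgram_on]). That Lipschitz functions belong to this space rests on the
    almost everywhere existence of their partial derivatives
    ([locally_lipschitz_partial_ae]), which Fubini's theorem reduces to the line.

    The global Poincare inequality gains integrability, so that by Hoelder's
    inequality a weight in the Lebesgue space with the conjugate exponent defines
    a quadratic form that is infinitesimally small with respect to the norm of
    [QH1], modulo the norm of [L^2] ([QH1_weighted_small]). The coefficients of the
    lower order terms are such weights. Hence the form is bounded
    ([form_bounded]) and coercive up to a multiple of the [L^2] norm
    ([form_Garding]).

    The [L^2] norm is in turn controlled, up to a small multiple of the norm of
    [QH1], by finitely many bounded functionals ([QH1_compact]); this inequality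
    expresses the compactness of the embedding in [L^2]. Away from the boundary
    [Th] is covered by quasimetric balls of a small radius whose enlargements
    overlap a bounded number of times, because of the doubling property
    ([controlled_covering]). On each ball the local Poincare inequality bounds the
    mean square by a small multiple of the energy and the square of the average,
    which is the square of a functional ([local_estimate]). Near the boundary the
    gain of integrability makes the [L^2] norm small ([QH1_weighted_vanishing]).

    Adding the squares of these functionals to the form therefore makes it
    coercive. Solving the coercive problem turns the original one into a linear
    system with a square matrix, the adjoint problem into the system with the
    transposed matrix, and the alternative into the equality of row rank and
    column rank ([finite_rank_Fredholm]). *)

(** * Fredholm alternative for finite-rank perturbations of coercive forms *)

Section linear_on_submodule.
Variables (R : realType) (V : lmodType R) (S : set V).

(** Linearity is relative to a submodule [S]: spaces such as [QH1] are sets of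
    pairs of functions, taken without passing to a quotient. *)
Definition linear_on (l : V -> R) : Prop :=
  forall a u v, S u -> S v -> l (a *: u + v) = a * l u + l v.

Definition bilinear_on (b : V -> V -> R) : Prop :=
  (forall u, S u -> linear_on (b u)) /\ (forall v, S v -> linear_on (b ^~ v)).

Hypothesis S0 : S 0.
Hypothesis Slin : forall a u v, S u -> S v -> S (a *: u + v).

Lemma submodZ a u : S u -> S (a *: u).
Proof. by move=> Su; rewrite -[_ *: _]addr0; exact: Slin. Qed.

Lemma submodD u v : S u -> S v -> S (u + v).
Proof. by move=> Su Sv; rewrite -[u]scale1r; exact: Slin. Qed.

Lemma submodB u v : S u -> S v -> S (u - v).
Proof. by move=> Su Sv; rewrite addrC -scaleN1r; exact: Slin. Qed.

Lemma submod_sum d (c : 'I_d -> R) (e : 'I_d -> V) :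
  (forall i, S (e i)) -> S (\sum_i c i *: e i).
Proof.
by move=> Se; apply: (big_ind S) => //; [exact: submodD|move=> i _; exact: submodZ].
Qed.

Section functional.
Variable l : V -> R.
Hypothesis ll : linear_on l.

Lemma linear_on0 : l 0 = 0.
Proof. by have := ll (-1) S0 S0; rewrite scaler0 addr0 mulN1r addNr. Qed.

Lemma linear_onZ a u : S u -> l (a *: u) = a * l u.
Proof. by move=> Su; rewrite -[_ *: _]addr0 ll// linear_on0 addr0. Qed.

Lemma linear_onD u v : S u -> S v -> l (u + v) = l u + l v.
Proof. by move=> Su Sv; rewrite -[u]scale1r ll// scale1r mul1r. Qed.

Lemma linear_onB u v : S u -> S v -> l (u - v) = l u - l v.
Proof. by move=> Su Sv; rewrite addrC -scaleN1r ll// mulN1r addrC. Qed.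

Lemma linear_on_sum d (c : 'I_d -> R) (e : 'I_d -> V) :
  (forall i, S (e i)) -> l (\sum_i c i *: e i) = \sum_i c i * l (e i).
Proof.
move=> Se.
suff [] : S (\sum_i c i *: e i) /\
  l (\sum_i c i *: e i) = \sum_i c i * l (e i) by [].
apply: (big_ind2 (fun x y => S x /\ l x = y)).
- by split=> //; exact: linear_on0.
- by move=> x1 x2 y1 y2 [Sx <-] [Sy <-]; split; [exact: submodD|exact: linear_onD].
- by move=> i _; split; [exact: submodZ|exact: linear_onZ].
Qed.

End functional.

Lemma bilinear_on_flip b : bilinear_on b -> bilinear_on (fun u v => b v u).
Proof. by case. Qed.

End linear_on_submodule.

Section semi_Hilbert.
Variables (R : realType) (V : lmodType R) (S : set V) (ip : V -> V -> R).
Local Notation q u := (ip u u).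
Hypothesis S0 : S 0.
Hypothesis Slin : forall a u v, S u -> S v -> S (a *: u + v).
Hypothesis ip_bilin : bilinear_on S ip.
Hypothesis ip_sym : forall u v, S u -> S v -> ip u v = ip v u.
Hypothesis ip_ge0 : forall u, S u -> 0 <= q u.

Local Notation SB := (submodB Slin).
Local Notation SD := (submodD Slin).
Local Notation SZ := (submodZ S0 Slin).

(** Scaling [u] turns an additive bound, which comes from a pointwise
    arithmetic-geometric inequality, into a Cauchy-Schwarz inequality. *)
Lemma scaled_bound (b : V -> V -> R) (K : R) : bilinear_on S b -> 0 < K ->
  (forall u v, S u -> S v -> `|b u v| <= K * (q u + q v)) ->
  forall u v, S u -> S v -> b u v ^+ 2 <= 4 * K ^+ 2 * q u * q v.
Proof.
move=> [bl br] K0 bK u v Su Sv.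
have qZ s : q (s *: u) = s ^+ 2 * q u.
  rewrite (linear_onZ S0 (ip_bilin.1 _ (SZ s Su)))//.
  by rewrite (linear_onZ S0 (ip_bilin.2 _ Su))// expr2 mulrA.
have H s : 0 <= s -> s * `|b u v| <= K * (s ^+ 2 * q u + q v).
  move=> s0; rewrite -qZ.
  by have := bK _ _ (SZ s Su) Sv; rewrite (linear_onZ S0 (br _ Sv))// normrM ger0_norm.
rewrite -(real_normK (num_real (b u v))).
have := ip_ge0 Su; have := ip_ge0 Sv; move: (q u) (q v) H => x y H y0 x0.
have [x00|xN0] := eqVneq x 0.
  have [->|bN0] := eqVneq `|b u v| 0; first by rewrite x00 expr2; nra.
  have b0 : 0 < `|b u v| by rewrite lt_def bN0 normr_ge0.
  have := H ((K * y + 1) / `|b u v|).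
  rewrite divfK ?gt_eqF// x00 mulr0 add0r => h.
  suff: K * y + 1 <= K * y by lra.
  by apply: h; rewrite divr_ge0//; nra.
have xp : 0 < x by rewrite lt_def xN0.
have xK : 0 < 2 * K * x by nra.
have /H h : 0 <= `|b u v| / (2 * K * x) by rewrite divr_ge0// ltW.
have e1 : `|b u v| / (2 * K * x) * `|b u v| = `|b u v| ^+ 2 / (2 * K * x) by field; lra.
have e2 : K * ((`|b u v| / (2 * K * x)) ^+ 2 * x + y) =
  (`|b u v| ^+ 2 / (2 * K * x)) / 2 + K * y by field; apply/andP; split; lra.
rewrite e1 e2 in h.
have {}h : `|b u v| ^+ 2 / (2 * K * x) <= 2 * K * y by lra.
rewrite ler_pdivrMr// in h.
have <- : 2 * K * y * (2 * K * x) = 4 * K ^+ 2 * x * y by ring.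
exact: h.
Qed.

Lemma Cauchy_Schwarz_on u v : S u -> S v -> ip u v ^+ 2 <= q u * q v.
Proof.
move=> Su Sv.
have h : forall u v, S u -> S v -> `|ip u v| <= 2^-1 * (q u + q v).
  move=> x y Sx Sy; rewrite ler_norml; apply/andP; split.
    have := ip_ge0 (SD Sx Sy).
    rewrite (linear_onD (ip_bilin.1 _ (SD Sx Sy)))//.
    rewrite (linear_onD (ip_bilin.2 _ Sx))//.
    rewrite (linear_onD (ip_bilin.2 _ Sy))// (ip_sym Sy Sx); lra.
  have := ip_ge0 (SB Sx Sy).
  rewrite (linear_onB (ip_bilin.1 _ (SB Sx Sy)))//.
  rewrite (linear_onB (ip_bilin.2 _ Sx))//.
  rewrite (linear_onB (ip_bilin.2 _ Sy))// (ip_sym Sy Sx); lra.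
have := scaled_bound ip_bilin _ h Su Sv.
have -> : 4 * 2^-1 ^+ 2 = 1 :> R by rewrite expr2; lra.
by rewrite mul1r; apply; rewrite invr_gt0.
Qed.

(** [ip] is only positive semidefinite, so that limits are unique up to vectors
    of seminorm zero. *)
Definition semi_complete : Prop :=
  forall u_ : nat -> V, (forall k, S (u_ k)) ->
  (forall e : R, 0 < e -> exists n, forall j k, (n <= j)%N -> (n <= k)%N ->
     q (u_ j - u_ k) <= e) ->
  exists2 u, S u & forall e : R, 0 < e -> exists n, forall k, (n <= k)%N ->
     q (u_ k - u) <= e.
Hypothesis complete : semi_complete.

Lemma ip_expandD t u v : S u -> S v ->
  q (u + t *: v) = q u + 2 * t * ip u v + t ^+ 2 * q v.
Proof.
move=> Su Sv; have Stv := SZ t Sv.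
rewrite (linear_onD (ip_bilin.1 _ (SD Su Stv)))//.
rewrite (linear_onD (ip_bilin.2 _ Su))//.
rewrite (linear_onD (ip_bilin.2 _ Stv))//.
rewrite (linear_onZ S0 (ip_bilin.1 _ Stv))// (linear_onZ S0 (ip_bilin.1 _ Su))//.
rewrite (linear_onZ S0 (ip_bilin.2 _ Su))// (linear_onZ S0 (ip_bilin.2 _ Sv))//.
by rewrite (ip_sym Sv Su); ring.
Qed.

Lemma small_eq0 (x : R) : (forall e : R, 0 < e -> x ^+ 2 <= e) -> x = 0.
Proof.
move=> h; apply/eqP; rewrite -sqrf_eq0 eq_le sqr_ge0 andbT.
by apply/ler_addgt0Pr => e; rewrite add0r; exact: h.
Qed.

Lemma inv_nat_small (e : R) : 0 < e ->
  exists n, forall k, (n <= k)%N -> k.+1%:R^-1 <= e :> R.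
Proof.
move=> e0; exists (Num.truncn e^-1).+1 => k nk.
rewrite -[leRHS]invrK lef_pV2 ?posrE ?invr_gt0//.
apply: (le_trans (ltW (truncnS_gt _))).
by rewrite ler_nat; exact: leq_trans nk _.
Qed.

(** The representative of [phi] is the limit of a minimizing sequence of
    [ip v v - 2 phi v]; such a sequence is Cauchy by the parallelogram law. *)
Lemma Riesz_on (phi : V -> R) (K : R) : linear_on S phi -> 0 <= K ->
  (forall v, S v -> phi v ^+ 2 <= K * q v) ->
  exists2 r, S r & forall v, S v -> ip r v = phi v.
Proof.
move=> lphi K0 phiK.
pose J v := q v - 2 * phi v.
have JK v : S v -> - K <= J v.
  move=> Sv; rewrite /J; have := phiK v Sv; have := ip_ge0 Sv.
  move: (q v) (phi v) => x y x0 yx.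
  rewrite leNgt; apply/negP => h.
  have : (x + K) ^+ 2 < 4 * y ^+ 2.
    have : 0 < (2 * y - (x + K)) * (2 * y + (x + K)) by apply: mulr_gt0; lra.
    by rewrite !expr2; lra.
  by have := sqr_ge0 (x - K); rewrite !expr2 in yx *; nra.
pose A := [set J v | v in S].
have infA : has_inf A.
  split; first by exists (J 0), 0.
  by exists (- K) => _ [v Sv <-]; exact: JK.
have mA v : S v -> inf A <= J v by move=> Sv; apply: (ge_inf infA.2); exists v.
have /choice[v_ v_P] k : exists v, S v /\ J v < inf A + k.+1%:R^-1.
  have k0 : 0 < k.+1%:R^-1 :> R by rewrite invr_gt0.
  have [_ [v Sv <-] h] := inf_adherent k0 infA.
  by exists v.
have Sv_ k : S (v_ k) := (v_P k).1.
have JD t u v : S u -> S v ->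
    J (u + t *: v) = J u + 2 * t * (ip u v - phi v) + t ^+ 2 * q v.
  move=> Su Sv; rewrite /J ip_expandD// (linear_onD lphi)//; last exact: SZ.
  by rewrite (linear_onZ S0 lphi)//; ring.
have [|r Sr rP] := complete Sv_.
  move=> e e0.
  have e4 : 0 < e / 4 by rewrite divr_gt0.
  have [n nP] := inv_nat_small e4; exists n => j k nj nk.
  have Sd := SB (Sv_ k) (Sv_ j).
  have mid := mA _ (SD (Sv_ j) (SZ 2^-1 Sd)).
  have := JD 1 _ _ (Sv_ j) Sd; rewrite scale1r addrC subrK => Jk.
  rewrite (JD 2^-1 _ _ (Sv_ j) Sd) in mid.
  have qN : q (v_ j - v_ k) = q (v_ k - v_ j).
    have e1 : v_ j - v_ k = 0 + (-1) *: (v_ k - v_ j).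
      by rewrite add0r scaleN1r opprB.
    rewrite e1 ip_expandD// (linear_on0 S0 (ip_bilin.1 _ S0)).
    by rewrite (linear_on0 S0 (ip_bilin.2 _ Sd)); ring.
  rewrite qN; have := nP j nj; have := nP k nk.
  have := (v_P j).2; have := (v_P k).2.
  rewrite Jk; move: mid (k.+1%:R^-1) (j.+1%:R^-1); move: (J (v_ j)) (q _) => X Z.
  move: (_ - phi _) (inf A) => Y m mid x y; rewrite !expr2 in mid *; lra.
exists r => // w Sw.
apply/eqP; rewrite -subr_eq0; apply/eqP/small_eq0 => e e0.
have qw := ip_ge0 Sw.
have [e'0 e'q] : 0 < e / (4 * (q w + 1)) /\ 4 * (e / (4 * (q w + 1))) * q w <= e.
  split; first by rewrite divr_gt0//; lra.
  rewrite [leLHS](_ : _ = e * (q w / (q w + 1))); last by field; lra.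
  by apply: ler_piMr; [exact: ltW|rewrite ler_pdivrMr; lra].
have [n1 n1P] := inv_nat_small e'0.
have [n2 n2P] := rP _ e'0.
pose k := maxn n1 n2; have k1 := n1P k (leq_maxl _ _); have k2 := n2P k (leq_maxr _ _).
pose x := ip (v_ k) w - phi w.
have vk := (v_P k).2; move: (k.+1%:R^-1) k1 vk => dk k1 vk.
have xq : x ^+ 2 <= dk * q w.
  have H t : 0 <= dk + 2 * t * x + t ^+ 2 * q w.
    by have := mA _ (SD (Sv_ k) (SZ t Sw)); rewrite (JD t _ _ (Sv_ k) Sw) -/x; lra.
  have [q0|qN0] := eqVneq (q w) 0.
    have := H (- (dk + 1) / (2 * x)); rewrite q0 !mulr0 addr0.
    have [->|x0] := eqVneq x 0; first by rewrite expr2 mulr0.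
    rewrite [X in 0 <= X -> _](_ : _ = - 1); first lra.
    by field.
  have qp : 0 < q w by rewrite lt_def qN0.
  have := H (- x / q w).
  rewrite [X in 0 <= X -> _](_ : _ = dk - x ^+ 2 / q w); last by field.
  by rewrite subr_ge0 ler_pdivrMr.
have yq : ip (v_ k - r) w ^+ 2 <= e / (4 * (q w + 1)) * q w.
  apply: (le_trans (Cauchy_Schwarz_on (SB (Sv_ k) Sr) Sw)).
  exact: ler_wpM2r.
have -> : ip r w - phi w = x - ip (v_ k - r) w.
  by rewrite /x (linear_onB (ip_bilin.2 _ Sw))//; ring.
have : x ^+ 2 <= e / (4 * (q w + 1)) * q w.
  by apply: le_trans xq _; exact: ler_wpM2r.
move: (ip (v_ k - r) w) yq => y yq xq'.
have := sqr_ge0 (x + y).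
have -> : (x + y) ^+ 2 = 2 * x ^+ 2 + 2 * y ^+ 2 - (x - y) ^+ 2 by ring.
lra.
Qed.

Lemma inv_geometric_small (x c e : R) : 0 <= x < 1 -> 0 < e ->
  exists n, forall k, (n <= k)%N -> x ^+ k * c <= e.
Proof.
move=> /andP[x0 x1] e0.
have xn : `|x| < 1 by rewrite ger0_norm.
have c0 : 0 < `|c| + 1 by rewrite ltr_wpDl.
have /cvgrPdist_le/(_ (e / (`|c| + 1)))[|n _ nP] := cvg_expr xn.
  by rewrite divr_gt0.
exists n => k nk; have := nP k nk.
rewrite /= sub0r normrN ger0_norm ?exprn_ge0// ler_pdivlMr// => h.
apply: le_trans h; rewrite ler_wpM2l ?exprn_ge0//.
by have := ler_norm c; lra.
Qed.

Lemma ip_sub u v : S u -> S v -> q (u - v) <= 2 * q u + 2 * q v.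
Proof.
move=> Su Sv; have := ip_expandD 1 Su Sv; have := ip_expandD (-1) Su Sv.
rewrite scale1r scaleN1r => -> h; have := ip_ge0 (SD Su Sv).
by rewrite h !expr2; lra.
Qed.

(** The residual of Richardson's iteration decays geometrically, and
    coercivity bounds the distance of two iterates by their residuals. *)
Lemma Lax_Milgram_on (a : V -> V -> R) (c M K : R) (phi : V -> R) :
  bilinear_on S a -> 0 < c -> 0 < M ->
  (forall u, S u -> c * q u <= a u u) ->
  (forall u v, S u -> S v -> a u v ^+ 2 <= M * q u * q v) ->
  linear_on S phi -> 0 <= K -> (forall v, S v -> phi v ^+ 2 <= K * q v) ->
  exists2 u, S u & forall v, S v -> a u v = phi v.
Proof.
move=> alin c0 M0' coer abnd' lphi K0 phiK.
pose M1 := Num.max M (2 * c ^+ 2).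
have M0 : 0 < M1 by rewrite lt_max M0'.
have Mc : 2 * c ^+ 2 <= M1 by rewrite le_max lexx orbT.
have abnd u v : S u -> S v -> a u v ^+ 2 <= M1 * q u * q v.
  move=> Su Sv; apply: (le_trans (abnd' _ _ Su Sv)).
  rewrite !ler_wpM2r ?ip_ge0//.
  by rewrite le_max lexx.
clear abnd' M0'; move: M1 M0 Mc abnd => {}M M0 Mc abnd.
have [r rP] : exists r : V -> V, forall u, S u -> S (r u) /\
    forall v, S v -> ip (r u) v = phi v - a u v.
  suff: forall u, exists ru, S u -> S ru /\
    forall v, S v -> ip ru v = phi v - a u v by move=> /choice[r rP]; exists r.
  move=> u; have [Su|nSu] := pselect (S u); last by exists 0.
  have [||v Sv|ru Sru ruP] := @Riesz_on (fun v => phi v - a u v) (2 * (K + M * q u)).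
  - by move=> t x y Sx Sy; rewrite lphi// (alin.1 _ Su)//; ring.
  - by rewrite mulr_ge0// addr_ge0// mulr_ge0 ?ip_ge0// ltW.
  - have := phiK v Sv; have := abnd u v Su Sv; have := sqr_ge0 (phi v + a u v).
    by rewrite !expr2; lra.
  - by exists ru.
pose tau := c / M; have tau0 : 0 < tau by rewrite divr_gt0.
pose u_ := fix loop k := if k is k'.+1 then loop k' + tau *: r (loop k') else 0.
have Su_ k : S (u_ k).
  by elim: k => [//|k IH] /=; apply: SD => //; apply: SZ; exact: (rP _ IH).1.
pose d_ k := r (u_ k).
have Sd k : S (d_ k) := (rP _ (Su_ k)).1.
have dP k v : S v -> ip (d_ k) v = phi v - a (u_ k) v := (rP _ (Su_ k)).2 v.
pose th := 1 - c ^+ 2 / M.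
have th01 : 0 <= th < 1.
  have h1 : 0 < c ^+ 2 / M by rewrite divr_gt0 ?exprn_gt0.
  have h2 : c ^+ 2 / M <= 1 by rewrite ler_pdivrMr//; have := sqr_ge0 c; lra.
  by rewrite /th; apply/andP; split; lra.
have dth k : q (d_ k.+1) <= th * q (d_ k).
  pose w := tau^-1 *: (d_ k - d_ k.+1).
  have Sw : S w by apply: SZ; exact: SB.
  have wP v : S v -> ip w v = a (d_ k) v.
    move=> Sv; rewrite (linear_onZ S0 (ip_bilin.2 _ Sv)); last exact: SB.
    rewrite (linear_onB (ip_bilin.2 _ Sv))// !dP//=.
    rewrite (linear_onD (alin.2 _ Sv))//; last exact: SZ (Sd k).
    rewrite (linear_onZ S0 (alin.2 _ Sv)) ?/d_; last exact: Sd k.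
    apply: (mulfI (lt0r_neq0 tau0)); rewrite mulVKf ?lt0r_neq0//; ring.
  have qw : q w <= M * q (d_ k).
    have := abnd _ _ (Sd k) Sw; rewrite -wP// => h.
    have := ip_ge0 Sw; rewrite le_eqVlt => /orP[/eqP <-|qw0].
      by rewrite mulr_ge0 ?ip_ge0 ?ltW.
    by rewrite expr2 ler_pM2r in h.
  have -> : d_ k.+1 = d_ k + (- tau) *: w.
    rewrite /w scalerA mulNr mulfV ?gt_eqF// scaleN1r opprB addrC subrK//.
  rewrite ip_expandD// (ip_sym (Sd k) Sw) wP//.
  have h1 := coer _ (Sd k).
  have h2 : tau ^+ 2 * q w <= tau ^+ 2 * (M * q (d_ k)).
    by rewrite ler_wpM2l ?sqr_ge0.
  have h3 : tau * (c * q (d_ k)) <= tau * a (d_ k) (d_ k) by rewrite ler_pM2l.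
  have e1 : tau ^+ 2 * (M * q (d_ k)) = c ^+ 2 / M * q (d_ k).
    by rewrite /tau; field; rewrite gt_eqF.
  have e2 : tau * (c * q (d_ k)) = c ^+ 2 / M * q (d_ k).
    by rewrite /tau; field; rewrite gt_eqF.
  rewrite sqrrN /th; rewrite e1 in h2; rewrite e2 in h3; lra.
have dq k : q (d_ k) <= th ^+ k * q (d_ 0).
  elim: k => [|k IH]; first by rewrite expr0 mul1r.
  apply: (le_trans (dth k)); rewrite exprS -mulrA ler_wpM2l//.
  by case/andP: th01.
have [|u Su uP] := complete Su_.
  move=> e e0.
  have e0' : 0 < e * c ^+ 2 / 4 by rewrite divr_gt0// mulr_gt0// exprn_gt0.
  have [n nP] := inv_geometric_small (q (d_ 0)) th01 e0'.
  exists n => j k nj nk.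
  have Sjk : S (u_ j - u_ k) by exact: SB.
  have Sdkj : S (d_ k - d_ j) by exact: SB.
  have h1 : q (d_ k - d_ j) <= e * c ^+ 2.
    apply: (le_trans (ip_sub (Sd k) (Sd j))).
    have := dq j; have := dq k; have := nP j nj; have := nP k nk; lra.
  have h2 : ip (d_ k - d_ j) (u_ j - u_ k) = a (u_ j - u_ k) (u_ j - u_ k).
    rewrite (linear_onB (ip_bilin.2 _ Sjk))// !dP//.
    by rewrite (linear_onB (alin.2 _ Sjk))//; ring.
  have h3 := coer _ Sjk; rewrite -h2 in h3.
  have h4 := Cauchy_Schwarz_on Sdkj Sjk.
  have := ip_ge0 Sjk; rewrite le_eqVlt => /orP[/eqP <-|qp]; first exact: ltW.
  have h5 : (c * q (u_ j - u_ k)) ^+ 2 <= e * c ^+ 2 * q (u_ j - u_ k).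
    apply: (@le_trans _ _ (ip (d_ k - d_ j) (u_ j - u_ k) ^+ 2)).
      by rewrite ler_pXn2r// ?nnegrE ?mulr_ge0 ?ltW//; apply: lt_le_trans h3;
        rewrite mulr_gt0.
    by apply: (le_trans h4); rewrite ler_wpM2r// ltW.
  have e1 : (c * q (u_ j - u_ k)) ^+ 2 = c ^+ 2 * q (u_ j - u_ k) * q (u_ j - u_ k).
    by ring.
  rewrite e1 ler_pM2r// mulrC ler_pM2r// in h5.
  exact: exprn_gt0.
exists u => // v Sv.
apply/eqP; rewrite -subr_eq0; apply/eqP/small_eq0 => e e0.
have qv := ip_ge0 Sv.
have [e1 e1e] : exists2 e1, 0 < e1 & 2 * (M + 1) * e1 * q v <= e.
  exists (e / (2 * (M + 1) * (q v + 1))).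
    by rewrite divr_gt0// mulr_gt0//; [rewrite mulr_gt0//|]; lra.
  rewrite [leLHS](_ : _ = e * (q v / (q v + 1))); last by field; apply/andP; split; lra.
  by apply: ler_piMr; [exact: ltW|rewrite ler_pdivrMr; lra].
have [n1 n1P] := inv_geometric_small (q (d_ 0)) th01 e1e.
have [n2 n2P] := uP _ e1e.
pose k := maxn n1 n2; have k1 := n1P k (leq_maxl _ _); have k2 := n2P k (leq_maxr _ _).
move=> he.
have -> : a u v - phi v = - ip (d_ k) v - a (u_ k - u) v.
  by rewrite dP// (linear_onB (alin.2 _ Sv))//; ring.
have h1 : ip (d_ k) v ^+ 2 <= e1 * q v.
  apply: (le_trans (Cauchy_Schwarz_on (Sd k) Sv)); rewrite ler_wpM2r//.
  exact: le_trans (dq k) k1.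
have h2 : a (u_ k - u) v ^+ 2 <= M * e1 * q v.
  apply: (le_trans (abnd _ _ (SB (Su_ k) Su) Sv)); rewrite ler_wpM2r//.
  by rewrite ler_pM2l.
have := sqr_ge0 (ip (d_ k) v - a (u_ k - u) v).
move: (ip (d_ k) v) (a (u_ k - u) v) h1 h2 => x y h1 h2; rewrite !expr2 in h1 h2 *; lra.
Qed.

End semi_Hilbert.

Section Fredholm.
Variables (R : realType) (V : lmodType R) (S : set V) (ip : V -> V -> R).
Local Notation q u := (ip u u).
Hypothesis S0 : S 0.
Hypothesis Slin : forall a u v, S u -> S v -> S (a *: u + v).
Hypothesis ip_bilin : bilinear_on S ip.
Hypothesis ip_sym : forall u v, S u -> S v -> ip u v = ip v u.
Hypothesis ip_ge0 : forall u, S u -> 0 <= q u.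
Hypothesis complete : semi_complete S ip.

Definition null_space (b : V -> V -> R) : set V :=
  [set u | S u /\ forall v, S v -> b u v = 0].

(** The dimension of the image of [N] in the quotient by the vectors of seminorm
    zero. *)
Definition has_dim (N : set V) (d : nat) : Prop :=
  exists e : 'I_d -> V,
    [/\ forall i, N (e i),
        forall c, q (\sum_i c i *: e i) = 0 -> forall i, c i = 0 &
        forall u, N u -> exists c, q (u - \sum_i c i *: e i) = 0].

Section one_sided.
Variables (b : V -> V -> R) (m : nat) (l : 'I_m -> V -> R) (c0 M : R).
Hypothesis b_bilin : bilinear_on S b.
Hypothesis l_lin : forall i, linear_on S (l i).
Hypothesis c00 : 0 < c0.
Hypothesis M0 : 0 < M.
Hypothesis l_bnd : forall i v, S v -> l i v ^+ 2 <= M * q v.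
Let a u v := b u v + \sum_i l i u * l i v.
Hypothesis a_bnd : forall u v, S u -> S v -> a u v ^+ 2 <= M * q u * q v.
Hypothesis a_coer : forall u, S u -> c0 * q u <= a u u.

Lemma perturbed_bilin : bilinear_on S a.
Proof.
split=> [u Su|v Sv] t x y Sx Sy; rewrite /a.
  rewrite (b_bilin.1 _ Su)// mulrDr mulr_sumr addrACA -big_split/=; congr (_ + _).
  by apply: eq_bigr => i _; rewrite l_lin//; ring.
rewrite (b_bilin.2 _ Sv)// mulrDr mulr_sumr addrACA -big_split/=; congr (_ + _).
by apply: eq_bigr => i _; rewrite l_lin//; ring.
Qed.

Lemma perturbed_solve (phi : V -> R) (K : R) : linear_on S phi -> 0 <= K ->
  (forall v, S v -> phi v ^+ 2 <= K * q v) ->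
  exists2 u, S u & forall v, S v -> a u v = phi v.
Proof.
exact: (Lax_Milgram_on S0 Slin ip_bilin ip_sym ip_ge0 complete perturbed_bilin
  c00 M0 a_coer a_bnd).
Qed.

(** The solutions for the functionals themselves span the finite dimensional
    space in which the problem for [b] is decided. *)
Lemma perturbed_basis : exists e : 'I_m -> V, forall i, S (e i) /\
  forall v, S v -> a (e i) v = l i v.
Proof.
suff /choice[e eP] : forall i, exists u, S u /\ forall v, S v -> a u v = l i v.
  by exists e.
move=> i.
have [u Su uP] := perturbed_solve (l_lin i) (ltW M0) (l_bnd i).
by exists u.
Qed.

Lemma linear_on_null (f : V -> R) (K : R) u :
  (forall v, S v -> f v ^+ 2 <= K * q v) -> S u -> q u = 0 -> f u = 0.
Proof.
move=> fK Su qu; apply/eqP; rewrite -sqrf_eq0 eq_le sqr_ge0 andbT.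
by apply: le_trans (fK _ Su) _; rewrite qu mulr0.
Qed.

Variable e : 'I_m -> V.
Hypothesis Se : forall i, S (e i).
Hypothesis eP : forall i v, S v -> a (e i) v = l i v.
Let Mx : 'M[R]_m := \matrix_(i, j) l j (e i).

Let l_comb (c : 'rV[R]_m) j : l j (\sum_i c 0 i *: e i) = (c *m Mx) 0 j.
Proof.
rewrite (linear_on_sum S0 Slin (l_lin j))// mxE.
by apply: eq_bigr => i _; rewrite mxE.
Qed.

Let a_comb (c : 'rV[R]_m) v : S v ->
  a (\sum_i c 0 i *: e i) v = \sum_i c 0 i * l i v.
Proof.
move=> Sv; rewrite (linear_on_sum S0 Slin (perturbed_bilin.2 _ Sv))//.
by apply: eq_bigr => i _; rewrite eP.
Qed.

(** A solution of [b u = phi] has the form [u0 + \sum_i c_i e_i], where [u0]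
    and the [e_i] solve the coercive problem, iff [c (1 - Mx)] is the row of
    the values of the functionals at [u0]. *)
Lemma finite_rank_solution (phi : V -> R) u0 (c : 'rV[R]_m) : S u0 ->
  (forall v, S v -> a u0 v = phi v) ->
  c *m (1%:M - Mx) = \row_j l j u0 ->
  forall v, S v -> b (u0 + \sum_i c 0 i *: e i) v = phi v.
Proof.
move=> Su0 u0P cP v Sv.
have Sc : S (\sum_i c 0 i *: e i) by exact: submod_sum.
have lc j : l j (u0 + \sum_i c 0 i *: e i) = c 0 j.
  rewrite (linear_onD (l_lin j))// l_comb.
  have := congr1 (fun r : 'rV_m => r 0 j) cP.
  by rewrite mulmxBr mulmx1 !mxE => <-; rewrite subrK.
have : a (u0 + \sum_i c 0 i *: e i) v = phi v + \sum_i c 0 i * l i v.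
  by rewrite (linear_onD (perturbed_bilin.2 _ Sv))// u0P// a_comb.
rewrite /a.
have -> : \sum_i l i (u0 + \sum_i c 0 i *: e i) * l i v = \sum_i c 0 i * l i v.
  by apply: eq_bigr => i _; rewrite lc.
exact: addIr.
Qed.

(** The values of the functionals at an element of the null space determine it
    up to seminorm zero, by coercivity of the perturbed form; the null space is
    thus the left kernel of [1 - Mx]. *)
Lemma null_space_coordinates u : null_space b u ->
  let c : 'rV[R]_m := \row_j l j u in
  c *m (1%:M - Mx) = 0 /\ q (u - \sum_i c 0 i *: e i) = 0.
Proof.
move=> [Su uP] c.
have Sc : S (\sum_i c 0 i *: e i) by exact: submod_sum.
have Sd : S (u - \sum_i c 0 i *: e i) by exact: (submodB Slin).
have q0 : q (u - \sum_i c 0 i *: e i) = 0.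
  apply/eqP; rewrite eq_le ip_ge0// andbT.
  rewrite -(ler_pM2l c00) mulr0; apply: (le_trans (a_coer Sd)).
  rewrite (linear_onB (perturbed_bilin.2 _ Sd))// a_comb// /a uP// add0r.
  by rewrite subr_le0; apply: ler_sum => i _; rewrite mxE.
split=> //; apply/rowP => j; rewrite mulmxBr mulmx1 mxE [RHS]mxE.
have := linear_on_null (l_bnd j) Sd q0.
by rewrite (linear_onB (l_lin j))// l_comb !mxE.
Qed.

Lemma null_space_has_dim : has_dim (null_space b) (\rank (kermx (1%:M - Mx))).
Proof.
set A := 1%:M - Mx.
pose B := row_base (kermx A).
have BA : B *m A = 0 by apply/sub_kermxP; rewrite eq_row_base.
pose f k := \sum_i B k i *: e i.
have fE k : f k = \sum_i (row k B) 0 i *: e i.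
  by apply: eq_bigr => i _; rewrite [in RHS]mxE.
have combE (c : 'I_(\rank (kermx A)) -> R) :
    \sum_k c k *: f k = \sum_i ((\row_k c k) *m B) 0 i *: e i.
  rewrite /f; under eq_bigr do rewrite scaler_sumr.
  rewrite exchange_big; apply: eq_bigr => i _; rewrite [in RHS]mxE scaler_suml.
  by apply: eq_bigr => k _; rewrite [in RHS]mxE scalerA.
have Sf k : S (f k) by exact: submod_sum.
exists f; split.
- move=> k; split=> // v Sv; rewrite fE.
  have := @finite_rank_solution (cst 0) 0 (row k B) S0 _ _ v Sv.
  rewrite add0r; apply.
    by move=> w Sw; rewrite (linear_on0 S0 (perturbed_bilin.2 _ Sw)).
  rewrite -row_mul BA row0; apply/rowP => j.
  by rewrite !mxE (linear_on0 S0 (l_lin j)).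
- move=> c qc i.
  suff: \row_k c k = 0 by move=> /rowP/(_ i); rewrite !mxE.
  apply: (row_free_injr (row_base_free (kermx A))); rewrite /= mul0mx -/B.
  have Sc : S (\sum_k c k *: f k) by exact: submod_sum.
  set r := _ *m B.
  have rA : r *m A = 0 by rewrite /r -mulmxA BA mulmx0.
  have rM : r *m Mx = 0.
    apply/rowP => j; rewrite -l_comb -combE mxE.
    exact: linear_on_null (l_bnd j) Sc qc.
  by move: rA; rewrite /A mulmxBr mulmx1 rM subr0.
move=> u Nu; have [cA qc] := null_space_coordinates Nu.
have : ((\row_j l j u : 'rV_m) <= B)%MS by rewrite eq_row_base; apply/sub_kermxP.
move=> /submxP[D DE]; exists (fun k => D 0 k).
rewrite combE; have -> : \row_k D 0 k = D by apply/rowP => k; rewrite mxE.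
by rewrite -DE.
Qed.

End one_sided.

(** The Fredholm alternative is the rank theorem for the square matrix
    [1 - Mx]: the adjoint problem has the transposed matrix. *)
Theorem finite_rank_Fredholm (b : V -> V -> R) (m : nat) (l : 'I_m -> V -> R)
    (c0 M : R) (a := fun u v => b u v + \sum_i l i u * l i v) :
  bilinear_on S b -> (forall i, linear_on S (l i)) -> 0 < c0 -> 0 < M ->
  (forall i v, S v -> l i v ^+ 2 <= M * q v) ->
  (forall u v, S u -> S v -> a u v ^+ 2 <= M * q u * q v) ->
  (forall u, S u -> c0 * q u <= a u u) ->
  let N := null_space b in let N' := null_space (fun u v => b v u) in
  (exists d, has_dim N d /\ has_dim N' d) /\
  forall (phi : V -> R) (K : R), linear_on S phi -> 0 <= K ->
    (forall v, S v -> phi v ^+ 2 <= K * q v) ->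
    (forall w, N' w -> phi w = 0) ->
    exists2 u, S u & forall v, S v -> b u v = phi v.
Proof.
move=> bb ll c00 M0 lb ab ac N N'.
pose a' u v := b v u + \sum_i l i u * l i v.
have aE u v : a' u v = a v u.
  by rewrite /a' /a; congr (_ + _); apply: eq_bigr => i _; rewrite mulrC.
have ab' u v : S u -> S v -> a' u v ^+ 2 <= M * q u * q v.
  by move=> Su Sv; rewrite aE mulrAC; exact: ab.
have ac' u : S u -> c0 * q u <= a' u u by move=> Su; rewrite aE; exact: ac.
have bb' := bilinear_on_flip bb.
have [e eP] := perturbed_basis bb ll c00 M0 lb ab ac.
have [e' e'P] := perturbed_basis bb' ll c00 M0 lb ab' ac'.
pose Mx : 'M[R]_m := \matrix_(i, j) l j (e i).
pose Mx' : 'M[R]_m := \matrix_(i, j) l j (e' i).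
have MxT : Mx' = Mx^T.
  apply/matrixP => i j; rewrite !mxE.
  have <- := (eP j).2 _ (e'P i).1; have <- := (e'P i).2 _ (eP j).1.
  exact/esym/aE.
split.
  exists (\rank (kermx (1%:M - Mx))); split.
    exact: (null_space_has_dim bb ll c00 lb ac (fun i => (eP i).1) (fun i => (eP i).2)).
  have := null_space_has_dim bb' ll c00 lb ac'
    (fun i => (e'P i).1) (fun i => (e'P i).2).
  rewrite -/Mx' MxT (_ : 1%:M - Mx^T = (1%:M - Mx)^T); last first.
    by rewrite linearB/= tr_scalar_mx.
  by rewrite mxrank_ker mxrank_tr -mxrank_ker.
move=> phi K lphi K0 phiK ortho.
have [u0 Su0 u0P] := perturbed_solve bb ll c00 M0 ab ac lphi K0 phiK.
pose r : 'rV[R]_m := \row_j l j u0.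
have : (r <= 1%:M - Mx)%MS.
  rewrite submxE; apply/eqP/rowP => k; rewrite [RHS]mxE.
  set C := cokermx _.
  have AC : (1%:M - Mx) *m C = 0 by exact: mulmx_coker.
  pose d : 'rV[R]_m := (col k C)^T.
  have dA : d *m (1%:M - Mx') = 0.
    rewrite MxT -[1%:M]tr_scalar_mx -linearB/= -trmx_mul.
    by rewrite colE mulmxA AC mul0mx trmx0.
  have Nw : N' (\sum_i d 0 i *: e' i).
    split; first by apply: submod_sum => // i; exact: (e'P i).1.
    move=> v Sv.
    have := @finite_rank_solution _ _ l bb' ll e' (fun i => (e'P i).1)
      (fun i => (e'P i).2) (cst 0) 0 d S0 _ _ v Sv.
    rewrite add0r; apply.
      move=> w Sw; rewrite (linear_on0 S0 (bb.1 _ Sw)) add0r big1// => i _.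
      by rewrite (linear_on0 S0 (ll i)) mul0r.
    rewrite -/Mx' dA; apply/rowP => j.
    by rewrite !mxE (linear_on0 S0 (ll j)).
  have := ortho _ Nw; rewrite -u0P; last exact: Nw.1.
  rewrite (linear_on_sum S0 Slin ((perturbed_bilin bb ll).1 _ Su0)); last first.
    by move=> i; exact: (e'P i).1.
  move=> <-; rewrite mxE; apply: eq_bigr => i _.
  rewrite -/(a u0 (e' i)) -aE /a' (e'P i).2// !mxE; ring.
move=> /submxP[c cE].
exists (u0 + \sum_i c 0 i *: e i).
  apply: submodD => //; apply: submod_sum => // i; exact: (eP i).1.
by apply: (finite_rank_solution bb ll (fun i => (eP i).1) (fun i => (eP i).2) Su0 u0P);
  rewrite -cE.
Qed.

End Fredholm.

(** * Positive semidefinite matrices *)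

Section dotv.
Context {R : realType} {m : nat}.
Implicit Types u v w : 'rV[R]_m.

Lemma dotvE u v : dotv u v = (u *m v^T) 0 0.
Proof. by rewrite mxE; apply: eq_bigr => i _; rewrite mxE. Qed.

Lemma dotvC u v : dotv u v = dotv v u.
Proof. by apply: eq_bigr => i _; rewrite mulrC. Qed.

Lemma dotvDl u v w : dotv (u + v) w = dotv u w + dotv v w.
Proof. by rewrite !dotvE mulmxDl mxE. Qed.

Lemma dotvDr u v w : dotv w (u + v) = dotv w u + dotv w v.
Proof. by rewrite dotvC dotvDl !(dotvC w). Qed.

Lemma dotvZl a u v : dotv (a *: u) v = a * dotv u v.
Proof. by rewrite !dotvE -scalemxAl mxE. Qed.

Lemma dotvZr a u v : dotv u (a *: v) = a * dotv u v.
Proof. by rewrite dotvC dotvZl dotvC. Qed.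

Lemma dotv0l w : dotv 0 w = 0.
Proof. by rewrite dotvE mul0mx mxE. Qed.

Lemma dotvBl u v w : dotv (u - v) w = dotv u w - dotv v w.
Proof. by rewrite -scaleN1r dotvDl dotvZl mulN1r. Qed.

Lemma dotv_ge0 u : 0 <= dotv u u.
Proof. by apply: sumr_ge0 => i _; rewrite -expr2 sqr_ge0. Qed.

Lemma dotv_eq0 u : dotv u u = 0 -> u = 0.
Proof.
move=> /eqP; rewrite psumr_eq0 => [/allP h|i _]; last by rewrite -expr2 sqr_ge0.
apply/rowP => i; have := h i (mem_index_enum i).
by rewrite -expr2 sqrf_eq0 mxE => /eqP.
Qed.

Lemma enorm_sqr u : enorm u ^+ 2 = dotv u u.
Proof. by rewrite sqr_sqrtr// dotv_ge0. Qed.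

Lemma dotv_mulmx u v (A : 'M[R]_m) : A^T = A -> dotv u (v *m A) = dotv (u *m A) v.
Proof. by move=> AT; rewrite !dotvE trmx_mul AT mulmxA. Qed.

Lemma entry_le_dotv u i : u 0 i ^+ 2 <= dotv u u.
Proof.
rewrite /dotv (bigD1 i)//= -expr2 lerDl; apply: sumr_ge0 => j _.
by rewrite -expr2 sqr_ge0.
Qed.

End dotv.

Section psd_form.
Context {R : realType} {m : nat}.
Variable A : 'M[R]_m.
Hypothesis hA : psdmx A.
Implicit Types u v w : 'rV[R]_m.

Lemma psd_formC u v : dotv u (v *m A) = dotv v (u *m A).
Proof. by rewrite (dotv_mulmx _ _ hA.1) dotvC. Qed.

Lemma psd_formD u v :
  dotv (u + v) ((u + v) *m A) =
  dotv u (u *m A) + 2 * dotv u (v *m A) + dotv v (v *m A).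
Proof. by rewrite mulmxDl !dotvDl !dotvDr (psd_formC v u); ring. Qed.

Lemma psd_formZ a u : dotv (a *: u) ((a *: u) *m A) = a ^+ 2 * dotv u (u *m A).
Proof. by rewrite -scalemxAl dotvZl dotvZr mulrA expr2. Qed.

Lemma psd_formN u : dotv (- u) ((- u) *m A) = dotv u (u *m A).
Proof. by rewrite -scaleN1r psd_formZ sqrrN expr1n mul1r. Qed.

Lemma psd_AMGM u v :
  `|dotv u (v *m A)| <= (dotv u (u *m A) + dotv v (v *m A)) / 2.
Proof.
have h1 := hA.2 (u + v); have h2 := hA.2 (u - v).
rewrite psd_formD in h1; rewrite psd_formD psd_formN mulNmx in h2.
rewrite -scaleN1r dotvZr in h2.
by rewrite ler_norml; apply/andP; split; lra.
Qed.

End psd_form.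

Section square_root.
Context {R : realType} {n : nat}.
Implicit Type A : 'M[R]_n.+1.

Lemma interpolation (s : seq R) (g : R -> R) :
  exists p : {poly R}, forall x, x \in s -> p.[x] = g x.
Proof.
elim: s => [|a s [p pP]]; first by exists 0.
have [as_|as_] := boolP (a \in s).
  by exists p => x; rewrite inE => /orP[/eqP ->|]; exact: pP.
pose w := \prod_(b <- s) ('X - b%:P).
have wa : w.[a] != 0 by rewrite -rootE root_prod_XsubC.
exists (p + ((g a - p.[a]) / w.[a]) *: w) => x; rewrite inE => /orP[/eqP ->|xs].
  by rewrite !hornerE divfK// addrC subrK.
have /eqP wx : w.[x] == 0 by rewrite -rootE root_prod_XsubC.
by rewrite !hornerE wx mulr0 addr0 pP.
Qed.

Lemma trmx_horner A (p : {poly R}) : A^T = A -> (horner_mx A p)^T = horner_mx A p.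
Proof.
move=> AT; elim/poly_ind: p => [|p c IH]; first by rewrite !rmorph0 trmx0.
rewrite !rmorphD !rmorphM/= horner_mx_X horner_mx_C linearD/= tr_scalar_mx.
congr (_ + _); rewrite [LHS]trmx_mul IH AT.
have : horner_mx A ('X * p) = horner_mx A (p * 'X) by rewrite mulrC.
by rewrite !rmorphM/= horner_mx_X.
Qed.

Section spectrum.
Import complex.
Variable A : 'M[R]_n.+1.
Hypothesis hA : psdmx A.
Let C : numClosedFieldType := R[i].
Let iota : {rmorphism R -> C} := real_complex R.
Let AC : 'M[C]_n.+1 := map_mx iota A.

(** The list of eigenvalues comes from the spectral theorem for the complexified
    matrix, which is Hermitian. *)
Lemma psd_spectrum : exists s : seq R, {in s, forall x, 0 <= x} /\
  forall p : {poly R}, (forall x, x \in s -> p.[x] = 0) -> horner_mx A p = 0.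
Proof.
have ACh : AC \is hermsymmx.
  apply: realsym_hermsym.
    apply/is_hermitianmxP; rewrite expr0 scale1r map_mx_id//.
    by rewrite /AC map_trmx hA.1.
  by apply/mxOverP => i j; rewrite mxE; apply/complex_realP; exists (A i j).
have dreal := hermitian_spectral_diag_real ACh.
have /orthomx_spectralP := hermitian_normalmx ACh.
set Pm := spectralmx AC; set d := spectral_diag AC => ACE.
have Pu : Pm \in unitmx := spectral_unit AC.
pose e i := complex.Re (d 0 i).
have dE i : d 0 i = iota (e i).
  by have /mxOverP/(_ 0 i)/RRe_real := dreal.
exists [seq e i | i <- enum 'I_n.+1]; split.
  move=> _ /mapP[i _ ->].
  have : eigenvalue AC (iota (e i)).
    apply/eigenvalueP; exists (row i Pm).
      rewrite -dE -row_mul {1}ACE !mulmxA mulmxV// mul1mx.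
      by rewrite row_mul row_diag_mx -scalemxAl -rowE.
    apply/eqP => r0; have := mulmxK Pu (delta_mx 0 i : 'rV[C]_n.+1).
    rewrite -rowE r0 mul0mx => /rowP/(_ i); rewrite !mxE !eqxx => /esym/eqP.
    by rewrite oner_eq0.
  rewrite eigenvalue_root_char -map_char_poly rootE horner_map fmorph_eq0 -rootE.
  rewrite -eigenvalue_root_char => /eigenvalueP[v vA v0].
  have := hA.2 v; rewrite vA dotvZr pmulr_lge0// lt_def dotv_ge0 andbT.
  by apply: contra v0 => /eqP/dotv_eq0 ->.
move=> p p0.
suff: map_mx iota (horner_mx A p) = 0.
  by move=> /eqP; rewrite map_mx_eq0 => /eqP.
rewrite map_horner_mx -/AC ACE horner_mx_uconjC// horner_mx_diag.
rewrite [X in diag_mx X](_ : _ = 0) ?linear0 ?mulmx0 ?mul0mx//.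
apply/rowP => i; rewrite !mxE dE horner_map p0 ?rmorph0//.
by apply/mapP; exists i => //; rewrite mem_enum.
Qed.

End spectrum.

(** The square root is [r(A)^2], where the real polynomial [r] interpolates
    the fourth root at the eigenvalues; being the square of a symmetric matrix,
    it is positive semidefinite. *)
Lemma psd_sqrt_exists A : psdmx A -> exists B : 'M[R]_n.+1, psdmx B /\ B *m B = A.
Proof.
move=> hA; have [s [s0 sP]] := psd_spectrum hA.
have [r rP] := interpolation s (fun x => Num.sqrt (Num.sqrt x)).
pose C := horner_mx A r; have CT : C^T = C by exact/trmx_horner/hA.1.
exists (C *m C); split.
  split; first by rewrite trmx_mul CT.
  by move=> v; rewrite mulmxA (dotv_mulmx _ _ CT) dotv_ge0.
have -> : C *m C *m (C *m C) = horner_mx A ((r ^+ 2) ^+ 2).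
  by rewrite !rmorphXn !expr2.
apply/eqP; rewrite -subr_eq0 -{2}[A]horner_mx_X -rmorphB; apply/eqP/sP => x xs.
rewrite !hornerE rP// sqr_sqrtr ?sqrtr_ge0// sqr_sqrtr ?subrr//.
exact: s0.
Qed.

Lemma sqrtmxP A : psdmx A -> psdmx (sqrtmx A) /\ sqrtmx A *m sqrtmx A = A.
Proof. by move=> /psd_sqrt_exists; exact: getPex. Qed.

Lemma enorm_sqrtmx A (v : 'rV[R]_n.+1) : psdmx A ->
  enorm (v *m sqrtmx A) ^+ 2 = dotv v (v *m A).
Proof.
move=> /sqrtmxP[[BT _] BB]; rewrite enorm_sqr -(dotv_mulmx _ _ BT).
by rewrite -mulmxA BB.
Qed.

End square_root.

Lemma real_Cauchy_cvg (R : realType) (x : nat -> R) :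
  (forall e : R, 0 < e -> exists n, forall j k, (n <= j)%N -> (n <= k)%N ->
    `|x j - x k| <= e) -> cvgn x.
Proof.
move=> h; apply/cauchy_cvgP/cauchy_ballP => _/posnumP[e].
have e2 : 0 < e%:num / 2 by [].
have [n nP] := h _ e2.
exists (x @` [set k | (n <= k)%N], x @` [set k | (n <= k)%N]).
  by split; exists n => // k nk; exists k.
move=> [_ _] [/= [j nj <-] [k nk <-]].
rewrite /ball/=; apply: le_lt_trans (nP j k nj nk) _.
by rewrite ltr_pdivrMr// ltr_pMr// ltr1n.
Qed.

Lemma cvg_fin_sum (R : realType) (T : Type) (F : set_system T) (FF : Filter F)
    (I : Type) (s : seq I) (f : I -> T -> R) (l : I -> R) :
  (forall i, f i x @[x --> F] --> l i) ->
  \sum_(i <- s) f i x @[x --> F] --> \sum_(i <- s) l i.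
Proof.
move=> h; elim: s => [|i s IH].
  by rewrite big_nil; under eq_cvg do rewrite big_nil; exact: cvg_cst.
rewrite big_cons; under eq_cvg do rewrite big_cons.
by apply: cvgD.
Qed.

Section psd_limits.
Context {R : realType} {n : nat}.
Variable A : 'M[R]_n.+1.
Hypothesis hA : psdmx A.

(** The [U_ j] need not converge, but their images under the square root of [A]
    do; the range of a matrix being closed, the limit has a preimage. *)
Lemma psd_complete (U_ : nat -> 'rV[R]_n.+1) :
  (forall e : R, 0 < e -> exists n0, forall j k, (n0 <= j)%N -> (n0 <= k)%N ->
    dotv (U_ j - U_ k) ((U_ j - U_ k) *m A) <= e) ->
  exists V, forall e : R, 0 < e -> exists n0, forall k, (n0 <= k)%N ->
    dotv (U_ k - V) ((U_ k - V) *m A) <= e.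
Proof.
move=> Cau.
set B := sqrtmx A; pose W_ j := U_ j *m B.
have qE (u : 'rV_n.+1) : dotv u (u *m A) = dotv (u *m B) (u *m B).
  by rewrite -enorm_sqr enorm_sqrtmx.
have cW i : cvgn (fun j => W_ j 0 i).
  apply: real_Cauchy_cvg => e e0.
  have [n0 n0P] := Cau _ (exprn_gt0 2 e0); exists n0 => j k nj nk.
  rewrite -ler_sqr ?nnegrE ?(ltW e0)// real_normK ?num_real//.
  apply: le_trans (n0P j k nj nk); rewrite qE mulmxBl.
  by apply: le_trans (entry_le_dotv _ i); rewrite /W_ !mxE.
pose W : 'rV_n.+1 := \row_i limn (fun j => W_ j 0 i).
have WP i : W_ j 0 i @[j --> \oo] --> W 0 i by rewrite mxE; exact: cW.
have : (W <= B)%MS.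
  rewrite submxE; apply/eqP/rowP => i; rewrite [RHS]mxE.
  have h : (W_ j *m cokermx B) 0 i @[j --> \oo] --> (W *m cokermx B) 0 i.
    rewrite mxE; under eq_cvg do rewrite mxE.
    by apply: cvg_fin_sum => k; apply: cvgMr_tmp; exact: WP.
  have h0 : (W_ j *m cokermx B) 0 i @[j --> \oo] --> (0 : R).
    under eq_cvg do rewrite /W_ -mulmxA mulmx_coker mulmx0 mxE.
    exact: cvg_cst.
  exact: (cvg_unique _ h h0).
move=> /submxP[V VE]; exists V => e e0.
have [n0 n0P] := Cau e e0; exists n0 => k nk.
rewrite qE mulmxBl -VE.
have h : dotv (W_ k - W_ j) (W_ k - W_ j) @[j --> \oo] --> dotv (W_ k - W) (W_ k - W).
  apply: cvg_fin_sum => i.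
  have hi : (W_ k - W_ j) 0 i @[j --> \oo] --> (W_ k - W) 0 i.
    have E w : (W_ k - w) 0 i = W_ k 0 i - w 0 i by rewrite mxE [X in _ + X]mxE.
    rewrite E; under eq_cvg do rewrite E.
    by apply: cvgB (WP i); exact: cvg_cst.
  exact: cvgM.
apply: (cvgr_to_le h); exists n0 => // j nj.
by rewrite /W_ -mulmxBl -qE n0P.
Qed.

Lemma psd_shift_unit (e : R) : 0 < e -> A + e%:M \in unitmx.
Proof.
move=> e0; rewrite -row_free_unit -kermx_eq0; apply/eqP/row_matrixP => i.
set v := row i _; rewrite row0; apply: dotv_eq0.
have : v *m (A + e%:M) = 0 by rewrite /v -row_mul mulmx_ker row0.
rewrite mulmxDr mul_mx_scalar => h.
have := congr1 (dotv v) h; rewrite dotvDr dotvZr.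
have -> : dotv v 0 = 0 by rewrite -(scale0r v) dotvZr mul0r.
have := hA.2 v; have := dotv_ge0 v => h1 h2 h3.
apply/eqP; rewrite eq_le h1 andbT -(ler_pM2l e0) mulr0; lra.
Qed.

(** The range and the kernel of a symmetric matrix meet trivially. *)
Lemma psd_square_rank : (A <= A *m A)%MS.
Proof.
rewrite -(geq_leqif (mxrank_leqif_sup (submxMl A A))).
rewrite -{1}(mxrank_mul_ker A A) -[leqRHS]addn0 leq_add2l leqn0 mxrank_eq0.
apply/eqP/row_matrixP => i; set v := row i _; rewrite row0; apply: dotv_eq0.
have : (v <= A :&: kermx A)%MS by exact: row_sub.
rewrite sub_capmx => /andP[/submxP[y vE] /sub_kermxP vA].
by rewrite {1}vE -dotv_mulmx ?hA.1// vA -(scale0r v) dotvC dotvZl mul0r.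
Qed.

(** Tikhonov regularization: the approximate preimage of [Z] under [A] depends on
    [Z] and [A] through rational functions, hence measurably. *)
Definition resolvent_approx (Z : 'rV[R]_n.+1) (k : nat) : 'rV[R]_n.+1 :=
  Z *m invmx (A + k.+1%:R^-1%:M).

(** On the range of [A] the resolvents converge to the pseudo-inverse. *)
Lemma resolvent_cvg (V : 'rV[R]_n.+1) : exists2 U : 'rV[R]_n.+1,
  U *m A = V *m A &
  forall i, resolvent_approx (V *m A) k 0 i @[k --> \oo] --> U 0 i.
Proof.
have /submxP[C CE] := psd_square_rank.
pose Y := V *m C; exists (Y *m A) => [|i].
  by rewrite /Y -!mulmxA -CE.
pose X k := k.+1%:R^-1 *: (Y *m invmx (A + k.+1%:R^-1%:M)).
have eps0 k : 0 < k.+1%:R^-1 :> R by rewrite invr_gt0.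
have Xle k : dotv (X k) (X k) <= dotv Y Y.
  have : X k *m (A + k.+1%:R^-1%:M) = k.+1%:R^-1 *: Y.
    by rewrite -scalemxAl mulmxKV// psd_shift_unit.
  move: (eps0 k) (X k); move: (k.+1%:R^-1) => e e0 x.
  rewrite mulmxDr mul_mx_scalar => h.
  have := congr1 (dotv x) h; rewrite dotvDr !dotvZr.
  have h1 := hA.2 x => h2.
  have h3 : dotv x x <= dotv x Y by rewrite -(ler_pM2l e0); lra.
  have := dotv_ge0 (Y - x); rewrite dotvBl (dotvC _ (Y - x)) (dotvC x) !dotvBl.
  by rewrite (dotvC Y x); lra.
have XE k : resolvent_approx (V *m A) k = Y *m A - k.+1%:R^-1 *: (Y - X k).
  have u := psd_shift_unit (eps0 k).
  apply: (can_inj (mulmxK u)); rewrite mulmxKV//.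
  rewrite mulmxBl -scalemxAl mulmxBl /X -[_ *: _ *m _]scalemxAl mulmxKV//.
  by rewrite !mulmxDr !mul_mx_scalar !addrK {1}CE !mulmxA.
have Xi k : `|(Y - X k) 0 i| <= 2 * Num.sqrt (dotv Y Y).
  have h u : dotv u u <= dotv Y Y -> `|u 0 i| <= Num.sqrt (dotv Y Y).
    move=> uY; rewrite -sqrtr_sqr ler_wsqrtr//.
    exact: le_trans (entry_le_dotv u i) uY.
  rewrite mxE [X in _ + X]mxE; apply: (le_trans (ler_normB _ _)).
  by have := h _ (lexx _); have := h _ (Xle k); lra.
have E k : (Y *m A - k.+1%:R^-1 *: (Y - X k)) 0 i =
    (Y *m A) 0 i - k.+1%:R^-1 * (Y - X k) 0 i.
  by rewrite mxE [X in _ + X]mxE [X in _ - X]mxE.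
under eq_cvg do rewrite XE E.
suff h0 : k.+1%:R^-1 * (Y - X k) 0 i @[k --> \oo] --> (0 : R).
  have : (Y *m A) 0 i - k.+1%:R^-1 * (Y - X k) 0 i @[k --> \oo] --> (Y *m A) 0 i - 0.
    by apply: cvgB h0; exact: cvg_cst.
  by rewrite subr0.
apply/cvgr0Pnorm_le => e e0.
pose c := 2 * Num.sqrt (dotv Y Y) + 1.
have c0 : 0 < c by rewrite ltr_wpDl// mulr_ge0// sqrtr_ge0.
have /cvgrPdist_le/(_ (e / c)) := @cvg_harmonic R.
rewrite divr_gt0// => /(_ isT); apply: filterS => k.
rewrite sub0r normrN /harmonic/= => h.
rewrite normrM -[leRHS](divfK (lt0r_neq0 c0)) ler_pM//.
by apply: (le_trans (Xi k)); rewrite /c lerDl.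
Qed.

End psd_limits.

(** * Lipschitz functions on the line are differentiable almost everywhere *)

Section Rademacher_half.
Context {R : realType}.
Local Notation lambda := (@lebesgue_measure R).
Variable g : R -> R.
Hypothesis gL : forall x y, `|g x - g y| <= `|x - y| / 2.

Lemma half_lipschitz_continuous : continuous g.
Proof.
move=> x; apply/cvgrPdist_le => e e0; near=> y.
apply: (le_trans (gL x y)).
have : `|x - y| <= e by near: y; exact: cvgr_dist_le.
by have := normr_ge0 (x - y); lra.
Unshelve. all: by end_near. Qed.

(** Adding a multiple of the identity makes [g] nondecreasing, hence the
    distribution function of a measure. *)
Definition half_up x := x / 2 + g x.
Definition half_down x := x / 2 - g x.

Lemma half_up_nd : nondecreasing half_up.
Proof.
move=> x y xy; have := gL y x; rewrite ler_norml ger0_norm ?subr_ge0// /half_up.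
by move=> /andP[]; lra.
Qed.

Lemma half_down_nd : nondecreasing half_down.
Proof.
move=> x y xy; have := gL y x; rewrite ler_norml ger0_norm ?subr_ge0// /half_down.
by move=> /andP[]; lra.
Qed.

Lemma half_up_continuous : continuous half_up.
Proof.
move=> x; apply: cvgD; last exact: half_lipschitz_continuous.
exact: cvgMr_tmp.
Qed.

Lemma half_down_continuous : continuous half_down.
Proof.
move=> x; apply: cvgB; last exact: half_lipschitz_continuous.
exact: cvgMr_tmp.
Qed.

HB.instance Definition _ := isCumulative.Build R _ R half_up
  half_up_nd (right_continuousW half_up_continuous).
HB.instance Definition _ := isCumulative.Build R _ R half_down
  half_down_nd (right_continuousW half_down_continuous).

Let nu1 : {measure set (measurableTypeR R) -> \bar R} :=
  lebesgue_stieltjes_measure half_up.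
Let nu2 : {measure set (measurableTypeR R) -> \bar R} :=
  lebesgue_stieltjes_measure half_down.

Lemma stieltjes_itv (f : cumulative R R) (a b : R) : a <= b ->
  lebesgue_stieltjes_measure f `]a, b]%classic = (f b - f a)%:E.
Proof.
move=> ab; rewrite /lebesgue_stieltjes_measure /measure_extension.
rewrite measurable_mu_extE/=; last exact: is_ocitv.
by rewrite wlength_itv_bnd// EFinB.
Qed.

(** [half_up] and [half_down] are nondecreasing with sum the identity, so
    that their Stieltjes measures add up to Lebesgue measure. *)
Lemma half_up_dominated A : measurable A -> (nu1 A <= lambda A)%E.
Proof.
move=> mA.
suff -> : lambda A = (nu1 A + nu2 A)%E by rewrite leeDl.
rewrite -measure_addE /lebesgue_measure.
apply: lebesgue_stieltjes_measure_unique mA => X.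
case=> -[a b] /= ab <-.
rewrite /msum 2!big_ord_recl/= big_ord0 adde0.
have [lab|lba] := leP a b.
  rewrite /nu1 /nu2 !stieltjes_itv// -EFinD; congr (_%:E).
  have : b - a = (b / 2 + g b) - (a / 2 + g a) + ((b / 2 - g b) - (a / 2 - g a)).
    by field.
  exact.
by rewrite set_itv_ge ?bnd_simp -?leNgt ?ltW// !measure0 adde0.
Qed.

(** The measure of [half_up] has a density, by domination, and [half_up] is the
    integral of that density; the Lebesgue differentiation theorem applies. *)
Lemma half_ae_derivable_bounded (m : R) : 0 < m ->
  {ae lambda, forall x, - m < x < m -> derivable g x 1}.
Proof.
move=> m0.
pose D := `]- m, m]%classic : set (measurableTypeR R).
have mD : measurable D by exact: measurable_itv.
have mm : - m <= m by lra.
have nuE y : - m <= y -> nu1 `]- m, y]%classic = (half_up y - half_up (- m))%:E.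
  exact: stieltjes_itv.
have nuD : (nu1 D < +oo)%E by rewrite nuE// ltry.
pose nu := mfrestr mD nuD.
have numu : nu `<< lambda.
  apply/null_content_dominatesP => A mA A0.
  apply/eqP; rewrite eq_le measure_ge0 andbT -A0.
  apply: (@le_trans _ _ (lambda (A `&` D))).
    by apply: half_up_dominated; exact: measurableI.
  by apply: le_measure; rewrite ?inE//; exact: measurableI.
pose phi := fine \o Radon_Nikodym_SigmaFinite.f nu lambda.
have phiE : EFin \o phi = Radon_Nikodym_SigmaFinite.f nu lambda.
  apply/funext => x; rewrite /= fineK//.
  exact: Radon_Nikodym_SigmaFinite.f_fin_num.
have phi_int : lambda.-integrable setT (EFin \o phi).
  by rewrite phiE; exact: Radon_Nikodym_SigmaFinite.f_integrable.
have phi_itv y : \int[lambda]_(t in `]-oo, y]) phi t = fine (nu `]-oo, y]%classic).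
  rewrite /Rintegral; congr fine.
  apply: etrans; last first.
    apply/esym/(Radon_Nikodym_SigmaFinite.f_integral numu).
    exact: measurable_itv.
  by apply: eq_integral => x _; rewrite -phiE.
have FE y : - m <= y -> y <= m ->
    \int[lambda]_(t in `]-oo, y]) phi t = half_up y - half_up (- m).
  move=> my ym; rewrite phi_itv /nu /mfrestr /mrestr.
  have h : (`]-oo, y]%classic `&` `]- m, m]%classic : set R) = `]- m, y]%classic.
    apply/seteqP; split=> x /=; rewrite !in_itv/=.
      by move=> [xy /andP[mx _]]; rewrite mx xy.
    by move=> /andP[mx xy]; split=> //; rewrite mx (le_trans xy).
  by rewrite /D [X in nu1 X]h nuE.
have int_ny y : lambda.-integrable `]-oo, y] (EFin \o phi).
  by apply: integrableS phi_int.
have loc : locally_integrable setT phi.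
  by apply: open_integrable_locally => //; exact: openT.
have := FTC1Ny int_ny loc.
apply: filterS; first exact: (ae_filter_ringOfSetsType lambda).
move=> x [dF _] /andP[mx xm].
have dup : derivable half_up x 1.
  have dF' : derivable (fun y : R =>
      \int[lambda]_(t in [set` `]-oo, y]]) phi t + half_up (- m)) x 1.
    exact: (derivableD dF (derivable_cst _ _ _)).
  apply: (near_eq_derivable _ dF').
  near=> y; rewrite FE ?subrK//; apply/ltW; near: y.
    exact: lt_nbhsr.
  exact: lt_nbhsl.
have d2 : derivable (2^-1 \*: (@id R : R -> R^o)) x 1.
  apply: derivableZ; exact: (@derivable_id R R^o).
have -> : g = half_up - (2^-1 \*: (@id R : R -> R^o)).
  apply/funext => y; have : g y = (y / 2 + g y) - 2^-1 * y by field.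
  exact.
exact: (derivableB dup d2).
Unshelve. all: by end_near. Qed.

End Rademacher_half.

Section Rademacher_line.
Context {R : realType}.
Local Notation lambda := (@lebesgue_measure R).

Lemma lipschitz_ae_derivable (K : R) (g : R -> R) :
  (forall x y, `|g x - g y| <= K * `|x - y|) ->
  {ae lambda, forall x, derivable g x 1}.
Proof.
move=> gK.
pose c := 2 * (`|K| + 1).
have c0 : 0 < c by rewrite /c; have := normr_ge0 K; lra.
pose h x := c^-1 * g x.
have hL x y : `|h x - h y| <= `|x - y| / 2.
  rewrite /h -mulrBr normrM gtr0_norm ?invr_gt0// mulrC ler_pdivrMr//.
  apply: (le_trans (gK x y)); rewrite /c.
  have := ler_norm K; have := normr_ge0 (x - y); nra.
have : {ae lambda, forall x, forall m : nat, - m.+1%:R < x < m.+1%:R -> derivable h x 1}.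
  by apply: ae_foralln => m; exact: half_ae_derivable_bounded.
apply: filterS; first exact: (ae_filter_ringOfSetsType lambda).
move=> x /(_ (Num.truncn `|x|)) hx.
have {}hx : derivable h x 1.
  by apply: hx; rewrite -ltr_norml; exact: truncnS_gt.
have -> : g = c \*: (h : R -> R^o).
  have cN0 := lt0r_neq0 c0; apply/funext => y; have : g y = c * (c^-1 * g y) by field.
  exact.
exact: derivableZ.
Qed.

End Rademacher_line.

(** * Lebesgue measure on row vectors *)

Section rV_topology.
Context {R : realType} {n : nat}.
Local Notation E := 'rV[R]_n.+1.

Lemma ball_rVE (x : E) (e : R) y : 0 < e ->
  ball x e y <-> forall i, `|x 0 i - y 0 i| < e.
Proof.
move=> e0; split=> [[_ h] i|h]; first exact: h.
by split=> // i j; rewrite (ord1 i); exact: h.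
Qed.

Lemma entry_le_norm (x : E) i : `|x 0 i| <= `|x|.
Proof.
rewrite -[leRHS]/(mx_norm x) mx_normrE.
exact: (le_bigmax _ (fun ij : 'I_1 * 'I_n.+1 => `|x ij.1 ij.2|) (0, i)).
Qed.

Lemma norm_le_entries (x : E) (M : R) : 0 <= M -> (forall i, `|x 0 i| <= M) -> `|x| <= M.
Proof.
move=> M0 h; rewrite -[leLHS]/(mx_norm x) mx_normrE.
by apply/bigmax_leP; split=> // -[i j] _ /=; rewrite (ord1 i); exact: h.
Qed.

End rV_topology.

Section tuple_rows.
Context {R : realType} {n : nat}.
Local Notation E := 'rV[R]_n.+1.
Local Notation T := (measurableTypeR R).
Local Notation mu := (@lebesgue_rV R n).

Definition row_of_tuple (t : n.+1.-tuple T) : E := \row_i tnth t i.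

Lemma row_of_tupleK : cancel row_of_tuple (@tuple_of_row R n).
Proof. by move=> t; apply/eq_from_tnth => i; rewrite tnth_mktuple mxE. Qed.

Lemma tuple_of_rowK : cancel (@tuple_of_row R n) row_of_tuple.
Proof. by move=> x; apply/rowP => i; rewrite mxE tnth_mktuple. Qed.

Lemma image_tuple_of_row (A : set E) : @tuple_of_row R n @` A = row_of_tuple @^-1` A.
Proof.
apply/seteqP; split=> [_ [x Ax <-]|t At]; first by rewrite /= tuple_of_rowK.
by exists (row_of_tuple t) => //; exact: row_of_tupleK.
Qed.

Lemma box_measurable (a b : 'I_n.+1 -> R) :
  measurable (row_of_tuple @^-1` [set x : E | forall i, a i < x 0 i < b i]).
Proof.
have mA i : measurable (`]a i, b i[%classic : set T) by exact: measurable_itv.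
have [mB _] := tuple_lebesgue_measure_box mA.
rewrite [X in measurable X](_ : _ = [set t : n.+1.-tuple T |
  forall i, `]a i, b i[%classic (tnth t i)])//.
by apply/seteqP; split=> t /= h i; have := h i; rewrite mxE in_itv.
Qed.

(** An open set is the union of the boxes with rational data it contains. *)
Lemma open_tuple_measurable (O : set E) : open O -> measurable (row_of_tuple @^-1` O).
Proof.
move=> oO.
pose B (p : 'rV[rat]_n.+1 * rat) : set E :=
  [set x : E | forall i, ratr (p.1 0 i) - ratr p.2 < x 0 i < ratr (p.1 0 i) + ratr p.2].
pose F p := if pselect (B p `<=` O) then B p else set0.
have -> : O = \bigcup_(p : 'rV[rat]_n.+1 * rat) F p.
  apply/seteqP; split=> [x Ox|x [p _]]; last first.
    by rewrite /F; case: pselect => // h; exact: h.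
  have /nbhs_ballP[e /= e0 eO] : nbhs x O by exact: open_nbhs_nbhs.
  have [r] := @rat_in_itvoo R (e / 4) (e / 2) ltac:(lra).
  rewrite in_itv/= => /andP[r1 r2].
  have h i : exists q : rat, ratr q \in `]x 0 i - e / 4, x 0 i + e / 4[.
    by have [q qP] := @rat_in_itvoo R (x 0 i - e / 4) (x 0 i + e / 4) ltac:(lra); exists q.
  have [c cP] := choice h.
  exists (\row_i c i, r) => //; rewrite /F; case: pselect => [_ i|]/=.
    by rewrite mxE; have := cP i; rewrite in_itv/= => /andP[]; lra.
  case=> y By; apply: eO; apply/ball_rVE => // i.
  have := By i; have := cP i; rewrite in_itv/= mxE => /andP[c1 c2] /andP[y1 y2].
  by rewrite ltr_norml; apply/andP; split; lra.
rewrite preimage_bigcup; apply: countable_bigcupT_measurable => // p.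
rewrite /F; case: pselect => h /=; last by rewrite preimage_set0.
exact: box_measurable.
Qed.

Lemma open_measurable_rV (O : set E) : open O -> measurable O.
Proof.
by move=> oO; apply: measurable_rV; rewrite image_tuple_of_row; exact: open_tuple_measurable.
Qed.

Lemma closed_measurable_rV (A : set E) : closed A -> measurable A.
Proof.
move=> cA; rewrite -(setCK A); apply: measurableC; apply: open_measurable_rV.
exact: closed_openC.
Qed.

Lemma bounded_lebesgue_lty (A : set E) : measurable A -> bounded_set A -> (mu A < +oo)%E.
Proof.
move=> mA [M [_ /(_ (M + 1))]]; rewrite ltrDl ltr01 => /(_ isT) AM.
have mI (i : 'I_n.+1) : measurable (`[- (M + 1), M + 1]%classic : set T).
  exact: measurable_itv.
have [mB muB] := lebesgue_rV_box mI.
apply: (@le_lt_trans _ _ (\big[*%E/1%E]_(i < n.+1)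
    lebesgue_measure (`[- (M + 1), M + 1]%classic : set T))); last first.
  suff : (fun x : \bar R => 0 <= x /\ x < +oo)%E (\big[*%E/1%E]_(i < n.+1)
    lebesgue_measure (`[- (M + 1), M + 1]%classic : set T)) by case.
  apply: (big_ind (fun x : \bar R => 0 <= x /\ x < +oo)%E) => //.
  - by rewrite ltry lee01.
  - move=> x y [x0 xy] [y0 yy]; split; first exact: mule_ge0.
    by rewrite lte_mul_pinfty// ge0_fin_numE.
  - move=> i _; split=> //; rewrite lebesgue_measure_itv/=.
    by case: ifP => _; rewrite ?ltry// -EFinD ltry.
rewrite -muB; apply: le_measure; rewrite ?inE// => x Ax i /=.
have := AM _ Ax => /= xM; rewrite in_itv/= -ler_norml.
exact: le_trans (entry_le_norm x i) xM.
Qed.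

Lemma open_lebesgue_gt0 (O : set E) x : open O -> O x -> (0 < mu O)%E.
Proof.
move=> oO Ox; have mO := open_measurable_rV oO.
have /nbhs_ballP[e /= e0 eO] : nbhs x O by exact: open_nbhs_nbhs.
have mI (i : 'I_n.+1) : measurable (`]x 0 i - e, x 0 i + e[%classic : set T).
  exact: measurable_itv.
have [mB muB] := lebesgue_rV_box mI.
apply: (@lt_le_trans _ _ (\big[*%E/1%E]_(i < n.+1)
    lebesgue_measure (`]x 0 i - e, x 0 i + e[%classic : set T))).
  apply: (big_ind (fun x : \bar R => 0 < x)%E) => //.
  - by move=> a b a0 b0; exact: mule_gt0.
  - move=> i _; rewrite lebesgue_measure_itv/= lte_fin ifT; last lra.
    by rewrite -EFinD lte_fin; lra.
rewrite -muB; apply: le_measure; rewrite ?inE// => y By; apply: eO.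
apply/ball_rVE => // i; have := By i; rewrite /= in_itv/= => /andP[y1 y2].
by rewrite ltr_norml; apply/andP; split; lra.
Qed.

Lemma lebesgue_rV_complete : measure_is_complete mu.
Proof. exact: measure_is_complete_caratheodory. Qed.

Lemma negligible_measurable_rV (A : set E) : mu.-negligible A -> measurable A.
Proof. exact: lebesgue_rV_complete. Qed.

Lemma continuous_measurable_rV (O : set E) (f : E -> R) : open O ->
  {in O, continuous f} -> measurable_fun O f.
Proof.
move=> oO cf mO; apply: (measurability _ (measurable_realfun.RGenOInfty.measurableE R)) => //.
move=> _ [_ [a ->] <-]; apply: open_measurable_rV.
rewrite openE => x [Ox /= fx]; apply: filterI; first exact: open_nbhs_nbhs.
rewrite in_itv/= andbT in fx.
have := cf x; rewrite inE => /(_ Ox) /cvgr_gt/(_ _ fx); apply: filterS => y /= ya.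
by rewrite in_itv/= ya.
Qed.

End tuple_rows.

Section null_sections.
Context {R : realType}.
Local Notation T := (measurableTypeR R).
Local Notation lambda := (@lebesgue_measure R : set T -> \bar R).

Definition tuple_update n (t : n.-tuple T) (i : 'I_n) (s : R) : n.-tuple T :=
  [tuple (if j == i then s else tnth t j) | j < n].

Lemma cons_pair_update0 n (p : T * n.-tuple T) s :
  tuple_update (cons_pair p) ord0 s = cons_pair (s, p.2).
Proof.
apply/eq_from_tnth => i; rewrite tnth_mktuple.
case: (unliftP ord0 i) => [j|] ->; last by rewrite eqxx /cons_pair tnth0.
by rewrite eq_sym (negbTE (neq_lift _ _)) /cons_pair !tnthS.
Qed.

Lemma cons_pair_updateS n (p : T * n.-tuple T) (i : 'I_n) s :
  tuple_update (cons_pair p) (lift ord0 i) s = cons_pair (p.1, tuple_update p.2 i s).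
Proof.
apply/eq_from_tnth => k; rewrite tnth_mktuple.
case: (unliftP ord0 k) => [j|] ->.
  by rewrite (inj_eq lift_inj) /cons_pair !tnthS tnth_mktuple.
by rewrite (negbTE (neq_lift _ _)) /cons_pair !tnth0.
Qed.

(** Fubini: a measurable set whose sections by the lines parallel to one
    coordinate axis are null is null. *)
Lemma null_of_null_sections n (A : set (n.-tuple T)) (i : 'I_n) : measurable A ->
  (forall t, lambda [set s | A (tuple_update t i s)] = 0%E) ->
  tuple_lebesgue_measure n A = 0%E.
Proof.
elim: n A i => [A [] //|n IH] A i mA A0.
pose B := @cons_pair R n @^-1` A.
have mB : measurable B.
  by rewrite /B -[_ @^-1` _]setTI; exact: measurable_cons_pair.
rewrite /= /cons_measure /pushforward -/B.
case: (unliftP ord0 i) => [j|] iE; last first.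
  rewrite -[LHS]/((lebesgue_measure \x tuple_lebesgue_measure n)%E B).
  rewrite (@product_measure_unique _ _ _ _ _ _ _
    (lebesgue_measure \x^ tuple_lebesgue_measure n)%E)//; last first.
    by move=> X Y mX mY; exact: product_measure2E.
  rewrite -[LHS]/(\int[tuple_lebesgue_measure n]_t lambda (ysection B t))%E.
  rewrite integral0_eq// => t _ /=.
  rewrite -[RHS](A0 (cons_pair (0, t))) iE; congr lebesgue_measure.
  apply/seteqP; split=> s /=; rewrite /ysection/= cons_pair_update0/=.
    by rewrite inE.
  by move=> ?; rewrite inE.
rewrite -[LHS]/(\int[lambda]_x tuple_lebesgue_measure n (xsection B x))%E.
rewrite integral0_eq// => x _ /=.
apply: (IH _ j) => [|t]; first exact: measurable_xsection.
rewrite -[RHS](A0 (cons_pair (x, t))) iE; congr lebesgue_measure.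
apply/seteqP; split=> s /=; rewrite /xsection/= cons_pair_updateS/=.
  by rewrite inE.
by move=> ?; rewrite inE.
Qed.

Lemma negligible_of_tuple n (A : set 'rV[R]_n.+1) :
  measurable (@row_of_tuple R n @^-1` A) ->
  tuple_lebesgue_measure n.+1 (@row_of_tuple R n @^-1` A) = 0%E ->
  (@lebesgue_rV R n).-negligible A.
Proof.
move=> mA A0; have mA' : measurable A.
  by apply: measurable_rV; rewrite image_tuple_of_row.
apply/negligibleP => //.
rewrite -[LHS]/(((tuple_lebesgue_measure n.+1)^*)%mu (@tuple_of_row R n @` A)).
rewrite image_tuple_of_row.
by rewrite measurable_mu_extE.
Qed.

End null_sections.

(** * Partial derivatives of locally Lipschitz functions *)

Section lipschitz_normed.
Context {R : realType} {V : normedModType R}.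

Definition lipschitz_by (K : R) (A : set V) (f : V -> R) : Prop :=
  forall x y, A x -> A y -> `|f x - f y| <= K * `|x - y|.

Lemma lipschitz_continuous (K : R) (A : set V) (f : V -> R) x :
  nbhs x A -> lipschitz_by K A f -> {for x, continuous f}.
Proof.
move=> xA Kf; have Ax := nbhs_singleton xA.
apply/cvgrPdist_le => e e0; near=> y.
apply: (@le_trans _ _ ((`|K| + 1) * `|x - y|)).
  apply: (le_trans (Kf x y _ _)) => //; first by near: y.
  by rewrite ler_wpM2r//; have := ler_norm K; lra.
rewrite mulrC -ler_pdivlMr ?ltr_wpDl//.
near: y; apply: cvgr_dist_le; first exact: cvg_id.
by rewrite divr_gt0// ltr_wpDl.
Unshelve. all: by end_near. Qed.

Definition diff_quot (f : V -> R) (v x : V) (h : R) : R :=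
  h^-1 * (f (h *: v + x) - f x).

Lemma derivable_diff_quot (f : V -> R) v x :
  derivable (f : V -> R^o) x v <-> cvg (diff_quot f v x @ 0^').
Proof. by []. Qed.

Lemma translation_continuous (w : V) : continuous (fun x => w + x).
Proof. by move=> x; apply: cvgD; [exact: cvg_cst|exact: cvg_id]. Qed.

Lemma cvg_translated_ray (v x : V) : k.+1%:R^-1 *: v + x @[k --> \oo] --> x.
Proof.
have h : (k.+1%:R^-1 : R) *: v + x @[k --> \oo] --> 0 *: v + x.
  by apply: cvgD; [apply: cvgZr_tmp; exact: cvg_harmonic|exact: cvg_cst].
by rewrite scale0r add0r in h.
Qed.

Variables (f : V -> R) (v : V).
Hypothesis cf : continuous f.

Lemma diff_quot_continuous h : continuous (fun x => diff_quot f v x h).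
Proof.
move=> x; apply: cvgMl_tmp; apply: cvgB; last exact: cf.
apply: (@cvg_comp _ _ _ (fun x => h *: v + x) f); last exact: cf.
by apply: cvgD; [exact: cvg_cst|exact: cvg_id].
Qed.

Lemma diff_quot_increment_continuous x h : h != 0 ->
  {for h, continuous (diff_quot f v x)}.
Proof.
move=> h0; apply: cvgM; first exact: cvgV.
apply: cvgB; last exact: cvg_cst.
apply: (@cvg_comp _ _ _ (fun h => h *: v + x) f); last exact: cf.
by apply: cvgD; [exact: cvgZr_tmp|exact: cvg_cst].
Qed.

Definition quotients_close (k m : nat) (p : rat * rat) : set V :=
  [set x | 0 < `|ratr p.1 : R| < k.+1%:R^-1 -> 0 < `|ratr p.2 : R| < k.+1%:R^-1 ->
      `|diff_quot f v x (ratr p.1) - diff_quot f v x (ratr p.2)| <= m.+1%:R^-1].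

Definition rational_Cauchy : set V :=
  \bigcap_(m : nat) \bigcup_(k : nat) \bigcap_(p : rat * rat) quotients_close k m p.

Lemma quotients_close_closed k m p : closed (quotients_close k m p).
Proof.
have [h1|h1] := boolP (0 < `|ratr p.1 : R| < k.+1%:R^-1); last first.
  rewrite [X in closed X](_ : _ = setT); first exact: closedT.
  by apply/seteqP; split=> // x _ h; rewrite h in h1.
have [h2|h2] := boolP (0 < `|ratr p.2 : R| < k.+1%:R^-1); last first.
  rewrite [X in closed X](_ : _ = setT); first exact: closedT.
  by apply/seteqP; split=> // x _ _ h; rewrite h in h2.
rewrite [X in closed X](_ : _ = (fun x =>
    `|diff_quot f v x (ratr p.1) - diff_quot f v x (ratr p.2)|) @^-1`
   [set y | y <= m.+1%:R^-1]).
  apply: closed_comp; last exact: closed_le.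
  by move=> x _; apply: cvg_norm; apply: cvgB; exact: diff_quot_continuous.
apply/seteqP; split=> x /=; first by apply.
by move=> ? _ _.
Qed.

(** The difference quotient is continuous in the increment, so that rational
    increments decide differentiability; the set of points of differentiability
    is thus a countable combination of closed sets. *)
Lemma rational_CauchyP x : rational_Cauchy x <-> derivable (f : V -> R^o) x v.
Proof.
split=> [cx|/derivable_diff_quot/cvg_cauchy/cauchy_ballP cx m _].
- apply/derivable_diff_quot; apply/cauchy_cvgP/cauchy_ballP => eps eps0.
  have [m _ mP] : exists2 m, True & m.+1%:R^-1 < eps / 3 :> R.
    have e3 : 0 < eps / 3 by rewrite divr_gt0.
    exists (Num.truncn (eps / 3)^-1) => //.
    by rewrite -[ltRHS]invrK ltf_pV2 ?posrE ?invr_gt0//; exact: truncnS_gt.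
  have [k _ kP] := cx m I.
  have app h : 0 < `|h| < k.+1%:R^-1 -> exists2 r : rat,
      0 < `|ratr r : R| < k.+1%:R^-1 &
      `|diff_quot f v x h - diff_quot f v x (ratr r)| <= eps / 3.
    move=> /andP[h0 hk]; have hN0 : h != 0 by rewrite -normr_gt0.
    have nh : \forall y \near h, 0 < `|y| < k.+1%:R^-1 /\
        `|diff_quot f v x h - diff_quot f v x y| <= eps / 3.
      near=> y; split; last first.
        by near: y; apply: cvgr_dist_le; [exact: diff_quot_increment_continuous|rewrite divr_gt0].
      apply/andP; split; near: y.
        apply: (@cvgr_gt _ _ _ _ (fun y : R => `|y|) `|h|) => //.
        by apply: cvg_norm; exact: cvg_id.
      apply: (@cvgr_lt _ _ _ _ (fun y : R => `|y|) `|h|) => //.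
      by apply: cvg_norm; exact: cvg_id.
    have /nbhs_ballP[d /= d0 dP] := nh.
    have [r] := @rat_in_itvoo R (h - d) (h + d) ltac:(lra).
    rewrite in_itv/= => /andP[r1 r2].
    have /dP[p1 p2] : ball h d (ratr r : R).
      by rewrite /ball/= ltr_norml; apply/andP; split; lra.
    by exists r.
  pose D : set R := [set h | 0 < `|h| < k.+1%:R^-1].
  exists (diff_quot f v x @` D, diff_quot f v x @` D).
    have nD : 0^' D.
      near=> h; apply/andP; split.
        by rewrite normr_gt0; near: h; exact: nbhs_dnbhs_neq.
      by near: h; apply: dnbhs0_lt; rewrite invr_gt0.
    have nDi : 0^' (diff_quot f v x @^-1` (diff_quot f v x @` D)).
      by apply: filterS nD => h Dh; exists h.
    by split.
  move=> [_ _] [/= [h1 D1 <-] [h2 D2 <-]].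
  have [r1 r1D r1P] := app _ D1; have [r2 r2D r2P] := app _ D2.
  have r12 := kP (r1, r2) I r1D r2D; rewrite /= in r12.
  rewrite /ball/=.
  have -> : diff_quot f v x h1 - diff_quot f v x h2 =
    (diff_quot f v x h1 - diff_quot f v x (ratr r1)) +
    (diff_quot f v x (ratr r1) - diff_quot f v x (ratr r2)) -
    (diff_quot f v x h2 - diff_quot f v x (ratr r2)) by ring.
  apply: (le_lt_trans (ler_normB _ _)).
  have := ler_normD (diff_quot f v x h1 - diff_quot f v x (ratr r1))
    (diff_quot f v x (ratr r1) - diff_quot f v x (ratr r2)).
  by move: (m.+1%:R^-1) mP r12 => z; lra.
- have m0 : 0 < m.+1%:R^-1 :> R by rewrite invr_gt0.
  have [[A B] [/= nA nB] AB] := cx _ m0.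
  have /nbhs_ballP[d /= d0 dP] : nbhs (0 : R) [set h | h != 0 ->
      A (diff_quot f v x h) /\ B (diff_quot f v x h)].
    have nA' : \forall h \near (0 : R), h != 0 -> A (diff_quot f v x h) := nA.
    have nB' : \forall h \near (0 : R), h != 0 -> B (diff_quot f v x h) := nB.
    by apply: filterS2 nA' nB' => h hA hB h0; split; [exact: hA|exact: hB].
  exists (Num.truncn d^-1) => // -[r1 r2] _ /= /andP[r10 r1k] /andP[r20 r2k].
  have kd : (Num.truncn d^-1).+1%:R^-1 < d.
    by rewrite -[ltRHS]invrK ltf_pV2 ?posrE ?invr_gt0//; exact: truncnS_gt.
  have h r : 0 < `|ratr r : R| -> `|ratr r : R| < (Num.truncn d^-1).+1%:R^-1 ->
      A (diff_quot f v x (ratr r)) /\ B (diff_quot f v x (ratr r)).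
    move=> r0 rk; apply: dP; last by rewrite -normr_gt0.
    by rewrite /ball/= sub0r normrN (lt_trans rk).
  apply: ltW.
  exact: (AB (_, _) (conj (h _ r10 r1k).1 (h _ r20 r2k).2)).
Unshelve. all: by end_near. Qed.

End lipschitz_normed.

Section local_lipschitz.
Context {R : realType} {n : nat}.
Local Notation E := 'rV[R]_n.+1.
Local Notation mu := (@lebesgue_rV R n).

Lemma locally_lipschitzP (A : set E) (f : E -> R) :
  locally_lipschitz A f <->
  forall x, A x -> exists e K : R, [/\ 0 < e, 0 <= K & lipschitz_by K (ball x e `&` A) f].
Proof.
split=> [h x Ax|h x Ax].
  have [U /nbhs_ballP[e /= e0 eU] [M0 [_ /(_ (Num.max M0 0 + 1))]]] := h x Ax.
  rewrite (le_lt_trans _ (_ : Num.max M0 0 < _)) ?le_max ?lexx// ?ltrDl// => /(_ isT) hl.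
  exists e, (Num.max M0 0 + 1); split=> //.
    by rewrite addr_ge0// le_max lexx orbT.
  move=> y z [ye Ay] [ze Az].
  by apply: (hl (y, z)); split; split=> //; exact: eU.
have [e [K [e0 K0 Kl]]] := h x Ax.
exists (ball x e); first exact: nbhsx_ballx.
exists K; split; first exact: num_real.
move=> M KM [y z] [/= yU zU]; apply: (le_trans (Kl _ _ yU zU)).
by rewrite ler_wpM2r// ltW.
Qed.

Lemma locally_lipschitz_lin (A : set E) (f g : E -> R) (a : R) :
  locally_lipschitz A f -> locally_lipschitz A g ->
  locally_lipschitz A (fun x => a * f x + g x).
Proof.
move=> /locally_lipschitzP hf /locally_lipschitzP hg; apply/locally_lipschitzP => x Ax.
have [e1 [K1 [e10 K10 h1]]] := hf x Ax; have [e2 [K2 [e20 K20 h2]]] := hg x Ax.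
exists (Num.min e1 e2), (`|a| * K1 + K2); split.
- by rewrite lt_min e10.
- by rewrite addr_ge0// mulr_ge0.
- move=> y z [ye Ay] [ze Az].
  have [y1 y2] : ball x e1 y /\ ball x e2 y.
    by split; apply: le_ball ye; rewrite ge_min lexx ?orbT.
  have [z1 z2] : ball x e1 z /\ ball x e2 z.
    by split; apply: le_ball ze; rewrite ge_min lexx ?orbT.
  have -> : a * f y + g y - (a * f z + g z) = a * (f y - f z) + (g y - g z) by ring.
  apply: (le_trans (ler_normD _ _)); rewrite normrM mulrDl -mulrA.
  by apply: lerD; [rewrite ler_wpM2l//; exact: h1|exact: h2].
Qed.

Lemma locally_lipschitz_cst (A : set E) (c : R) : locally_lipschitz A (fun=> c).
Proof.
apply/locally_lipschitzP => x Ax; exists 1, 0; split=> //.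
by move=> y z _ _; rewrite subrr normr0 mul0r.
Qed.

Lemma locally_lipschitz_continuous (A : set E) (f : E -> R) : open A ->
  locally_lipschitz A f -> {in A, continuous f}.
Proof.
move=> oA /locally_lipschitzP lf x; rewrite inE => Ax.
have [e [K [e0 _ h]]] := lf x Ax.
apply: (@lipschitz_continuous R E K (ball x e `&` A)) => //.
by apply: filterI; [exact: nbhsx_ballx|exact: open_nbhs_nbhs].
Qed.

(** Negligibility is a local property, by the Lindelof property of [E]. *)
Lemma local_negligible (O N : set E) :
  (forall x, O x -> exists2 e : R, 0 < e & mu.-negligible (ball x e `&` N)) ->
  mu.-negligible (O `&` N).
Proof.
move=> h.
pose B (p : 'rV[rat]_n.+1 * rat) : set E := ball (map_mx ratr p.1 : E) (ratr p.2).
pose F k := if unpickle k is Some p then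
  if pselect (mu.-negligible (B p `&` N)) then B p `&` N else set0 else set0.
apply: (@negligibleS _ _ _ _ (\bigcup_k F k)); last first.
  apply: negligible_bigcup => k; rewrite /F.
  case: (unpickle k) => [p|]; last exact: negligible_set0.
  by case: pselect => [h'|h'] //=; exact: negligible_set0.
move=> x [Ox Nx]; have [e e0 eN] := h x Ox.
have [r] := @rat_in_itvoo R (e / 4) (e / 2) ltac:(lra).
rewrite in_itv/= => /andP[r1 r2].
have hc i : exists q : rat, ratr q \in `]x 0 i - e / 4, x 0 i + e / 4[.
  by have [q qP] := @rat_in_itvoo R (x 0 i - e / 4) (x 0 i + e / 4) ltac:(lra); exists q.
have [c cP] := choice hc.
pose p : 'rV[rat]_n.+1 * rat := (\row_i c i, r).
have r0 : 0 < ratr p.2 :> R by rewrite /=; lra.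
have Bx : B p x.
  apply/ball_rVE => // i; rewrite !mxE; have := cP i; rewrite in_itv/= => /andP[c1 c2].
  by rewrite ltr_norml; apply/andP; split; rewrite /=; lra.
exists (pickle p) => //; rewrite /F pickleK.
case: pselect => //=; case; apply: negligibleS eN => y [By Ny]; split=> //.
apply/ball_rVE => // i; have /(ball_rVE _ _ r0)/(_ i) := By; rewrite !mxE/=.
have := cP i; rewrite in_itv/= => /andP[c1 c2].
by rewrite !ltr_norml => /andP[y1 y2]; apply/andP; split; lra.
Qed.

End local_lipschitz.

Section difference_quotient.
Context {R : realType} {n : nat}.
Local Notation E := 'rV[R]_n.+1.
Local Notation mu := (@lebesgue_rV R n).

Variable f : E -> R.
Variable K : R.
Hypothesis fK : lipschitz_by K setT f.
Variable i : 'I_n.+1.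
Let e_i : E := delta_mx 0 i.

Let cf : continuous f.
Proof. by move=> x; apply: (@lipschitz_continuous R E K setT) => //; exact: filterT. Qed.

Lemma rational_Cauchy_measurable :
  measurable (@row_of_tuple R n @^-1` rational_Cauchy f e_i).
Proof.
rewrite /rational_Cauchy preimage_bigcap; apply: bigcapT_measurable => m.
rewrite preimage_bigcup; apply: bigcupT_measurable => k.
rewrite -[X in measurable X]setCK preimage_bigcap setC_bigcap; apply: measurableC.
apply: countable_bigcupT_measurable => // p.
rewrite preimage_setC; apply: open_tuple_measurable; apply: closed_openC.
exact: quotients_close_closed.
Qed.

(** By Fubini's theorem it is enough to know that Lipschitz functions on a line
    are differentiable almost everywhere. *)
Lemma lipschitz_partial_ae :
  mu.-negligible [set x | ~ derivable (f : E -> R^o) x e_i].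
Proof.
have -> : [set x | ~ derivable (f : E -> R^o) x e_i] = ~` rational_Cauchy f e_i.
  by apply/seteqP; split=> x /= h; apply: contra_not h => /(rational_CauchyP _ cf).
have mC : measurable (@row_of_tuple R n @^-1` (~` rational_Cauchy f e_i)).
  by rewrite -preimage_setC; apply: measurableC; exact: rational_Cauchy_measurable.
apply: negligible_of_tuple => //; apply: (@null_of_null_sections _ _ _ i) => // t.
pose x0 : E := row_of_tuple (tuple_update t i 0).
pose g (s : R) := f (s *: e_i + x0).
have xE s : row_of_tuple (tuple_update t i s) = s *: e_i + x0.
  apply/rowP => j; rewrite !mxE !tnth_mktuple eqxx/=.
  by case: eqP => _; rewrite ?mulr1 ?addr0 ?mulr0 ?add0r.
have gK s s' : `|g s - g s'| <= K * `|s - s'|.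
  have K0 : 0 <= K.
    have := @fK e_i 0 I I; have : 0 < `|e_i - 0 : E|.
      rewrite subr0 normr_gt0; apply/eqP => /rowP/(_ i); rewrite !mxE !eqxx => /eqP.
      by rewrite oner_eq0.
    by have := normr_ge0 (f e_i - f 0); nra.
  apply: (le_trans (@fK _ _ I I)); rewrite ler_wpM2l//.
  have -> : s *: e_i + x0 - (s' *: e_i + x0) = (s - s') *: e_i.
    by rewrite opprD addrACA subrr addr0 scalerBl.
  apply: norm_le_entries => // j; rewrite !mxE eqxx/= normrM.
  by case: eqP => _ /=; rewrite ?normr1 ?normr0 ?mulr1 ?mulr0.
have /= := lipschitz_ae_derivable gK.
move=> [N [mN N0 NP]].
apply/eqP; rewrite eq_le measure_ge0 andbT -N0.
apply: le_outer_measure => s /= hs; apply: NP => /= ds; apply: hs.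
rewrite xE; apply/(rational_CauchyP _ cf).
have qE : diff_quot f e_i (s *: e_i + x0) = @diff_quot R R^o g 1 s.
  apply/funext => h; rewrite /diff_quot /g; congr (_ * (f _ - _)).
  by rewrite [h *: 1]mulr1 scalerDl addrA.
by apply/derivable_diff_quot; rewrite qE; exact: (derivable_diff_quot _ _ _).1 ds.
Qed.

End difference_quotient.

Section gradient.
Context {R : realType} {n : nat}.
Local Notation E := 'rV[R]_n.+1.
Local Notation mu := (@lebesgue_rV R n).

(** Composition with the coordinatewise projection on a ball of the max norm,
    which is a box, extends a Lipschitz function on that ball to [E]. *)
Definition clamp_ball (c : E) (r : R) (x : E) : E :=
  \row_i Num.max (c 0 i - r) (Num.min (x 0 i) (c 0 i + r)).

Lemma clamp_ball_id c r x : 0 < r -> ball c r x -> clamp_ball c r x = x.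
Proof.
move=> r0 /(ball_rVE _ _ r0) h; apply/rowP => i; rewrite mxE.
have := h i; rewrite ltr_norml => /andP[h1 h2].
by rewrite min_l ?max_r//; lra.
Qed.

Lemma clamp_ball_in c r e x : 0 < r -> r < e -> ball c e (clamp_ball c r x).
Proof.
move=> r0 re; apply/ball_rVE; first exact: lt_trans re.
move=> i; rewrite mxE ltr_norml; apply/andP.
by split; case: (leP (x 0 i)) => ?; case: (leP (c 0 i - r)) => ?; lra.
Qed.

Lemma clamp_ball_lipschitz c r x y : `|clamp_ball c r x - clamp_ball c r y| <= `|x - y|.
Proof.
apply: norm_le_entries => // i; apply: le_trans (entry_le_norm (x - y) i).
rewrite !mxE; move: (x 0 i) (y 0 i) (c 0 i - r) (c 0 i + r) => {}x {}y a b.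
have nrm (u v : R) : - `|u - v| <= u - v <= `|u - v| by rewrite -ler_norml lexx.
have hmin (u v : R) : `|Num.min u b - Num.min v b| <= `|u - v|.
  rewrite ler_norml /Order.min; have /andP[? ?] := nrm u v; apply/andP.
  by split; do 2! (case: ifPn; rewrite -?leNgt => ?); lra.
have hmax (u v : R) : `|Num.max a u - Num.max a v| <= `|u - v|.
  rewrite ler_norml /Order.max; have /andP[? ?] := nrm u v; apply/andP.
  by split; do 2! (case: ifPn; rewrite -?leNgt => ?); lra.
exact: le_trans (hmax _ _) (hmin _ _).
Qed.

Lemma locally_lipschitz_partial_ae (O : set E) (f : E -> R) (i : 'I_n.+1) : open O ->
  locally_lipschitz O f ->
  {ae mu, forall x, O x -> derivable (f : E -> R^o) x (delta_mx 0 i)}.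
Proof.
move=> oO /locally_lipschitzP lf.
have : mu.-negligible (O `&` [set x | ~ derivable (f : E -> R^o) x (delta_mx 0 i)]).
  apply: local_negligible => x Ox.
  have [e [K [e0 K0 fK]]] := lf x Ox.
  have /nbhs_ballP[d /= d0 dO] : nbhs x O by exact: open_nbhs_nbhs.
  pose r := Num.min e d / 2.
  have m0 : 0 < Num.min e d by rewrite lt_min e0.
  have r0 : 0 < r by rewrite divr_gt0.
  have rm : r < Num.min e d by rewrite /r; lra.
  exists r => //.
  have FK : lipschitz_by K setT (f \o clamp_ball x r).
    move=> y z _ _.
    have inA w : (ball x e `&` O) (clamp_ball x r w).
      have := clamp_ball_in x w r0 rm => h; split.
        by apply: le_ball h; rewrite ge_min lexx.
      by apply: dO; apply: le_ball h; rewrite ge_min lexx orbT.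
    by apply: (le_trans (fK _ _ (inA y) (inA z))); rewrite ler_wpM2l// clamp_ball_lipschitz.
  apply: negligibleS (lipschitz_partial_ae FK i) => y [/= By Ny]; apply: contra_not Ny.
  apply: near_eq_derivable; near=> z; rewrite /= clamp_ball_id//.
  by near: z; apply: open_nbhs_nbhs; split=> //; exact: ball_open.
apply: negligibleS => x /= /not_implyP[Ox dx]; split=> //.
Unshelve. all: by end_near. Qed.

Lemma locally_lipschitz_derivable_ae (O : set E) (f : E -> R) : open O ->
  locally_lipschitz O f ->
  {ae mu, forall x, O x -> forall i, derivable (f : E -> R^o) x (delta_mx 0 i)}.
Proof.
move=> oO lf.
have h i := locally_lipschitz_partial_ae i oO lf.
have : mu.-negligible (\big[setU/set0]_(i < n.+1)
   ~` [set x | O x -> derivable (f : E -> R^o) x (delta_mx 0 i)]).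
  apply: (big_ind (fun A => mu.-negligible A)).
- exact: negligible_set0.
- by move=> A B; exact: negligibleU.
- by move=> i _; exact: h.
apply: negligibleS => x /= nx.
move/not_implyP: nx => [Ox /existsNP[i di]].
by rewrite (bigD1 i)//=; left => /= /(_ Ox).
Qed.

Lemma gradE (f : E -> R) (x : E) i :
  derivable (f : E -> R^o) x (delta_mx 0 i) ->
  diff_quot f (delta_mx 0 i) x k.+1%:R^-1 @[k --> \oo] --> grad f x 0 i.
Proof.
move=> df; rewrite mxE.
have h : diff_quot f (delta_mx 0 i) x @ 0^' --> 'D_(delta_mx 0 i) (f : E -> R^o) x.
  exact: df.
apply: ((cvgr_dnbhsP _ _ _).1 h); split; last exact: cvg_harmonic.
by move=> k; rewrite /= gt_eqF// invr_gt0.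
Qed.

End gradient.

Section gradient_measurable.
Context {R : realType} {n : nat}.
Local Notation E := 'rV[R]_n.+1.
Local Notation mu := (@lebesgue_rV R n).

(** Almost everywhere the gradient is a limit of difference quotients, which are
    continuous where they are defined inside [O]. *)
Lemma grad_measurable (O : set E) (f : E -> R) : open O -> locally_lipschitz O f ->
  measurable_vec O (grad f).
Proof.
move=> oO lf i.
have mO := open_measurable_rV oO.
have cf := locally_lipschitz_continuous oO lf.
pose e_i : E := delta_mx 0 i.
pose q k x := k.+1%:R * ((f \_ O) (k.+1%:R^-1 *: e_i + x) - f x).
have mq k : measurable_fun O (q k).
  apply: (measurable_funM (measurable_cst _)).
  refine (measurable_funB _ (continuous_measurable_rV oO cf)).
  pose h := k.+1%:R^-1 : R.
  pose Ok : set E := (fun x => h *: e_i + x) @^-1` O.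
  have ch : continuous (fun x : E => h *: e_i + x) by exact: translation_continuous.
  have oOk : open Ok by apply: open_comp => // x _; exact: ch.
  have mOk := open_measurable_rV oOk.
  have -> : (fun x => (f \_ O) (h *: e_i + x)) = (fun x => f (h *: e_i + x)) \_ Ok.
    apply/funext => x; rewrite /patch.
    by have -> : (h *: e_i + x \in O) = (x \in Ok) by apply/idP/idP; rewrite !inE.
  apply/(measurable_restrict _ mOk mO).
  apply: (measurable_funS mOk (@subIsetr _ O Ok)).
  apply: continuous_measurable_rV => // x; rewrite inE => Okx.
  apply: (@cvg_comp _ _ _ (fun x => h *: e_i + x) f); first exact: ch.
  by apply: cf; rewrite inE.
have ae_cvg : {ae mu, forall x, O x -> q k x @[k --> \oo] --> grad f x 0 i}.
  apply: filterS (locally_lipschitz_partial_ae i oO lf) => x hx Ox.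
  apply: cvg_trans (gradE (hx Ox)).
  apply: near_eq_cvg.
  have nO : \forall k \near \oo, O (k.+1%:R^-1 *: e_i + x).
    by apply: (@cvg_translated_ray _ E e_i x); exact: open_nbhs_nbhs.
  apply: filterS nO => k Ok.
  by rewrite /q /diff_quot invrK patchE mem_set.
have [N [mN N0 NP]] := ae_cvg.
have mN' : measurable_fun (O `\` N) (fun x => grad f x 0 i).
  apply: (@measurable_fun_cvg _ _ _ _ q).
    by move=> k; apply: measurable_funS (mq k) => // x [].
  by move=> x [Ox Nx]; apply: contrapT => h; apply: Nx; apply: NP => /(_ Ox).
move=> _ B mB; have := mN' (measurableD mO mN) B mB => h.
rewrite -(setUIDK O N) setIUl; apply: measurableU => //.
apply: negligible_measurable_rV; exists N; split=> //.
by move=> x [[_ Nx] _].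
Qed.

Lemma grad_lin (O : set E) (f g : E -> R) (a : R) : open O ->
  locally_lipschitz O f -> locally_lipschitz O g ->
  {ae mu, forall x, O x -> grad (fun y => a * f y + g y) x = a *: grad f x + grad g x}.
Proof.
move=> oO lf lg.
have := locally_lipschitz_derivable_ae oO lf.
have := locally_lipschitz_derivable_ae oO lg.
apply: filterS2 => x hg hf Ox; apply/rowP => i; rewrite !mxE.
have df := hf Ox i; have dg := hg Ox i.
rewrite -[LHS]/('D_(delta_mx 0 i) ((a \*: (f : E -> R^o)) + (g : E -> R^o)) x).
by rewrite (deriveD (derivableZ df) dg) (deriveZ _ df).
Qed.

Lemma grad_near (f g : E -> R) (x : E) : (\near x, f x = g x) -> grad f x = grad g x.
Proof. by move=> fg; apply/rowP => i; rewrite !mxE; exact: near_eq_derive. Qed.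

End gradient_measurable.

(** * Integrals of real functions *)

Section real_integrals.
Context d (T : measurableType d) (R : realType) (mu : {measure set T -> \bar R}).
Variable D : set T.
Hypothesis mD : measurable D.
Implicit Types f g : T -> R.

Local Notation L1 f := (mu.-integrable D (EFin \o f)).

Lemma L1_measurable f : L1 f -> measurable_fun D f.
Proof. by move=> /measurable_int/measurable_EFinP. Qed.

Lemma L1_lin a f g : L1 f -> L1 g -> L1 (fun x => a * f x + g x).
Proof.
move=> hf hg.
have -> : EFin \o (fun x => a * f x + g x) =
  (fun x => (a%:E * (EFin \o f) x)%E) \+ (EFin \o g) by apply/funext.
by apply: integrableD => //; exact: integrableZl.
Qed.

Lemma Rintegral_lin a f g : L1 f -> L1 g ->
  \int[mu]_(x in D) (a * f x + g x) = a * \int[mu]_(x in D) f x + \int[mu]_(x in D) g x.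
Proof.
move=> hf hg; rewrite -(RintegralZl a mD hf) -RintegralD//.
have -> : EFin \o (fun x => a * f x) = (fun x => (a%:E * (EFin \o f) x)%E).
  exact/funext.
exact: integrableZl.
Qed.

Lemma L1_Z a f : L1 f -> L1 (fun x => a * f x).
Proof.
move=> hf; have -> : EFin \o (fun x => a * f x) = (fun x => (a%:E * (EFin \o f) x)%E).
  exact/funext.
exact: integrableZl.
Qed.

Lemma L1_D f g : L1 f -> L1 g -> L1 (fun x => f x + g x).
Proof.
by move=> hf hg; have -> : EFin \o (fun x => f x + g x) =
  (EFin \o f) \+ (EFin \o g) by []; exact: integrableD.
Qed.

Lemma L1_cst (c : R) : (mu D < +oo)%E -> L1 (fun=> c).
Proof.
move=> h; apply/integrableP; split; first exact/measurable_EFinP/measurable_cst.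
rewrite (_ : (\int[mu]_(x in D) _)%E = (\int[mu]_(x in D) cst `|c%:E|%E x)%E)//.
by rewrite integral_cst//; apply: lte_mul_pinfty.
Qed.

Lemma L1_sum (I : Type) (s : seq I) (f : I -> T -> R) : (forall i, L1 (f i)) ->
  L1 (fun x => \sum_(i <- s) f i x).
Proof.
move=> hf; elim: s => [|i s IH].
  rewrite (_ : EFin \o _ = cst 0%E); first exact: integrable0.
  by apply/funext => x; rewrite /= big_nil.
rewrite (_ : EFin \o _ = EFin \o (fun x => f i x + \sum_(i <- s) f i x)).
  exact: L1_D.
by apply/funext => x; rewrite /= big_cons.
Qed.

Lemma Rintegral_sum (I : Type) (s : seq I) (f : I -> T -> R) : (forall i, L1 (f i)) ->
  \int[mu]_(x in D) (\sum_(i <- s) f i x) = \sum_(i <- s) \int[mu]_(x in D) f i x.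
Proof.
move=> hf; elim: s => [|i s IH].
  rewrite big_nil (@eq_Rintegral _ _ _ mu D (cst 0)); last by move=> x _; rewrite big_nil.
  by rewrite Rintegral_cst// mul0r.
rewrite big_cons -IH -RintegralD//; last exact: L1_sum.
by apply: eq_Rintegral => x _; rewrite big_cons.
Qed.

Lemma ae_dominated_L1 f g : measurable_fun D f -> L1 g ->
  {ae mu, forall x, D x -> `|f x| <= g x} -> L1 f.
Proof.
move=> mf hg [N [mN N0 NP]].
have mf' : measurable_fun D (EFin \o f) by exact/measurable_EFinP.
apply/(negligible_integrable mN mD mf' N0).
have hg' : mu.-integrable (D `\` N) (EFin \o g).
  by apply: integrableS hg => //; exact: measurableD.
apply: le_integrable hg' => //; first exact: measurableD.
  by apply: measurable_funS mf' => //; exact: subDsetl.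
move=> x [Dx Nx] /=; rewrite lee_fin.
have h : `|f x| <= g x.
  by apply: contrapT => h; apply: Nx; apply: NP => /(_ Dx).
by apply: le_trans h _; exact: ler_norm.
Qed.

Lemma dominated_L1 f g : measurable_fun D f -> L1 g ->
  (forall x, D x -> `|f x| <= g x) -> L1 f.
Proof. by move=> mf hg h; apply: (ae_dominated_L1 mf hg); exact: aeW. Qed.

Lemma Rintegral_eq_ae f g : measurable_fun D f -> measurable_fun D g ->
  {ae mu, forall x, D x -> f x = g x} ->
  \int[mu]_(x in D) f x = \int[mu]_(x in D) g x.
Proof.
move=> mf mg fg; rewrite /Rintegral; congr fine; apply: ae_eq_integral => //.
- exact/measurable_EFinP.
- exact/measurable_EFinP.
- by apply: filterS fg => x fgx Dx; rewrite fgx.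
Qed.

Lemma le_Rintegral_ae f g : L1 f -> L1 g ->
  {ae mu, forall x, D x -> f x <= g x} ->
  \int[mu]_(x in D) f x <= \int[mu]_(x in D) g x.
Proof.
move=> hf hg [N [mN N0 NP]]; rewrite /Rintegral.
rewrite (negligible_integral mN mD hf N0) (negligible_integral mN mD hg N0).
have mDN : measurable (D `\` N) by exact: measurableD.
have sub h : L1 h -> mu.-integrable (D `\` N) (EFin \o h).
  by move=> hh; apply: integrableS hh => //; exact: subDsetl.
apply: le_Rintegral => //; try exact: sub.
by move=> x [Dx Nx]; apply: contrapT => h; apply: Nx; apply: NP => /(_ Dx).
Qed.

Lemma EFin_Rintegral f : L1 f ->
  (\int[mu]_(x in D) f x)%:E = (\int[mu]_(x in D) (f x)%:E)%E.
Proof. by move=> hf; rewrite /Rintegral fineK//; exact: integrable_fin_num. Qed.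

Lemma ge0_L1 f : measurable_fun D f -> (forall x, D x -> 0 <= f x) ->
  (\int[mu]_(x in D) (f x)%:E < +oo)%E -> L1 f.
Proof.
move=> mf f0 fy; apply/integrableP; split; first exact/measurable_EFinP.
rewrite (eq_integral (fun x => (f x)%:E))// => x; rewrite inE => Dx /=.
by rewrite ger0_norm// f0.
Qed.

Lemma ge0_Rintegral_eq0 f : L1 f -> (forall x, D x -> 0 <= f x) ->
  \int[mu]_(x in D) f x = 0 -> {ae mu, forall x, D x -> f x = 0}.
Proof.
move=> hf f0 If0.
have mf : measurable_fun D (EFin \o f) by exact: measurable_int hf.
have : (\int[mu]_(x in D) `|(EFin \o f) x| = 0)%E.
  rewrite (eq_integral (fun x => (f x)%:E)); first by rewrite -EFin_Rintegral// If0.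
  by move=> x; rewrite inE => Dx /=; rewrite ger0_norm// f0.
move/(ae_eq_integral_abs mu mD mf); apply: filterS => x h Dx.
by have [] := h Dx.
Qed.

(** Fatou's lemma, in the form in which strong limits inherit bounds. *)
Lemma Fatou_bound (f_ : nat -> T -> R) f (c : R) :
  (forall k, measurable_fun D (f_ k)) -> measurable_fun D f ->
  (forall k x, D x -> 0 <= f_ k x) -> (forall x, D x -> 0 <= f x) ->
  {ae mu, forall x, D x -> f_ k x @[k --> \oo] --> f x} ->
  (\forall k \near \oo, (\int[mu]_(x in D) (f_ k x)%:E <= c%:E)%E) ->
  L1 f /\ \int[mu]_(x in D) f x <= c.
Proof.
move=> mf_ mf f_0 f0 cvgf [k0 _ k0P].
have mE h : measurable_fun D h -> measurable_fun D (EFin \o h).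
  by move=> ?; exact/measurable_EFinP.
have h : (\int[mu]_(x in D) (f x)%:E <= c%:E)%E.
  apply: (@le_trans _ _ (\int[mu]_(x in D) limn_einf (fun k => (f_ k x)%:E))%E).
    apply: ae_ge0_le_integral => //.
    - exact: mE.
    - move=> x Dx; rewrite limn_einf_lim; apply: lime_ge.
        exact: is_cvg_einfs.
      by apply: nearW => k; apply: le_ereal_inf_tmp => _ [j _ <-]; rewrite lee_fin f_0.
    - rewrite (_ : (fun x => _) =
          (fun x => - limn_esup (fun k => (- (f_ k x)%:E)))%E); last first.
        by apply/funext => x; rewrite -limn_einfN; congr limn_einf;
          apply/funext => k; rewrite /comp oppeK.
      apply: measurableT_comp => //.
      apply: measurable_fun_limn_esup => k; apply: measurableT_comp => //; exact: mE.
    - apply: filterS cvgf => x h Dx.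
      have hE : (f_ k x)%:E @[k --> \oo] --> (f x)%:E by apply: cvg_EFin; [exact: nearW|exact: h].
      by rewrite (cvg_limn_einf_sup hE).1.
  apply: (le_trans (fatou mu mD _ _)).
  - by move=> k; exact: mE.
  - by move=> k x Dx; rewrite lee_fin f_0.
  - rewrite limn_einf_lim; apply: lime_le; first exact: is_cvg_einfs.
    near=> k; apply: (@le_trans _ _ (\int[mu]_(x in D) (f_ (maxn k k0) x)%:E)%E).
      by apply: ereal_inf_lbound; exists (maxn k k0) => //=; exact: leq_maxl.
    by apply: k0P => /=; exact: leq_maxr.
have hf : L1 f by apply: ge0_L1 => //; apply: le_lt_trans h (ltry _).
by split=> //; rewrite -lee_fin EFin_Rintegral.
Unshelve. all: by end_near. Qed.

(** Integrals decaying like [8^-j] give pointwise decay like [4^-j], with a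
    dominating function, [\sum_j 4^j h_j], that is integrable. *)
Lemma fast_decay (h_ : nat -> T -> R) :
  (forall j, L1 (h_ j)) -> (forall j x, D x -> 0 <= h_ j x) ->
  (forall j, \int[mu]_(x in D) h_ j x <= (8^-1) ^+ j) ->
  exists S : T -> R, [/\ L1 S, forall x, D x -> 0 <= S x,
    \int[mu]_(x in D) S x <= 2 &
    {ae mu, forall x, D x -> forall j, h_ j x <= S x * (4^-1) ^+ j}].
Proof.
move=> hL h0 hI.
pose g j x := (4 ^+ j * h_ j x)%:E.
have mg j : measurable_fun D (g j).
  by apply/measurable_EFinP; apply: measurable_funM => //; exact: L1_measurable.
have g0 j x : D x -> (0 <= g j x)%E.
  by move=> Dx; rewrite lee_fin mulr_ge0 ?exprn_ge0// h0.
have gI j : (\int[mu]_(x in D) g j x <= ((2^-1 : R) ^+ j)%:E)%E.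
  rewrite -(EFin_Rintegral (L1_Z (4 ^+ j) (hL j))) RintegralZl//.
  rewrite lee_fin (_ : (2^-1 : R) ^+ j = 4 ^+ j * (8^-1) ^+ j).
    by rewrite ler_pM2l// exprn_gt0.
  by rewrite -exprMn; congr (_ ^+ j); lra.
have partial k : \sum_(0 <= j < k) (2^-1 : R) ^+ j <= 2.
  suff -> : \sum_(0 <= j < k) (2^-1 : R) ^+ j = 2 - 2 * 2^-1 ^+ k.
    by rewrite lerBlDr lerDl mulr_ge0// exprn_ge0.
  elim: k => [|k IH]; first by rewrite big_geq// expr0 mulr1 subrr.
  by rewrite big_nat_recr//= IH exprS; field.
have Sint : (\int[mu]_(x in D) (\sum_(j <oo) g j x) <= 2%:E)%E.
  rewrite integral_nneseries//.
  apply: lime_le; first by apply: is_cvg_nneseries => j _ _; apply: integral_ge0 => x; exact: g0.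
  apply: nearW => k; apply: (@le_trans _ _ (\sum_(0 <= j < k) ((2^-1 : R) ^+ j)%:E)%E).
    by apply: lee_sum => j _.
  by rewrite sumEFin lee_fin.
have mS : measurable_fun D (fun x => \sum_(j <oo) g j x)%E.
  by apply: ge0_emeasurable_sum => // j x Dx _; exact: g0.
have hS : mu.-integrable D (fun x => \sum_(j <oo) g j x)%E.
  apply/integrableP; split=> //.
  rewrite (eq_integral (fun x => \sum_(j <oo) g j x)%E).
    exact: le_lt_trans Sint (ltry _).
  by move=> x; rewrite inE => Dx; rewrite gee0_abs// nneseries_ge0// => j _ _; exact: g0.
pose S x := fine (\sum_(j <oo) g j x)%E.
have S0 x : D x -> 0 <= S x.
  by move=> Dx; apply: fine_ge0; apply: nneseries_ge0 => j _ _; exact: g0.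
have mSf : measurable_fun D S by by apply: (measurableT_comp _ mS).
have SI : (\int[mu]_(x in D) (S x)%:E <= 2%:E)%E.
  apply: le_trans Sint; apply: ge0_le_integral => //.
  - exact/measurable_EFinP.
  - move=> x Dx; rewrite /S.
    have : (0 <= \sum_(j <oo) g j x)%E by apply: nneseries_ge0 => j _ _; exact: g0.
    by case: (\sum_(j <oo) g j x)%E => //= r _; rewrite leey.
have LS : L1 S by apply: ge0_L1 => //; apply: le_lt_trans SI (ltry _).
exists S; split=> //; first by rewrite -lee_fin EFin_Rintegral.
have := integrable_ae mD hS; apply: filterS => x fx Dx j.
rewrite -lee_fin EFinM /S fineK; last exact: fx.
have gS : (g j x <= \sum_(j <oo) g j x)%E.
  apply: le_trans (nneseries_lim_ge j.+1 _) => [|i _ _]; last exact: g0.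
  by rewrite big_nat_recr//= leeDr// sume_ge0// => i _; exact: g0.
apply: (@le_trans _ _ (g j x * ((4^-1 : R) ^+ j)%:E)%E); last first.
  by rewrite lee_wpmul2r// lee_fin exprn_ge0.
rewrite /g -EFinM lee_fin mulrAC -exprMn divff// expr1n mul1r.
exact: lexx.
Qed.

End real_integrals.

(** * The weighted space of pairs *)

Section measurability.
Context {R : realType} {n : nat}.
Local Notation E := 'rV[R]_n.+1.
Local Notation mu := (@lebesgue_rV R n).
Variable D : set E.
Hypothesis mD : measurable D.

Lemma measurable_vec_mulmx (V : E -> E) (A : E -> 'M[R]_n.+1) :
  measurable_vec D V -> measurable_mx D A -> measurable_vec D (fun x => V x *m A x).
Proof.
move=> mV mA i.
have -> : (fun x => (V x *m A x) 0 i) = (fun x => \sum_j V x 0 j * A x j i).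
  by apply/funext => x; rewrite mxE.
by apply: measurable_sum => j; exact: (measurable_funM (mV j) (mA j i)).
Qed.

Lemma measurable_dotv (U V : E -> E) :
  measurable_vec D U -> measurable_vec D V -> measurable_fun D (fun x => dotv (U x) (V x)).
Proof.
by move=> mU mV; apply: measurable_sum => i; exact: (measurable_funM (mU i) (mV i)).
Qed.

Lemma measurable_vec_lin (a : R) (U V : E -> E) :
  measurable_vec D U -> measurable_vec D V -> measurable_vec D (fun x => a *: U x + V x).
Proof.
move=> mU mV i.
have -> : (fun x => (a *: U x + V x) 0 i) = (fun x => a * U x 0 i + V x 0 i).
  by apply/funext => x; rewrite !mxE.
exact: (measurable_funD (measurable_funM (measurable_cst _) (mU i)) (mV i)).
Qed.

Lemma measurable_inv (f : E -> R) : measurable_fun D f ->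
  measurable_fun D (fun x => (f x)^-1).
Proof.
move=> mf.
have -> : (fun x => (f x)^-1) = (fun x => f x * (f x * f x) `^ (-1)).
  apply/funext => x; have [->|f0] := eqVneq (f x) 0; first by rewrite invr0 mul0r.
  by rewrite powR_inv1 -?expr2 ?sqr_ge0// expr2 invfM mulrA mulfV// mul1r.
apply: (measurable_funM mf).
exact: (measurableT_comp (measurable_powR (-1)) (measurable_funM mf mf)).
Qed.

Lemma measurable_det m (A : E -> 'M[R]_m) :
  (forall i j, measurable_fun D (fun x => A x i j)) -> measurable_fun D (fun x => \det (A x)).
Proof.
move=> mA; rewrite /determinant; apply: measurable_sum => s.
apply: (measurable_funM (measurable_cst _)).
by apply: measurable_prod => i _; exact: mA.
Qed.

Lemma measurable_invmx (A : E -> 'M[R]_n.+1) : (forall x, D x -> A x \in unitmx) ->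
  measurable_mx D A -> measurable_mx D (fun x => invmx (A x)).
Proof.
move=> uA mA i j.
apply: (@eq_measurable_fun _ _ _ _ _ (fun x => (\det (A x))^-1 * cofactor (A x) j i)).
  by move=> x; rewrite inE => Dx; rewrite /invmx uA// !mxE.
apply: (measurable_funM (measurable_inv (measurable_det mA))).
rewrite /cofactor; apply: (measurable_funM (measurable_cst _)).
apply: measurable_det => k l.
have -> : (fun x => row' j (col' i (A x)) k l) = (fun x => A x (lift j k) (lift i l)).
  by apply/funext => x; rewrite !mxE.
exact: mA.
Qed.

Lemma measurable_fun_negligible (N : set E) (f : E -> R) : measurable N ->
  mu.-negligible N -> measurable_fun (D `\` N) f -> measurable_fun D f.
Proof.
move=> mN N0 mf _ B mB; have := mf (measurableD mD mN) B mB => h.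
rewrite -(setUIDK D N) setIUl; apply: measurableU => //.
apply: negligible_measurable_rV; apply: negligibleS N0.
by move=> x [[_ Nx] _].
Qed.

End measurability.

Section weighted.
Context {R : realType} {n : nat}.
Local Notation E := 'rV[R]_n.+1.
Local Notation mu := (@lebesgue_rV R n).

(** [R^o] is [R] seen as a module over itself, which makes the functions a module
    over [R]. *)
Definition pairs : lmodType R := ((E -> R^o) * (E -> E))%type.

Variables (Q : E -> 'M[R]_n.+1) (Th : set E).
Hypothesis mTh : measurable Th.
Hypothesis mQ : measurable_mx Th Q.
Hypothesis psdQ : forall x, Th x -> psdmx (Q x).
Local Notation L1 f := (mu.-integrable Th (EFin \o f)).

Definition polar (u v : pairs) (x : E) : R :=
  u.1 x * v.1 x + dotv (u.2 x) (v.2 x *m Q x).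

Definition L2Q : set pairs :=
  [set u | [/\ measurable_fun Th (u.1 : E -> R), measurable_vec Th u.2 &
            L1 (polar u u)]].

(** The inner product of [QH1]; its null vectors are the pairs that represent
    zero there. *)
Definition ipQ (u v : pairs) : R := \int[mu]_(x in Th) polar u v x.

Lemma polar_ge0 u x : Th x -> 0 <= polar u u x.
Proof. by move=> Tx; rewrite addr_ge0 ?(psdQ Tx).2// -expr2 sqr_ge0. Qed.

Lemma polarC u v x : Th x -> polar u v x = polar v u x.
Proof. by move=> Tx; rewrite /polar mulrC (psd_formC (psdQ Tx)). Qed.

Lemma polar_linr a u v w x : polar w (a *: u + v) x = a * polar w u x + polar w v x.
Proof.
rewrite /polar /= mulmxDl -scalemxAl dotvDr dotvZr /=.
rewrite -[(a *: u.1 + v.1) x]/(a * u.1 x + v.1 x); ring.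
Qed.

Lemma polar_linl a u v w x : polar (a *: u + v) w x = a * polar u w x + polar v w x.
Proof.
rewrite /polar /= dotvDl dotvZl /=.
rewrite -[(a *: u.1 + v.1) x]/(a * u.1 x + v.1 x); ring.
Qed.

Lemma polar_AMGM u v x : Th x ->
  `|polar u v x| <= (polar u u x + polar v v x) / 2.
Proof.
move=> Tx; apply: (le_trans (ler_normD _ _)); rewrite /polar.
have := psd_AMGM (psdQ Tx) (u.2 x) (v.2 x).
suff : `|u.1 x * v.1 x| <= (u.1 x * u.1 x + v.1 x * v.1 x) / 2 by lra.
have h1 := sqr_ge0 (u.1 x - v.1 x); have h2 := sqr_ge0 (u.1 x + v.1 x).
by rewrite ler_norml; apply/andP; split; rewrite !expr2 in h1 h2; lra.
Qed.

Lemma polar_le_double u v x : Th x ->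
  polar (u + v) (u + v) x <= 2 * polar u u x + 2 * polar v v x.
Proof.
move=> Tx; have := polar_AMGM u v Tx; rewrite ler_norml => /andP[_].
have -> : u + v = 1 *: u + v by rewrite scale1r.
by rewrite polar_linl !polar_linr (polarC v u Tx); lra.
Qed.

Lemma polarZ a u x : polar (a *: u) (a *: u) x = a ^+ 2 * polar u u x.
Proof.
rewrite /polar /= -scalemxAl dotvZl dotvZr /=.
rewrite -[(a *: u.1) x]/(a * u.1 x); ring.
Qed.

Lemma polarN u x : polar (- u) (- u) x = polar u u x.
Proof. by rewrite -scaleN1r polarZ sqrrN expr1n mul1r. Qed.

Lemma measurable_polar u v :
  measurable_fun Th (u.1 : E -> R) -> measurable_fun Th (v.1 : E -> R) ->
  measurable_vec Th u.2 -> measurable_vec Th v.2 -> measurable_fun Th (polar u v).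
Proof.
move=> mu1 mv1 mu2 mv2; apply: (measurable_funD (measurable_funM mu1 mv1)).
exact: (measurable_dotv mu2 (measurable_vec_mulmx mv2 mQ)).
Qed.

Lemma L1_polar u v : L2Q u -> L2Q v -> L1 (polar u v).
Proof.
move=> [mu1 mu2 hu] [mv1 mv2 hv].
apply: (dominated_L1 mTh (measurable_polar mu1 mv1 mu2 mv2)
  (L1_Z mTh 2^-1 (L1_D mTh hu hv))) => x Tx.
by rewrite mulrC; exact: polar_AMGM.
Qed.

Lemma L2Q0 : L2Q 0.
Proof.
split.
- exact: measurable_cst.
- move=> i; rewrite (_ : (fun x => _) = cst 0); first exact: measurable_cst.
  by apply/funext => x; rewrite mxE.
- rewrite (_ : EFin \o _ = cst 0%E); first exact: integrable0.
  apply/funext => x; rewrite /= /polar /= mul0mx mul0r add0r.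
  by rewrite dotv0l.
Qed.

Lemma L2Q_lin a u v : L2Q u -> L2Q v -> L2Q (a *: u + v).
Proof.
move=> hu hv; have [mu1 mu2 Lu] := hu; have [mv1 mv2 Lv] := hv.
have m1 : measurable_fun Th ((a *: u + v).1 : E -> R).
  exact: (measurable_funD (measurable_funM (measurable_cst a) mu1) mv1).
have m2 : measurable_vec Th (a *: u + v).2 by exact: measurable_vec_lin.
split=> //.
apply: (dominated_L1 mTh (measurable_polar m1 m1 m2 m2)
  (L1_D mTh (L1_Z mTh (2 * a ^+ 2) Lu) (L1_Z mTh 2 Lv))) => x Tx.
rewrite ger0_norm ?polar_ge0//; apply: (le_trans (polar_le_double _ _ Tx)).
by rewrite polarZ mulrA.
Qed.

Lemma ipQ_bilin : bilinear_on L2Q ipQ.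
Proof.
split=> [w hw|w hw] a u v hu hv; rewrite /ipQ.
  rewrite -Rintegral_lin//; try exact: L1_polar.
  by apply: eq_Rintegral => x _; rewrite polar_linr.
rewrite -Rintegral_lin//; try exact: L1_polar.
by apply: eq_Rintegral => x _; rewrite polar_linl.
Qed.

Lemma ipQ_sym u v : L2Q u -> L2Q v -> ipQ u v = ipQ v u.
Proof. by move=> _ _; apply: eq_Rintegral => x; rewrite inE => Tx; exact: polarC. Qed.

Lemma ipQ_ge0 u : 0 <= ipQ u u.
Proof. by apply: Rintegral_ge0 => x; exact: polar_ge0. Qed.

Lemma ipQ_eq0 u : L2Q u -> ipQ u u = 0 <-> QHeq Q Th u (@QH0 R n).
Proof.
move=> hu; have [_ _ Lu] := hu.
have key x : Th x -> polar u u x = 0 <-> u.1 x = 0 /\ sqrtQ Q (fun y => u.2 y - 0) x = 0.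
  move=> Tx; rewrite /sqrtQ subr0.
  have s0 : 0 <= u.1 x * u.1 x by rewrite -expr2 sqr_ge0.
  have q0 := (psdQ Tx).2 (u.2 x).
  have e := enorm_sqrtmx (u.2 x) (psdQ Tx).
  split=> [h|[h1 h2]].
    have e1 : u.1 x * u.1 x = 0 by rewrite /polar in h; lra.
    have e2 : dotv (u.2 x) (u.2 x *m Q x) = 0 by rewrite /polar in h; lra.
    split; first by apply/eqP; rewrite -sqrf_eq0 expr2 e1.
    by apply: dotv_eq0; rewrite -enorm_sqr e.
  by rewrite /polar h1 mul0r add0r -e h2 enorm_sqr dotv0l.
split=> [h|[h1 h2]].
  have := ge0_Rintegral_eq0 mTh Lu (fun x => @polar_ge0 u x) h => ae0.
  by split; apply: filterS ae0 => x hx Tx; have [] := (key x Tx).1 (hx Tx).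
rewrite /ipQ (@Rintegral_eq_ae _ _ _ mu Th mTh _ (cst 0)).
- by rewrite Rintegral_cst// mul0r.
- exact: L1_measurable Lu.
- exact: measurable_cst.
- by apply: filterS2 h1 h2 => x hx1 hx2 Tx; apply/(key x Tx); split; [exact: hx1|exact: hx2].
Qed.

End weighted.

Section weighted_complete.
Context {R : realType} {n : nat}.
Local Notation E := 'rV[R]_n.+1.
Local Notation mu := (@lebesgue_rV R n).
Variables (Q : E -> 'M[R]_n.+1) (Th : set E).
Hypothesis mTh : measurable Th.
Hypothesis mQ : measurable_mx Th Q.
Hypothesis psdQ : forall x, Th x -> psdmx (Q x).
Local Notation L1 f := (mu.-integrable Th (EFin \o f)).
Local Notation pairs := (@pairs R n).
Local Notation polar := (polar Q).
Local Notation ipQ := (ipQ Q Th).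
Local Notation L2Q := (L2Q Q Th).

Lemma polarB_sym (u v : pairs) x : polar (u - v) (u - v) x = polar (v - u) (v - u) x.
Proof. by rewrite -opprB polarN. Qed.

Lemma polarBE (u v : pairs) x : polar (u - v) (u - v) x =
  (u.1 x - v.1 x) ^+ 2 + dotv (u.2 x - v.2 x) ((u.2 x - v.2 x) *m Q x).
Proof. by rewrite expr2. Qed.

Lemma telescoped_decay (w : nat -> pairs) x (C : R) : Th x -> 0 <= C ->
  (forall j, polar (w j - w j.+1) (w j - w j.+1) x <= C * (4^-1) ^+ j) ->
  forall N j k, (N <= j)%N -> (N <= k)%N ->
    polar (w j - w k) (w j - w k) x <= 4 * C * (4^-1) ^+ N.
Proof.
have aux (p1 p2 e : R) : p1 <= e -> p2 <= e -> 2 * p1 + 2 * p2 <= 4 * e by lra.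
move=> Tx C0 hw.
have p0 j : 0 <= (4^-1 : R) ^+ j by rewrite exprn_ge0.
have step m j : polar (w j - w (j + m)%N) (w j - w (j + m)%N) x <= 4 * C * (4^-1) ^+ j.
  elim: m j => [|m IH] j.
    by rewrite addn0 subrr -(scale0r (0 : pairs)) polarZ expr0n mul0r !mulr_ge0.
  have -> : w j - w (j + m.+1)%N = (w j - w j.+1) + (w j.+1 - w (j.+1 + m)%N).
    by rewrite addrA subrK addSnnS.
  apply: (le_trans (polar_le_double psdQ _ _ Tx)).
  have h1 := hw j; have h2 := IH j.+1.
  have {}h2 : polar (w j.+1 - w (j.+1 + m)%N) (w j.+1 - w (j.+1 + m)%N) x <=
      C * (4^-1) ^+ j.
    apply: (le_trans h2); rewrite exprS le_eqVlt; apply/orP; left; apply/eqP.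
    by move: ((4^-1) ^+ j) => e; field.
  by rewrite -mulrA; exact: (aux _ _ _ h1 h2).
have main N j k : (N <= j)%N -> (j <= k)%N ->
    polar (w j - w k) (w j - w k) x <= 4 * C * (4^-1) ^+ N.
  move=> Nj jk; have := step (k - j)%N j; rewrite subnKC// => h.
  apply: (le_trans h); rewrite ler_wpM2l//; first by rewrite mulr_ge0.
  by apply: ler_wiXn2l => //; lra.
move=> N j k Nj Nk; have [jk|/ltnW kj] := leqP j k; first exact: main.
by rewrite polarB_sym; exact: main.
Qed.

Definition pair_lim (w : nat -> pairs) : pairs :=
  (fun x => limn (fun k => (w k).1 x : R),
   fun x => \row_i limn (fun m =>
     resolvent_approx (Q x) (\row_j limn (fun k => ((w k).2 x *m Q x) 0 j)) m 0 i)).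

(** The vectors [(w k).2 x] need not converge, their images under [Q x] do; the
    resolvents then select a preimage of the limit in a measurable way. *)
Lemma pair_lim_cvg (w : nat -> pairs) x (C : R) : Th x -> 0 <= C ->
  (forall j, polar (w j - w j.+1) (w j - w j.+1) x <= C * (4^-1) ^+ j) ->
  [/\ (w k).1 x @[k --> \oo] --> ((pair_lim w).1 x : R),
      forall i, ((w k).2 x *m Q x) 0 i @[k --> \oo] -->
         limn (fun k => ((w k).2 x *m Q x) 0 i),
      forall i, resolvent_approx (Q x) (\row_j limn (fun k => ((w k).2 x *m Q x) 0 j)) m 0 i
         @[m --> \oo] --> (pair_lim w).2 x 0 i &
      forall j, polar (w j - pair_lim w) (w j - pair_lim w) x <= 8 * C * (4^-1) ^+ j].
Proof.
move=> Tx C0 hw; have hA := psdQ Tx.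
have small (e : R) : 0 < e -> exists N, 4 * C * (4^-1) ^+ N <= e.
  move=> e0; have [|N NP] := @inv_geometric_small R 4^-1 (4 * C) e _ e0.
    by apply/andP; split; lra.
  by exists N; rewrite mulrC; exact: NP.
have Cau (e : R) : 0 < e -> exists N, forall j k, (N <= j)%N -> (N <= k)%N ->
    polar (w j - w k) (w j - w k) x <= e.
  move=> e0; have [N NP] := small e e0; exists N => j k Nj Nk.
  exact: le_trans (telescoped_decay Tx C0 hw Nj Nk) NP.
have sq1 (a : R) : 0 <= a * a by rewrite -expr2 sqr_ge0.
have cvg1 : (w k).1 x @[k --> \oo] --> ((pair_lim w).1 x : R).
  apply: real_Cauchy_cvg => e e0.
  have [N NP] := Cau _ (exprn_gt0 2 e0); exists N => j k Nj Nk.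
  rewrite -ler_sqr ?nnegrE ?(ltW e0)// real_normK ?num_real//.
  apply: le_trans (NP j k Nj Nk); rewrite /polar /= expr2.
  by have := hA.2 ((w j).2 x - (w k).2 x); rewrite lerDl.
have [V VP] : exists V, forall e : R, 0 < e -> exists N, forall k, (N <= k)%N ->
    dotv ((w k).2 x - V) (((w k).2 x - V) *m Q x) <= e.
  apply: psd_complete => // e e0; have [N NP] := Cau e e0; exists N => j k Nj Nk.
  by apply: le_trans (NP j k Nj Nk); rewrite /polar /= lerDr; exact: sq1.
have cvgV i : ((w k).2 x *m Q x) 0 i @[k --> \oo] --> (V *m Q x) 0 i.
  pose d : E := delta_mx 0 i; pose c := dotv d (d *m Q x).
  have c0 : 0 <= c := hA.2 d.
  have entryE (y : E) : (y *m Q x) 0 i = dotv d (y *m Q x).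
    rewrite /dotv (bigD1 i)//= big1 => [|j ji]; last first.
      by rewrite [d 0 j]mxE (negbTE ji) andbF mul0r.
    by rewrite [d 0 i]mxE !eqxx mul1r addr0.
  have CS (y : E) : (y *m Q x) 0 i ^+ 2 <= c * dotv y (y *m Q x).
    rewrite entryE.
    apply: (@Cauchy_Schwarz_on R E setT (fun u v => dotv u (v *m Q x))) => //.
    - split=> u _ a y1 y2 _ _; rewrite ?mulmxDl ?dotvDr ?dotvDl -?scalemxAl.
        by rewrite dotvZr.
      by rewrite dotvZl.
    - by move=> u v _ _; exact: psd_formC.
    - by move=> u _; exact: hA.2.
  apply/cvgrPdist_le => e e0.
  have [N NP] := VP (e ^+ 2 / (c + 1)) ltac:(by rewrite divr_gt0 ?exprn_gt0//; lra).
  exists N => // k Nk /=; rewrite distrC.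
  rewrite -ler_sqr ?nnegrE ?(ltW e0)// real_normK ?num_real//.
  have -> : ((w k).2 x *m Q x) 0 i - (V *m Q x) 0 i = (((w k).2 x - V) *m Q x) 0 i.
    by rewrite mulmxBl [RHS]mxE [X in _ = _ + X]mxE.
  apply: (le_trans (CS _)); apply: (@le_trans _ _ (c * (e ^+ 2 / (c + 1)))).
    by rewrite ler_wpM2l//; exact: NP.
  by rewrite mulrCA; apply: ler_piMr; rewrite ?sqr_ge0// ler_pdivrMr; lra.
have ZE : \row_j limn (fun k => ((w k).2 x *m Q x) 0 j) = V *m Q x.
  by apply/rowP => j; rewrite mxE; exact: (cvg_lim _ (cvgV j)).
have [U UQ UP] := resolvent_cvg hA V.
have UE : (pair_lim w).2 x = U.
  by apply/rowP => i; rewrite /pair_lim /= ZE mxE; exact: (cvg_lim _ (UP i)).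
split=> //.
- by move=> i; have := cvgV i => h; rewrite (cvg_lim _ h).
- by move=> i; rewrite ZE UE; exact: UP.
move=> j.
have fE y : dotv (y - U) ((y - U) *m Q x) = dotv (y - V) ((y - V) *m Q x).
  have -> : (y - U) *m Q x = (y - V) *m Q x by rewrite !mulmxBl UQ.
  by rewrite !(dotv_mulmx _ _ hA.1) !mulmxBl UQ.
apply/ler_addgt0Pr => e e0.
have e4 : 0 < e / 4 by rewrite divr_gt0.
have [N1 N1P] := VP _ e4.
have /cvgrPdist_le/(_ (Num.min 1 (e / 4))) := cvg1.
rewrite lt_min ltr01 e4 => /(_ isT)[N2 _ N2P].
pose k := maxn j (maxn N1 N2).
have kj : (j <= k)%N by rewrite leq_maxl.
have k1 : (N1 <= k)%N by rewrite /k maxnA (leq_trans (leq_maxr j N1))// leq_maxl.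
have k2 : (N2 <= k)%N by rewrite /k maxnA leq_maxr.
have -> : w j - pair_lim w = (w j - w k) + (w k - pair_lim w) by rewrite addrA subrK.
apply: (le_trans (polar_le_double psdQ _ _ Tx)).
have := telescoped_decay Tx C0 hw (leqnn j) kj.
suff : polar (w k - pair_lim w) (w k - pair_lim w) x <= e / 4 + e / 4.
  by move: ((4^-1) ^+ j) => z; lra.
rewrite polarBE UE fE; apply: lerD; last exact: N1P.
have := N2P k k2; rewrite distrC -(real_normK (num_real (_ - _))).
move: (normr_ge0 ((w k).1 x - (pair_lim w).1 x : R)).
move: `|_| => a a0; rewrite le_min expr2 => /andP[a1 a2]; nra.
Qed.

(** As in the Riesz-Fischer theorem, a rapidly converging subsequence converges
    almost everywhere, with an integrable dominating function. *)
Lemma L2Q_complete : semi_complete L2Q ipQ.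
Proof.
have aux (a b e : R) : a <= e / 4 -> b <= e / 4 -> 2 * a + 2 * b <= e by lra.
move=> u_ hu Cau.
have p8 j : 0 < (8^-1 : R) ^+ j by rewrite exprn_gt0.
have [s0 s0P] : exists s0 : nat -> nat, forall j a b, (s0 j <= a)%N -> (s0 j <= b)%N ->
    ipQ (u_ a - u_ b) (u_ a - u_ b) <= (8^-1) ^+ j.
  suff /choice[s0 s0P] : forall j, exists m, forall a b, (m <= a)%N -> (m <= b)%N ->
    ipQ (u_ a - u_ b) (u_ a - u_ b) <= (8^-1) ^+ j by exists s0.
  by move=> j; exact: Cau.
pose s j := (j + \sum_(0 <= i < j.+1) s0 i)%N.
have ss j k : (j <= k)%N -> (s0 j <= s k)%N.
  move=> jk; rewrite /s (@bigD1_seq _ _ _ _ _ j) ?iota_uniq ?mem_index_iota//=.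
  by rewrite addnCA leq_addr.
pose w j := u_ (s j); have hw j : L2Q (w j) := hu _.
have hB (a b : pairs) : L2Q a -> L2Q b -> L2Q (a - b).
  exact: (submodB (L2Q_lin mTh mQ psdQ)).
have w8 : forall a b, (a <= b)%N -> ipQ (w a - w b) (w a - w b) <= (8^-1) ^+ a.
  by move=> a b ab; apply: s0P; exact: ss.
have [S [LS S0 IS SP]] := @fast_decay _ _ _ mu Th mTh
  (fun j => polar (w j - w j.+1) (w j - w j.+1))
  (fun j => L1_polar mTh mQ psdQ (hB _ _ (hw j) (hw j.+1)) (hB _ _ (hw j) (hw j.+1)))
  (fun j x Tx => polar_ge0 psdQ _ Tx) (fun j => w8 j j.+1 (leqnSn j)).
pose u := pair_lim w.
have good : {ae mu, forall x, Th x ->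
  [/\ (w k).1 x @[k --> \oo] --> (u.1 x : R),
      forall i, ((w k).2 x *m Q x) 0 i @[k --> \oo] -->
         limn (fun k => ((w k).2 x *m Q x) 0 i),
      forall i, resolvent_approx (Q x) (\row_j limn (fun k => ((w k).2 x *m Q x) 0 j)) m 0 i
         @[m --> \oo] --> u.2 x 0 i &
      forall j, polar (w j - u) (w j - u) x <= 8 * S x * (4^-1) ^+ j]}.
  by apply: filterS SP => x hx Tx; apply: pair_lim_cvg => //; [exact: S0|exact: hx].
have [N [mN N0 NP]] := good.
have nN : mu.-negligible N by exists N; split.
have goodD x : (Th `\` N) x -> Th x /\
  [/\ (w k).1 x @[k --> \oo] --> (u.1 x : R),
      forall i, ((w k).2 x *m Q x) 0 i @[k --> \oo] -->
         limn (fun k => ((w k).2 x *m Q x) 0 i),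
      forall i, resolvent_approx (Q x) (\row_j limn (fun k => ((w k).2 x *m Q x) 0 j)) m 0 i
         @[m --> \oo] --> u.2 x 0 i &
      forall j, polar (w j - u) (w j - u) x <= 8 * S x * (4^-1) ^+ j].
  move=> [Tx Nx]; split=> //; apply: contrapT => h; apply: Nx; apply: NP => /= h'.
  exact: h (h' Tx).
have sub (f : E -> R) : measurable_fun Th f -> measurable_fun (Th `\` N) f.
  by move=> mf; apply: (measurable_funS mTh _ mf); exact: subDsetl.
have m1 : measurable_fun Th (u.1 : E -> R).
  apply: (measurable_fun_negligible mTh mN nN).
  apply: (@measurable_fun_cvg _ _ _ _ (fun k x => (w k).1 x : R)).
    by move=> k; apply: sub; have [] := hw k.
  by move=> x /goodD[_ []].
have mZ : measurable_vec (Th `\` N) (fun x => \row_j limn (fun k => ((w k).2 x *m Q x) 0 j)).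
  move=> i; apply: (@measurable_fun_cvg _ _ _ _ (fun k x => ((w k).2 x *m Q x) 0 i)).
    move=> k; apply: sub; have [_ mk _] := hw k.
    exact: (measurable_vec_mulmx mk mQ).
  by move=> x /goodD[_ [_ h _ _]]; rewrite mxE; exact: h.
have m2 : measurable_vec Th u.2.
  move=> i; apply: (measurable_fun_negligible mTh mN nN).
  apply: (@measurable_fun_cvg _ _ _ _ (fun m x =>
    resolvent_approx (Q x) (\row_j limn (fun k => ((w k).2 x *m Q x) 0 j)) m 0 i)).
    move=> m; apply: (measurable_vec_mulmx mZ) => a b.
    apply: measurable_invmx => [x [Tx _]|{}a {}b].
      by apply: psd_shift_unit; [exact: psdQ|rewrite invr_gt0].
    have -> : (fun x => (Q x + m.+1%:R^-1%:M) a b) =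
       (fun x => Q x a b + (m.+1%:R^-1%:M : 'M[R]_n.+1) a b).
      by apply/funext => x; rewrite mxE.
    exact: (measurable_funD (sub _ (mQ a b)) (measurable_cst _)).
  by move=> x /goodD[_ [_ _ h _]]; exact: h.
have m1w j : measurable_fun Th ((w j - u).1 : E -> R).
  by have [mk _ _] := hw j; exact: (measurable_funB mk m1).
have m2w j : measurable_vec Th (w j - u).2.
  have [_ mk _] := hw j; move=> i.
  have -> : (fun x => (w j - u).2 x 0 i) = (fun x => (w j).2 x 0 i - u.2 x 0 i).
    by apply/funext => x; rewrite !mxE.
  exact: (measurable_funB (mk i) (m2 i)).
have Lwu j : L1 (polar (w j - u) (w j - u)).
  apply: (ae_dominated_L1 mTh (measurable_polar mQ (m1w j) (m1w j) (m2w j) (m2w j))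
    (L1_Z mTh (8 * (4^-1) ^+ j) LS)).
  apply: filterS good => x hx Tx; rewrite ger0_norm ?(polar_ge0 psdQ)//.
  by have [_ _ _ h] := hx Tx; rewrite mulrAC; exact: h.
have hwu j : L2Q (w j - u) by split; [exact: m1w|exact: m2w|exact: Lwu].
have Iwu j : ipQ (w j - u) (w j - u) <= 16 * (4^-1) ^+ j.
  apply: (@le_trans _ _ (\int[mu]_(x in Th) (8 * (4^-1) ^+ j * S x))).
    apply: le_Rintegral_ae => //; first exact: L1_Z.
    apply: filterS good => x hx Tx.
    by have [_ _ _ h] := hx Tx; rewrite mulrAC; exact: h.
  rewrite RintegralZl//.
  have -> : 16 * (4^-1) ^+ j = 8 * (4^-1) ^+ j * 2 :> R by ring.
  by rewrite ler_wpM2l// mulr_ge0// exprn_ge0.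
have hu' : L2Q u.
  have -> : u = w 0%N - (w 0%N - u) by rewrite opprB addrC subrK.
  exact: hB.
have S0' := L2Q0 Q Th; have Slin' := L2Q_lin mTh mQ psdQ.
have ipb := ipQ_bilin mTh mQ psdQ.
have ips u v := @ipQ_sym _ _ Q Th psdQ u v.
have ip0 (v : pairs) : L2Q v -> 0 <= ipQ v v by move=> _; exact: ipQ_ge0.
exists u => // e e0.
have e4 : 0 < e / 4 by rewrite divr_gt0.
have [m mP] := Cau _ e4.
have [|j0 j0P] := @inv_geometric_small R 4^-1 16 (e / 4) _ e4.
  by apply/andP; split; lra.
exists m => k mk.
pose j := (maxn m j0).
have sj : (m <= s j)%N by rewrite (leq_trans (leq_maxl m j0))// leq_addr.
have -> : u_ k - u = (u_ k - w j) - (u - w j) by rewrite opprB addrA subrK.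
apply: (le_trans (ip_sub S0' Slin' ipb ips ip0 _ _)); [exact: hB|exact: hB|].
have h1 := mP k (s j) mk sj.
have h2 : ipQ (u - w j) (u - w j) <= e / 4.
  have -> : ipQ (u - w j) (u - w j) = ipQ (w j - u) (w j - u).
    by apply: eq_Rintegral => x _; exact: polarB_sym.
  by apply: (le_trans (Iwu j)); rewrite mulrC; apply: j0P; exact: leq_maxr.
exact: (aux _ _ _ h1 h2).
Qed.

End weighted_complete.

Section Lp_on.
Context {R : realType} {n : nat}.
Local Notation E := 'rV[R]_n.+1.
Local Notation mu := (@lebesgue_rV R n).
Variable Th : set E.
Hypothesis mTh : measurable Th.
Local Notation L1 f := (mu.-integrable Th (EFin \o f)).

Lemma measurable_absX (f : E -> R) (p : R) : measurable_fun Th f ->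
  measurable_fun Th (fun x => `|f x| `^ p).
Proof.
move=> mf; apply: (measurableT_comp (measurable_powR p)).
exact: (measurableT_comp _ mf).
Qed.

Lemma Lnorm_restrict (f : E -> R) (p : R) : p != 0 ->
  Lnorm mu p%:E (EFin \o (f \_ Th)) =
  ((\int[mu]_(x in Th) (`|f x| `^ p)%:E) `^ p^-1)%E.
Proof.
move=> p0; rewrite unlock; apply: (congr1 (fun y => poweR y p^-1)).
rewrite [RHS]integral_mkcond; apply: eq_integral => x _ /=.
rewrite /patch; case: ifP => // _.
by rewrite normr0 powR0.
Qed.

Lemma Lp_onP (p : R) (f : E -> R) : 0 < p ->
  Lp_on Th p%:E f <-> measurable_fun Th f /\ L1 (fun x => `|f x| `^ p).
Proof.
move=> p0; have pN0 : p != 0 by rewrite gt_eqF.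
have mE : f \_ Th \in @mfun _ _ E R <-> measurable_fun Th f.
  split=> [|mf].
    by rewrite inE /= => /(measurable_restrictT _ mTh).
  by rewrite inE /=; exact/(measurable_restrictT _ mTh).
have LE : f \_ Th \in Lfun mu p%:E <-> (f \_ Th \in @mfun _ _ E R) /\
    ((\int[mu]_(x in Th) (`|f x| `^ p)%:E) `^ p^-1 < +oo)%E.
  rewrite -(Lnorm_restrict _ pN0); split=> [/andP[m1 m2]|[m1 m2]].
    by split=> //; rewrite inE in m2.
  by apply/andP; split=> //; rewrite inE.
have m0 x : Th x -> 0 <= `|f x| `^ p by rewrite powR_ge0.
rewrite /Lp_on; split=> [/LE[/mE mf h]|[mf h]].
  split; first exact: mf.
  refine (ge0_L1 (measurable_absX p mf) m0 _).
  by apply: lty_poweRy h; rewrite invr_eq0.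
apply/LE; split; first exact/mE.
by rewrite poweR_lty// -EFin_Rintegral// ltry.
Qed.

Lemma Lp_on_ae_bounded (f : E -> R) : Lp_on Th +oo%E f ->
  measurable_fun Th f /\ exists2 M : R, 0 <= M & {ae mu, forall x, Th x -> `|f x| <= M}.
Proof.
rewrite /Lp_on => /andP[m1 m2].
split; first by apply/(measurable_restrictT _ mTh); rewrite inE in m1.
rewrite inE /= /finite_norm unlock in m2.
case: ifPn m2 => [_|]; last first.
  rewrite lt0e measure_ge0 andbT negbK => /eqP T0 _; exists 0 => //.
  exists setT; split=> //; exact: measurableT.
move=> hy.
have hae := ess_sup_ge mu (abse \o (EFin \o (f \_ Th))).
move: hy hae; set s := ess_sup _ _ => hy hae.
exists (Num.max 0 (fine s)); first by rewrite le_max lexx.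
apply: filterS hae => x /= hx Tx; move: hx; rewrite patchE mem_set//.
case: s hy => [r| |]//= _; rewrite ?lee_fin ?leeNy_eq// => h.
by rewrite le_max h orbT.
Qed.

(** On a set of finite measure the scale of Lebesgue spaces is decreasing. *)
Lemma Lp_on_lower (p : R) (t : \bar R) (f : E -> R) : 0 < p -> (p%:E < t)%E ->
  (mu Th < +oo)%E -> Lp_on Th t f -> measurable_fun Th f /\ L1 (fun x => `|f x| `^ p).
Proof.
case: t => [t| |]// p0 pt Tfin; last first.
  move=> /Lp_on_ae_bounded[mf [M M0 hM]]; split=> //.
  apply: (ae_dominated_L1 mTh (measurable_absX p mf) (L1_cst mTh (M `^ p) Tfin)).
  apply: filterS hM => x hx Tx; rewrite ger0_norm ?powR_ge0//.
  by apply: ge0_ler_powR; rewrite ?nnegrE ?(ltW p0)//; exact: hx.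
rewrite lte_fin in pt; have t0 : 0 < t by exact: lt_trans pt.
move=> /(Lp_onP _ t0)[mf Lf]; split=> //.
apply: (dominated_L1 mTh (measurable_absX p mf) (L1_D mTh (L1_cst mTh 1 Tfin) Lf)) => x Tx.
rewrite ger0_norm ?powR_ge0//.
have [f1|/ltW f1] := leP `|f x| 1.
  apply: (@le_trans _ _ (1 `^ p)); last by rewrite powR1 lerDl powR_ge0.
  by apply: ge0_ler_powR; rewrite ?nnegrE ?(ltW p0).
apply: (@le_trans _ _ (`|f x| `^ t)); last by rewrite lerDr.
by apply: ler_powR => //; exact: ltW.
Qed.

End Lp_on.

Section QH1.
Context {R : realType} {n : nat}.
Local Notation E := 'rV[R]_n.+1.
Local Notation mu := (@lebesgue_rV R n).
Variables (Q : E -> 'M[R]_n.+1) (Th : set E).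
Hypothesis oTh : open Th.
Hypothesis mQ : measurable_mx Th Q.
Hypothesis psdQ : forall x, Th x -> psdmx (Q x).
Local Notation L1 f := (mu.-integrable Th (EFin \o f)).
Local Notation pairs := (@pairs R n).
Local Notation polar := (polar Q).
Local Notation ipQ := (ipQ Q Th).
Local Notation L2Q := (L2Q Q Th).
Let mTh := open_measurable_rV oTh.

Definition graph (phi : E -> R) : pairs := (phi, grad phi).

Lemma enorm_sqrtQ (U : E -> E) x : Th x ->
  enorm (sqrtQ Q U x) ^+ 2 = dotv (U x) (U x *m Q x).
Proof. by move=> Tx; rewrite /sqrtQ enorm_sqrtmx//; exact: psdQ. Qed.

Lemma QHnormE (u : pairs) : measurable_fun Th (u.1 : E -> R) -> measurable_vec Th u.2 ->
  QHnorm Q Th u = ((\int[mu]_(x in Th) (polar u u x)%:E) `^ 2^-1)%E.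
Proof.
move=> m1 m2; rewrite /QHnorm; congr (_ `^ _)%E.
have mq : measurable_fun Th (fun x => dotv (u.2 x) (u.2 x *m Q x)).
  exact: (measurable_dotv m2 (measurable_vec_mulmx m2 mQ)).
rewrite (eq_integral (fun x => ((u.1 x * u.1 x : R))%:E)); last first.
  by move=> x _; rewrite real_normK ?num_real// expr2.
rewrite (@eq_integral _ _ _ mu Th (fun x => (dotv (u.2 x) (u.2 x *m Q x))%:E)
   (fun x => (enorm (sqrtQ Q u.2 x) ^+ 2)%:E)); last first.
  by move=> x; rewrite inE => Tx; rewrite enorm_sqrtQ.
have p1 x : Th x -> (0 <= (u.1 x * u.1 x : R)%:E)%E.
  by move=> _; rewrite lee_fin -expr2 sqr_ge0.
have p2 x : Th x -> (0 <= (dotv (u.2 x) (u.2 x *m Q x))%:E)%E.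
  by move=> Tx; rewrite lee_fin (psdQ Tx).2.
have e1 := (measurable_EFinP Th _).2 (measurable_funM m1 m1).
have e2 := (measurable_EFinP Th _).2 mq.
rewrite [RHS](@eq_integral _ _ _ mu Th (fun x =>
    ((u.1 x * u.1 x : R)%:E + (dotv (u.2 x) (u.2 x *m Q x))%:E)%E)).
  exact: (esym (ge0_integralD mu mTh p1 e1 p2 e2)).
by move=> x _; rewrite -EFinD.
Qed.

Lemma QHnorm_L2Q (u : pairs) : L2Q u -> QHnorm Q Th u = ((ipQ u u) `^ 2^-1)%:E.
Proof. by move=> [m1 m2 Lu]; rewrite QHnormE// -EFin_Rintegral. Qed.

Lemma LipQ_L2Q phi : LipQ Q Th phi -> L2Q (graph phi).
Proof.
move=> [lphi hy].
have m1 : measurable_fun Th (phi : E -> R).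
  exact: continuous_measurable_rV oTh (locally_lipschitz_continuous oTh lphi).
have m2 := grad_measurable oTh lphi.
split=> //; apply: ge0_L1 => //.
- exact: (measurable_polar mQ (u := graph phi) (v := graph phi)).
- by move=> x; exact: polar_ge0.
- by move: hy; rewrite (@QHnormE (graph phi))//; apply: lty_poweRy; rewrite invr_eq0.
Qed.

Lemma L2Q_LipQ phi : locally_lipschitz Th phi -> L2Q (graph phi) -> LipQ Q Th phi.
Proof.
by move=> lphi hL; split=> //; rewrite (@QHnorm_L2Q (graph phi))// ltry.
Qed.

Lemma L2Q_components (u : pairs) : L2Q u <->
  [/\ Lp_on Th 2%:E (u.1 : E -> R), measurable_vec Th u.2 &
      Lp_on Th 2%:E (fun x => enorm (sqrtQ Q u.2 x))].
Proof.
have sq (a : R) : `|a| `^ 2 = a ^+ 2.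
  by rewrite powR_mulrn// real_normK// num_real.
have two0 : 0 < 2 :> R by [].
split=> [[m1 m2 Lu]|[/(Lp_onP mTh _ two0)[m1 L1u] m2 /(Lp_onP mTh _ two0)[m3 L2u]]].
  have mq : measurable_fun Th (fun x => dotv (u.2 x) (u.2 x *m Q x)).
    exact: (measurable_dotv m2 (measurable_vec_mulmx m2 mQ)).
  have sq0 (a : R) : 0 <= a * a by rewrite -expr2 sqr_ge0.
  have me : measurable_fun Th (fun x => enorm (sqrtQ Q u.2 x)).
    apply: (@eq_measurable_fun _ _ _ _ _ (fun x =>
        (dotv (u.2 x) (u.2 x *m Q x)) `^ 2^-1)).
      move=> x; rewrite inE => Tx; rewrite powR12_sqrt ?(psdQ Tx).2//.
      by rewrite -enorm_sqrtQ// sqrtr_sqr ger0_norm// sqrtr_ge0.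
    exact: (measurableT_comp (measurable_powR 2^-1) mq).
  split; [|exact: m2|].
    apply/(Lp_onP mTh _ two0); split; first exact: m1.
    apply: (dominated_L1 mTh (measurable_absX _ m1) Lu) => x Tx.
    rewrite sq normrX real_normK ?num_real// expr2 /polar lerDl.
    exact: (psdQ Tx).2.
  apply/(Lp_onP mTh _ two0); split; first exact: me.
  apply: (dominated_L1 mTh (measurable_absX _ me) Lu) => x Tx.
  rewrite sq normrX real_normK ?num_real// enorm_sqrtQ// /polar lerDr.
  exact: sq0.
split=> //.
have h := L1_D mTh L1u L2u.
apply: (dominated_L1 mTh (measurable_polar mQ m1 m1 m2 m2) h) => x Tx.
rewrite ger0_norm ?(polar_ge0 psdQ)// !sq enorm_sqrtQ//.
Qed.

(** [QH1] is the closure in the weighted space of the graphs of Lipschitz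
    functions. *)
Lemma QH1P (u : pairs) : QH1 Q Th u <-> L2Q u /\
  forall e : R, 0 < e -> exists2 phi, LipQ Q Th phi &
    ipQ (graph phi - u) (graph phi - u) <= e.
Proof.
have hB (a b : pairs) : L2Q a -> L2Q b -> L2Q (a - b).
  exact: (submodB (L2Q_lin mTh mQ psdQ)).
have sqE (a : R) : 0 <= a -> (a `^ 2^-1) ^+ 2 = a.
  by move=> a0; rewrite powR12_sqrt// sqr_sqrtr.
split=> [[h1 h2 h3 [phi [hphi cphi]]]|[hu happ]].
  have hu : L2Q u by apply/L2Q_components.
  split=> // e e0.
  have /cphi[j _ /(_ j (leqnn j)) hlt0] :
      nbhs (0%E : \bar R) [set y | (y < (e `^ 2^-1)%:E)%E].
    by apply: open_ereal_lt'; rewrite lte_fin powR_gt0.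
  have : (QHnorm Q Th ((graph (phi j) - u)%R : pairs) < (e `^ 2^-1)%:E)%E by exact: hlt0.
  have hj : L2Q (graph (phi j) - u) by apply: hB => //; exact: LipQ_L2Q.
  rewrite QHnorm_L2Q// lte_fin => hlt; exists (phi j) => //.
  have ipg : 0 <= ipQ (graph (phi j) - u) (graph (phi j) - u) := ipQ_ge0 psdQ _.
  rewrite -(sqE _ ipg) -(sqE _ (ltW e0)).
  by rewrite ler_sqr ?nnegrE ?powR_ge0// ltW.
have /L2Q_components[h1 h2 h3] := hu; split=> //.
have h j : exists phi, LipQ Q Th phi /\
    ipQ (graph phi - u) (graph phi - u) <= (j.+1%:R^-1) ^+ 2.
  have j0 : 0 < j.+1%:R^-1 :> R by rewrite invr_gt0.
  have [phi lp hp] := happ _ (exprn_gt0 2 j0).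
  by exists phi.
have /choice[phi phiP] := h.
exists phi; split=> [j|]; first exact: (phiP j).1.
have L2j j : L2Q (graph (phi j) - u) by apply: hB => //; exact: LipQ_L2Q (phiP j).1.
have hle j : (0 <= QHnorm Q Th ((graph (phi j) - u)%R : pairs) <= (j.+1%:R^-1)%:E)%E.
  have j0 : 0 < j.+1%:R^-1 :> R by rewrite invr_gt0.
  rewrite QHnorm_L2Q// !lee_fin powR_ge0/=.
  rewrite -ler_sqr ?nnegrE ?powR_ge0 ?(ltW j0)// sqE; last exact: ipQ_ge0.
  exact: (phiP j).2.
have c0 : cst 0%E j @[j --> \oo] --> (0%E : \bar R) by exact: cvg_cst.
have c1 : (j.+1%:R^-1)%:E @[j --> \oo] --> (0%E : \bar R).
  by apply: cvg_EFin; [exact: nearW|exact: cvg_harmonic].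
exact: (squeeze_cvge (nearW _ hle) c0 c1).
Qed.

Definition QH1set : set pairs := [set u : pairs | QH1 Q Th u].

Lemma QH1_L2Q u : QH1set u -> L2Q u.
Proof. by move=> /QH1P[]. Qed.

Lemma ipQ_small_sub u v (e : R) : L2Q u -> L2Q v -> ipQ u u <= e / 4 ->
  ipQ v v <= e / 4 -> ipQ (u - v) (u - v) <= e.
Proof.
have aux (a b : R) : a <= e / 4 -> b <= e / 4 -> 2 * a + 2 * b <= e by lra.
move=> hu hv h1 h2; apply: le_trans (aux _ _ h1 h2).
apply: (ip_sub (L2Q0 Q Th) (L2Q_lin mTh mQ psdQ) (ipQ_bilin mTh mQ psdQ)
  (@ipQ_sym _ _ Q Th psdQ)) => // w _; exact: ipQ_ge0.
Qed.

Lemma QH1_graph phi : LipQ Q Th phi -> QH1set (graph phi).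
Proof.
move=> hphi; apply/QH1P; split; first exact: LipQ_L2Q.
move=> e e0; exists phi => //; rewrite subrr.
by rewrite (linear_on0 (L2Q0 Q Th) ((ipQ_bilin mTh mQ psdQ).1 _ (L2Q0 Q Th))) ltW.
Qed.

Lemma LipQ_lin a phi psi : LipQ Q Th phi -> LipQ Q Th psi ->
  LipQ Q Th (fun x => a * phi x + psi x) /\
  ipQ (graph (fun x => a * phi x + psi x) - (a *: graph phi + graph psi))
      (graph (fun x => a * phi x + psi x) - (a *: graph phi + graph psi)) = 0.
Proof.
move=> hphi hpsi.
have ll := locally_lipschitz_lin a hphi.1 hpsi.1.
have gl := grad_lin a oTh hphi.1 hpsi.1.
have hc := L2Q_lin mTh mQ psdQ a (LipQ_L2Q hphi) (LipQ_L2Q hpsi).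
have [mc1 mc2 Lc] := hc.
set w := fun x => a * phi x + psi x.
have m1 : measurable_fun Th (w : E -> R).
  exact: continuous_measurable_rV oTh (locally_lipschitz_continuous oTh ll).
have m2 := grad_measurable oTh ll.
have hw : L2Q (graph w).
  split=> //.
  apply: (ae_dominated_L1 mTh (measurable_polar mQ (u := graph w) (v := graph w)
    m1 m1 m2 m2) Lc).
  apply: filterS gl => x gx Tx; rewrite ger0_norm ?(polar_ge0 psdQ)//.
  by rewrite /polar /= gx.
split; first exact: L2Q_LipQ.
have [k1 k2 k3] : L2Q (graph w - (a *: graph phi + graph psi)).
  exact: (submodB (L2Q_lin mTh mQ psdQ)).
rewrite /ipQ (@Rintegral_eq_ae _ _ _ mu Th mTh _ (cst 0)).
- by rewrite Rintegral_cst// mul0r.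
- exact: L1_measurable k3.
- exact: measurable_cst.
- apply: filterS gl => x gx Tx; rewrite polarBE /= gx //.
  by rewrite !subrr dotv0l expr0n addr0.
Qed.

Lemma QH1_lin a u v : QH1set u -> QH1set v -> QH1set (a *: u + v).
Proof.
move=> /QH1P[hu au] /QH1P[hv av]; apply/QH1P.
have Slin := L2Q_lin mTh mQ psdQ.
split; first exact: Slin.
move=> e e0.
have a0 : 0 < a ^+ 2 + 1 by rewrite ltr_wpDl// sqr_ge0.
have e16 : 0 < e / 16 by rewrite divr_gt0.
have [phi hphi phiP] := au (e / 16 / (a ^+ 2 + 1)) (divr_gt0 e16 a0).
have [psi hpsi psiP] := av _ e16.
have [hw w0] := LipQ_lin a hphi hpsi.
set w := fun x => a * phi x + psi x in hw w0 *.
exists w => //.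
have gp := LipQ_L2Q hphi; have gq := LipQ_L2Q hpsi; have gw := LipQ_L2Q hw.
set c := a *: graph phi + graph psi in w0.
have hB (y z : pairs) : L2Q y -> L2Q z -> L2Q (y - z) by exact: (submodB Slin).
have dE : graph w - (a *: u + v) =
    (graph w - c) - (- (a *: (graph phi - u) + (graph psi - v))).
  have h : a *: (graph phi - u) + (graph psi - v) = c - (a *: u + v).
    by rewrite scalerBr addrACA -opprD.
  by rewrite opprK h addrA subrK.
have hd : L2Q (a *: (graph phi - u) + (graph psi - v)).
  by apply: Slin; exact: hB.
rewrite dE; apply: ipQ_small_sub.
- by apply: hB => //; exact: Slin.
- by rewrite -sub0r; apply: hB => //; exact: L2Q0.
- by rewrite w0 divr_ge0// ltW.
have -> (z : pairs) : ipQ (- z) (- z) = ipQ z z.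
  by apply: eq_Rintegral => x _; exact: polarN.
have -> : a *: (graph phi - u) + (graph psi - v) = a *: (graph phi - u) - (v - graph psi).
  by rewrite opprB.
apply: ipQ_small_sub.
- by apply: (submodZ (L2Q0 Q Th) Slin); exact: hB.
- exact: hB.
- have -> : ipQ (a *: (graph phi - u)) (a *: (graph phi - u)) =
      a ^+ 2 * ipQ (graph phi - u) (graph phi - u).
    have [_ _ LL] := hB _ _ gp hu.
    rewrite /ipQ -RintegralZl//; apply: eq_Rintegral => x _; exact: polarZ.
  apply: (@le_trans _ _ (a ^+ 2 * (e / 16 / (a ^+ 2 + 1)))).
    by rewrite ler_wpM2l ?sqr_ge0.
  rewrite mulrCA; have -> : e / 4 / 4 = e / 16 by field.
  by apply: ler_piMr; [exact: ltW|rewrite ler_pdivrMr// mul1r lerDl].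
have -> : ipQ (v - graph psi) (v - graph psi) = ipQ (graph psi - v) (graph psi - v).
  by apply: eq_Rintegral => x _; exact: polarB_sym.
by have -> : e / 4 / 4 = e / 16 by field.
Qed.

Lemma QH10 : QH1set 0.
Proof.
have h : (0 : pairs) = graph (fun=> 0).
  apply/pair_equal_spec; split=> //; apply/funext => x; apply/rowP => i.
  rewrite !mxE; apply/esym; exact: (@derive_cst R E R^o).
rewrite h; apply: QH1_graph; apply: L2Q_LipQ; first exact: locally_lipschitz_cst.
by rewrite -h; exact: L2Q0.
Qed.

Lemma QH1_complete : semi_complete QH1set ipQ.
Proof.
move=> u_ hu Cau.
have [u hL uP] := L2Q_complete mTh mQ psdQ (fun k => QH1_L2Q (hu k)) Cau.
exists u; last exact: uP.
apply/QH1P; split; first exact: hL.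
move=> e e0.
have e4 : 0 < e / 4 by rewrite divr_gt0.
have [k kP] := uP _ e4.
have /QH1P[huk /(_ _ e4)[phi hphi phiP]] := hu k.
exists phi; first exact: hphi.
have -> : graph phi - u = (graph phi - u_ k) - (u - u_ k).
  by rewrite opprB addrA subrK.
have hB (y z : pairs) : L2Q y -> L2Q z -> L2Q (y - z).
  exact: (submodB (L2Q_lin mTh mQ psdQ)).
have h1 : L2Q (graph phi - u_ k) by apply: hB; [exact: LipQ_L2Q|exact: huk].
have h2 : L2Q (u - u_ k) by apply: hB; [exact: hL|exact: huk].
have h3 : ipQ (u - u_ k) (u - u_ k) <= e / 4.
  have -> : ipQ (u - u_ k) (u - u_ k) = ipQ (u_ k - u) (u_ k - u).
    by apply: eq_Rintegral => x _; exact: polarB_sym.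
  exact: (kP k (leqnn k)).
exact: (ipQ_small_sub h1 h2 phiP h3).
Qed.

End QH1.

(** * Consequences of the global Poincare inequality *)

Lemma powR_cvg {R : realType} (s : nat -> R) (l p : R) : 0 < p -> 0 <= l ->
  (forall j, 0 <= s j) -> s j @[j --> \oo] --> l ->
  s j `^ p @[j --> \oo] --> l `^ p.
Proof.
move=> p0; rewrite le_eqVlt => /predU1P[<-|l0] s0 cs; last first.
  have dl : derivable (fun x : R => x `^ p) l 1.
    by have [] := is_derive1_powR p l0.
  have cl : {for l, continuous (fun x : R => x `^ p)}.
    exact/differentiable_continuous/derivable1_diffP.
  exact: (cvg_comp s (fun x : R => x `^ p) cs cl).
rewrite powR0 ?lt0r_neq0//; apply/cvgrPdist_le => e e0.
have ep : 0 < e `^ p^-1 by rewrite powR_gt0.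
have /cvgrPdist_le/(_ _ ep)[k _ kP] := cs.
exists k => // j kj; have := kP j kj.
rewrite /= !sub0r !normrN !ger0_norm ?powR_ge0// => h.
have -> : e = (e `^ p^-1) `^ p by rewrite -powRrM mulVf ?lt0r_neq0// powRr1// ltW.
by apply: ge0_ler_powR; rewrite ?nnegrE ?(ltW p0) ?(ltW ep).
Qed.

Section sobolev_gain.
Context {R : realType} {n : nat}.
Local Notation E := 'rV[R]_n.+1.
Local Notation mu := (@lebesgue_rV R n).
Variables (Q : E -> 'M[R]_n.+1) (Th : set E) (omega : R).
Hypothesis oTh : open Th.
Hypothesis mQ : measurable_mx Th Q.
Hypothesis psdQ : forall x, Th x -> psdmx (Q x).
Hypothesis omega_gt1 : 1 < omega.
Local Notation L1 f := (mu.-integrable Th (EFin \o f)).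
Local Notation pairs := (@pairs R n).
Local Notation ipQ := (ipQ Q Th).
Local Notation L2Q := (L2Q Q Th).
Local Notation QH1set := (QH1set Q Th).
Let mTh := open_measurable_rV oTh.
Local Notation omega' := (omega / (omega - 1)).

Lemma omega_gt0 : 0 < omega. Proof. exact: lt_trans omega_gt1. Qed.

Lemma omega'_gt0 : 0 < omega'.
Proof. by rewrite divr_gt0 ?omega_gt0// subr_gt0. Qed.

(** [omega'] is the exponent conjugate to [omega]. *)
Lemma Hoelder_square (w v : E -> R) :
  measurable_fun Th w -> (forall x, Th x -> 0 <= w x) ->
  L1 (fun x => w x `^ omega') ->
  measurable_fun Th v -> L1 (fun x => `|v x| `^ (2 * omega)) ->
  L1 (fun x => w x * v x ^+ 2) /\
  \int[mu]_(x in Th) (w x * v x ^+ 2) <=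
    (\int[mu]_(x in Th) (w x `^ omega')) `^ omega'^-1 *
    (\int[mu]_(x in Th) (`|v x| `^ (2 * omega))) `^ omega^-1.
Proof.
move=> mw w0 Lw mv Lv.
have o0 := omega_gt0; have o'0 := omega'_gt0.
have mv2 : measurable_fun Th (fun x => v x ^+ 2) by exact: measurable_funX.
have mwv : measurable_fun Th (fun x => w x * v x ^+ 2) by exact: (measurable_funM mw mv2).
have wv0 x : Th x -> 0 <= w x * v x ^+ 2 by move=> Tx; rewrite mulr_ge0 ?w0 ?sqr_ge0.
have conj : omega'^-1 + omega^-1 = 1.
  by rewrite invf_div; field; rewrite gt_eqF.
have rm (f : E -> R) : measurable_fun Th f -> measurable_fun setT (f \_ Th).
  by move=> mf; exact/(measurable_restrictT _ mTh).
have := @hoelder _ _ _ mu _ _ omega' omega (rm _ mw) (rm _ mv2) o'0 o0 conj.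
rewrite (Lnorm_restrict _ _ (lt0r_neq0 o'0)) (Lnorm_restrict _ _ (lt0r_neq0 o0)).
rewrite Lnorm1.
rewrite [X in (X <= _)%E](_ : _ = (\int[mu]_(x in Th) (w x * v x ^+ 2)%:E)%E); last first.
  rewrite [RHS]integral_mkcond; apply: eq_integral => x _.
  rewrite /= /patch; case: ifPn => [|_]; last by rewrite mul0r normr0.
  by rewrite inE => Tx; rewrite ger0_norm// wv0.
have eqw x : x \in Th -> (`|w x| `^ omega')%:E = (w x `^ omega')%:E.
  by rewrite inE => Tx; rewrite (ger0_norm (w0 _ Tx)).
have eqv x : x \in Th -> (`|v x ^+ 2| `^ omega)%:E = (`|v x| `^ (2 * omega))%:E.
  by move=> _; rewrite normrX -powR_mulrn// -powRrM.
rewrite (eq_integral _ _ eqw) (eq_integral _ _ eqv).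
rewrite -(EFin_Rintegral mTh Lw) -(EFin_Rintegral mTh Lv) !poweR_EFin -EFinM => h.
have Lwv : L1 (fun x => w x * v x ^+ 2).
  by apply: (ge0_L1 mwv wv0); exact: le_lt_trans h (ltry _).
by split=> //; rewrite -lee_fin EFin_Rintegral.
Qed.

Variable C4 : R.
Hypothesis C40 : 0 < C4.
Hypothesis hglobal : forall f, LipQ Q Th f ->
    ((\int[mu]_(x in Th) (`|f x| `^ (2 * omega))%:E) `^ (2 * omega)^-1
     <= C4%:E * (\int[mu]_(x in Th) (enorm (sqrtQ Q (grad f) x) ^+ 2)%:E
                 + \int[mu]_(x in Th) (`|f x| ^+ 2)%:E) `^ 2^-1)%E.

Lemma LipQ_gain phi : LipQ Q Th phi ->
  (\int[mu]_(x in Th) (`|phi x| `^ (2 * omega))%:E <=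
    ((C4 ^+ 2 * ipQ (graph phi) (graph phi)) `^ omega)%:E)%E.
Proof.
move=> hphi; have o0 := omega_gt0.
have o2 : 0 < 2 * omega by rewrite mulr_gt0.
have o2N : (2 * omega)^-1 != 0 by rewrite invr_neq0// lt0r_neq0.
have := hglobal hphi.
have hL := LipQ_L2Q oTh mQ psdQ hphi.
have := QHnorm_L2Q oTh mQ psdQ hL; rewrite /QHnorm /= addeC => ->.
have ip0 := ipQ_ge0 psdQ (graph phi).
rewrite -EFinM => h.
have Jfin : (\int[mu]_(x in Th) (`|phi x| `^ (2 * omega))%:E < +oo)%E.
  by apply: (lty_poweRy o2N); exact: le_lt_trans h (ltry _).
have J0 : (0 <= \int[mu]_(x in Th) (`|phi x| `^ (2 * omega))%:E)%E.
  by apply: integral_ge0 => x _; rewrite lee_fin powR_ge0.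
move: Jfin J0 h; case: (\int[mu]_(x in Th) _)%E => //= J _ J0.
rewrite !lee_fin in J0 *; rewrite powR12_sqrt// => h.
have -> : J = (J `^ (2 * omega)^-1) `^ (2 * omega).
  by rewrite -powRrM mulVf ?lt0r_neq0// powRr1.
apply: (@le_trans _ _ ((C4 * Num.sqrt (ipQ (graph phi) (graph phi))) `^ (2 * omega))).
  by apply: ge0_ler_powR; rewrite ?nnegrE ?powR_ge0 ?mulr_ge0 ?sqrtr_ge0 ?(ltW o0) ?(ltW C40).
rewrite powRrM powR_mulrn ?mulr_ge0 ?sqrtr_ge0 ?(ltW C40)//.
by rewrite exprMn sqr_sqrtr.
Qed.

(** The gain of integrability passes to limits by Fatou's lemma. *)
Lemma QH1_gain u (d : R) : QH1set u -> 0 < d ->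
  L1 (fun x => `|u.1 x : R| `^ (2 * omega)) /\
  \int[mu]_(x in Th) (`|u.1 x : R| `^ (2 * omega)) <=
    (C4 ^+ 2 * (2 * ipQ u u + d)) `^ omega.
Proof.
move=> hu d0; have /(QH1P oTh mQ psdQ)[hL happ] := hu.
have hB (a b : pairs) : L2Q a -> L2Q b -> L2Q (a - b).
  exact: (submodB (L2Q_lin mTh mQ psdQ)).
have /choice[phi phiP] : forall j, exists f, LipQ Q Th f /\
    ipQ (graph f - u) (graph f - u) <= (8^-1) ^+ j.
  move=> j; have p8 : 0 < (8^-1 : R) ^+ j by rewrite exprn_gt0.
  by have [f hf fP] := happ _ p8; exists f.
have hphi j := LipQ_L2Q oTh mQ psdQ (phiP j).1.
have mphi j : measurable_fun Th (phi j : E -> R) by have [] := hphi j.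
have [mu1 mu2 Lu] := hL.
have Ld j : L1 (fun x => (phi j x - u.1 x) ^+ 2 : R).
  have [k1 k2 k3] := hB _ _ (hphi j) hL.
  apply: (dominated_L1 mTh _ k3).
    exact: (measurable_funX _ (measurable_funB (mphi j) mu1)).
  move=> x Tx; rewrite ger0_norm ?sqr_ge0// polarBE lerDl.
  exact: (psdQ Tx).2.
have Id j : \int[mu]_(x in Th) ((phi j x - u.1 x) ^+ 2 : R) <= (8^-1) ^+ j.
  have [k1 k2 k3] := hB _ _ (hphi j) hL.
  apply: le_trans (phiP j).2; apply: le_Rintegral => // x Tx.
  by rewrite polarBE lerDl; exact: (psdQ Tx).2.
have [S [LS S0 IS SP]] := @fast_decay _ _ _ mu Th mTh _ Ld
  (fun j x _ => sqr_ge0 _) Id.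
have o0 := omega_gt0; have o2 : 0 < 2 * omega by rewrite mulr_gt0.
apply: (@Fatou_bound _ _ _ mu Th mTh (fun j x => `|phi j x| `^ (2 * omega))).
- by move=> j; exact: measurable_absX.
- exact: measurable_absX.
- by move=> j x _; rewrite powR_ge0.
- by move=> x _; rewrite powR_ge0.
- apply: filterS SP => x hx Tx.
  have cphi : phi j x @[j --> \oo] --> (u.1 x : R).
    apply/cvgrPdist_le => e e0.
    have [|N NP] := @inv_geometric_small R 4^-1 (S x) _ _ (exprn_gt0 2 e0).
      by apply/andP; split; lra.
    exists N => // j /= Nj; rewrite distrC.
    rewrite -ler_sqr ?nnegrE ?(ltW e0)// real_normK ?num_real//.
    by apply: (le_trans (hx Tx j)); rewrite mulrC; exact: NP.
  have cn : `|phi j x| @[j --> \oo] --> `|u.1 x : R| by exact: cvg_norm.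
  exact: (powR_cvg o2 (normr_ge0 _) (fun=> normr_ge0 _) cn).
have [|N NP] := @inv_geometric_small R 8^-1 2 _ _ d0.
  by apply/andP; split; lra.
exists N => // j /= Nj; apply: (le_trans (LipQ_gain (phiP j).1)).
rewrite lee_fin; apply: ge0_ler_powR; rewrite ?nnegrE ?(ltW o0)//.
- by rewrite mulr_ge0 ?sqr_ge0// ipQ_ge0.
- by rewrite mulr_ge0 ?sqr_ge0// addr_ge0 ?(ltW d0)// mulr_ge0// ipQ_ge0.
rewrite ler_wpM2l ?sqr_ge0//.
have -> : graph (phi j) = u - (u - graph (phi j)) by rewrite opprB addrC subrK.
have h1 := ip_sub (L2Q0 Q Th) (L2Q_lin mTh mQ psdQ) (ipQ_bilin mTh mQ psdQ)
  (@ipQ_sym _ _ Q Th psdQ) (fun u _ => ipQ_ge0 psdQ u) hL (hB _ _ hL (hphi j)).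
apply: (le_trans h1); rewrite lerD2l.
have -> : ipQ (u - graph (phi j)) (u - graph (phi j)) = ipQ (graph (phi j) - u) (graph (phi j) - u).
  by apply: eq_Rintegral => x _; exact: polarB_sym.
apply: le_trans (NP j Nj); rewrite mulrC; apply: ler_wpM2r => //.
exact: (phiP j).2.
Qed.

Lemma L2Q_sqr u : L2Q u -> L1 (fun x => (u.1 x : R) ^+ 2).
Proof.
move=> [mu1 mu2 Lu]; apply: (dominated_L1 mTh (measurable_funX _ mu1) Lu) => x Tx.
by rewrite ger0_norm ?sqr_ge0// expr2 /polar lerDl; exact: (psdQ Tx).2.
Qed.

(** The gain [omega] in integrability is exactly what the conjugate exponent of
    the weight requires in Hoelder's inequality. *)
Lemma QH1_weighted (w : E -> R) : measurable_fun Th w -> (forall x, Th x -> 0 <= w x) ->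
  L1 (fun x => w x `^ omega') -> forall u, QH1set u ->
  L1 (fun x => w x * (u.1 x : R) ^+ 2) /\
  \int[mu]_(x in Th) (w x * (u.1 x : R) ^+ 2) <=
    2 * C4 ^+ 2 * (\int[mu]_(x in Th) (w x `^ omega')) `^ omega'^-1 * ipQ u u.
Proof.
move=> mw w0 Lw u hu.
have [[mu1 _ _] _] := (QH1P oTh mQ psdQ u).1 hu.
have [Lg _] := QH1_gain hu ltr01.
have [Lwu Iwu] := Hoelder_square mw w0 Lw mu1 Lg.
split; first exact: Lwu.
move: Iwu; set A := (\int[mu]_(x in Th) (w x `^ omega')) `^ omega'^-1.
have : 0 <= A by exact: powR_ge0.
move: A => A A0 Iwu.
have C2 := sqr_ge0 C4.
apply/ler_addgt0Pr => e e0.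
pose d := e / (C4 ^+ 2 * A + 1).
have c1 : 0 < C4 ^+ 2 * A + 1 := ltr_wpDl (mulr_ge0 C2 A0) ltr01.
have d0 : 0 < d := divr_gt0 e0 c1.
have [_ Ig] := QH1_gain hu d0.
have ip0 := ipQ_ge0 psdQ u.
have X0 : 0 <= C4 ^+ 2 * (2 * ipQ u u + d).
  exact: (mulr_ge0 C2 (addr_ge0 (mulr_ge0 (ler0n _ 2) ip0) (ltW d0))).
apply: (le_trans Iwu); apply: (@le_trans _ _ (A * (C4 ^+ 2 * (2 * ipQ u u + d)))).
  apply: (ler_wpM2l A0).
  have oN : omega != 0 := lt0r_neq0 omega_gt0.
  rewrite -[leRHS](@powRr1 _ _ X0) -[X in _ <= _ `^ X](mulfV oN) powRrM.
  apply: ge0_ler_powR; rewrite ?nnegrE ?powR_ge0 ?invr_ge0 ?(ltW omega_gt0)//.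
  by apply: Rintegral_ge0 => x _; exact: powR_ge0.
have -> : A * (C4 ^+ 2 * (2 * ipQ u u + d)) =
  2 * C4 ^+ 2 * A * ipQ u u + e * ((C4 ^+ 2 * A) / (C4 ^+ 2 * A + 1)).
  by rewrite /d; field; exact: lt0r_neq0.
rewrite lerD2l; apply: ler_piMr; first exact: ltW.
by rewrite ler_pdivrMr// mul1r lerDl.
Qed.

(** Dominated convergence makes the weighted bound as small as desired. *)
Lemma QH1_weighted_vanishing (w : E -> R) (w_ : nat -> E -> R) :
  measurable_fun Th w -> L1 (fun x => w x `^ omega') ->
  (forall k, measurable_fun Th (w_ k)) ->
  (forall k x, Th x -> 0 <= w_ k x <= w x) ->
  (forall x, Th x -> w_ k x @[k --> \oo] --> (0 : R)) ->
  forall e : R, 0 < e -> exists k, forall u, QH1set u ->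
  L1 (fun x => w_ k x * (u.1 x : R) ^+ 2) /\
  \int[mu]_(x in Th) (w_ k x * (u.1 x : R) ^+ 2) <= e * ipQ u u.
Proof.
move=> mw Lw mw_ w_w cw e e0.
have o'0 := omega'_gt0.
have mp k : measurable_fun Th (fun x => w_ k x `^ omega').
  exact: (measurableT_comp (measurable_powR omega') (mw_ k)).
have le_p k x : Th x -> `|w_ k x `^ omega'| <= w x `^ omega'.
  move=> Tx; have /andP[h0 h1] := w_w k x Tx.
  rewrite ger0_norm ?powR_ge0//; apply: ge0_ler_powR; rewrite ?nnegrE ?(ltW o'0)//.
  exact: le_trans h1.
have Lk k : L1 (fun x => w_ k x `^ omega') by exact: (dominated_L1 mTh (mp k) Lw (le_p k)).
have cpt x : Th x -> (w_ k x `^ omega')%:E @[k --> \oo] --> 0%E.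
  move=> Tx; apply/fine_cvgP; split; first exact: nearW.
  have wk0 k : 0 <= w_ k x by have /andP[] := w_w k x Tx.
  by have := powR_cvg o'0 (lexx 0) wk0 (cw x Tx); rewrite powR0// lt0r_neq0.
have dom x (k : nat) : Th x -> (`|(w_ k x `^ omega')%:E| <= (w x `^ omega')%:E)%E.
  by move=> Tx; rewrite abse_EFin lee_fin; exact: le_p.
have cst0 : measurable_fun Th (cst 0%E : E -> \bar R) by exact: measurable_cst.
have [_ _ cI] := @dominated_convergence _ _ _ mu Th mTh
  (fun k x => (w_ k x `^ omega')%:E) (cst 0%E) (fun x => (w x `^ omega')%:E)
  (fun k => (measurable_EFinP Th _).2 (mp k)) cst0
  (aeW _ cpt) Lw (aeW _ dom).
rewrite integral0 in cI.
pose J k := \int[mu]_(x in Th) (w_ k x `^ omega').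
have J0 k : 0 <= J k by apply: Rintegral_ge0 => x _; exact: powR_ge0.
have cJ : J k @[k --> \oo] --> (0 : R).
  by apply: (fine_cvg cI).
have C2 : 0 < C4 ^+ 2 by rewrite exprn_gt0.
pose d := e / (2 * C4 ^+ 2).
have d0 : 0 < d by rewrite divr_gt0// mulr_gt0.
have dp0 : 0 < d `^ omega' by rewrite powR_gt0.
have /cvgrPdist_lt/(_ _ dp0)[k _ kP] := cJ.
exists k => u hu; have wk0 x : Th x -> 0 <= w_ k x by move=> Tx; have /andP[] := w_w k x Tx.
have [L1u Iu] := QH1_weighted (mw_ k) wk0 (Lk k) hu.
split=> //; apply: (le_trans Iu); apply: ler_wpM2r; first exact: ipQ_ge0.
have -> : e = 2 * C4 ^+ 2 * d by rewrite /d mulrC divfK// lt0r_neq0// mulr_gt0.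
apply: ler_wpM2l; first exact: (mulr_ge0 (ler0n _ 2) (ltW C2)).
rewrite -/(J k).
have dE : d = (d `^ omega') `^ omega'^-1 by rewrite -powRrM mulfV ?lt0r_neq0// powRr1// ltW.
rewrite [leRHS]dE; apply: ge0_ler_powR; rewrite ?nnegrE ?invr_ge0 ?powR_ge0 ?(ltW o'0)//.
by have := kP k (leqnn k); rewrite /= sub0r normrN (ger0_norm (J0 k)) => /ltW.
Qed.

(** The truncations of [w] are bounded and the remainders have small norm. *)
Lemma QH1_weighted_small (w : E -> R) : measurable_fun Th w -> (forall x, Th x -> 0 <= w x) ->
  L1 (fun x => w x `^ omega') ->
  forall e : R, 0 < e -> exists2 k : R, 0 <= k & forall u, QH1set u ->
  \int[mu]_(x in Th) (w x * (u.1 x : R) ^+ 2) <=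
    e * ipQ u u + k * \int[mu]_(x in Th) ((u.1 x : R) ^+ 2).
Proof.
move=> mw w0 Lw e e0.
pose w_ (k : nat) x := if w x <= k%:R then 0 else w x.
have [|||k kP] := QH1_weighted_vanishing mw Lw (w_ := w_) _ _ _ e0.
- move=> k; apply: (measurable_fun_if mTh).
  + exact: (measurable_fun_ler mw (measurable_cst _)).
  + exact: measurable_cst.
  + apply: (measurable_funS mTh _ mw); exact: subIsetl.
- by move=> k x Tx; rewrite /w_; case: ifP => _; rewrite ?lexx w0.
- move=> x Tx; apply/cvgrPdist_le => d d0.
  have [N NP] : exists N : nat, w x <= N%:R.
    by exists (Num.bound (w x)); exact: ltW (archi_boundP (w0 x Tx)).
  exists N => // k /= Nk; rewrite /w_ ifT ?subrr ?normr0 ?(ltW d0)//.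
  by apply: le_trans NP _; rewrite ler_nat.
exists k%:R => // u hu; have [L1u Iu] := kP u hu.
have [hL _] := (QH1P oTh mQ psdQ u).1 hu.
have L2u : L1 (fun x => (u.1 x : R) ^+ 2) := L2Q_sqr hL.
have mwu : measurable_fun Th (fun x => w x * (u.1 x : R) ^+ 2).
  by have [mu1 _ _] := hL; exact: (measurable_funM mw (measurable_funX _ mu1)).
have bound x : Th x -> w x * (u.1 x : R) ^+ 2 <=
    1 * (w_ k x * (u.1 x : R) ^+ 2) + k%:R * (u.1 x : R) ^+ 2.
  move=> Tx; rewrite mul1r -mulrDl; apply: ler_wpM2r; first exact: sqr_ge0.
  by rewrite /w_; case: (leP (w x) k%:R) => [h|_]; rewrite ?add0r// lerDl.
have Ls := L1_lin mTh 1 L1u (L1_Z mTh k%:R L2u).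
have Lw2 : L1 (fun x => w x * (u.1 x : R) ^+ 2).
  apply: (dominated_L1 mTh mwu Ls) => x Tx.
  by rewrite ger0_norm; [exact: bound|exact: (mulr_ge0 (w0 x Tx) (sqr_ge0 _))].
apply: (le_trans (le_Rintegral mTh Lw2 Ls bound)).
rewrite (Rintegral_lin mTh 1 L1u (L1_Z mTh k%:R L2u)) mul1r (RintegralZl _ mTh L2u).
by rewrite lerD2r.
Qed.

End sobolev_gain.

(** * Distance functions, cutoffs and uniformity on compact sets *)

Section set_distance.
Context {R : realType} {V : normedModType R}.
Variable A : set V.
Hypothesis A0 : A !=set0.

Definition set_dist (x : V) : R := inf [set `|x - y| | y in A].

Let has_lb x : has_inf [set `|x - y| | y in A].
Proof.
split; first by have [a Aa] := A0; exists `|x - a|; exists a.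
by exists 0 => _ [y _ <-].
Qed.

Lemma set_dist_le x y : A y -> set_dist x <= `|x - y|.
Proof. by move=> Ay; apply: (ge_inf (has_lb x).2); exists y. Qed.

Lemma set_dist_ge x c : (forall y, A y -> c <= `|x - y|) -> c <= set_dist x.
Proof.
move=> h; apply: lb_le_inf; first exact: (has_lb x).1.
by move=> _ [y Ay <-]; exact: h.
Qed.

Lemma set_dist_ge0 x : 0 <= set_dist x.
Proof. exact: set_dist_ge. Qed.

Lemma set_dist_lipschitz : lipschitz_by 1 setT set_dist.
Proof.
have h x y : set_dist x <= `|x - y| + set_dist y.
  rewrite -lerBlDl; apply: set_dist_ge => a Aa; rewrite lerBlDl.
  apply: le_trans (set_dist_le x Aa) _.
  by have := ler_normD (x - y) (y - a); rewrite addrA subrK.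
move=> x y _ _; rewrite mul1r ler_norml.
have := h x y; have := h y x; rewrite (distrC y) => ? ?.
by apply/andP; split; lra.
Qed.

Lemma set_dist_continuous : continuous set_dist.
Proof. by move=> x; apply: (lipschitz_continuous _ set_dist_lipschitz); exact: filterT. Qed.

Lemma set_dist_gt0 x : closed A -> ~ A x -> 0 < set_dist x.
Proof.
move=> cA nAx; have oC : open (~` A) by exact: closed_openC.
have /nbhs_ballP[e /= e0 eA] : nbhs x (~` A) by exact: open_nbhs_nbhs.
apply: (lt_le_trans e0); apply: set_dist_ge => y Ay; rewrite leNgt; apply/negP => h.
by apply: (eA y) => //; rewrite -ball_normE.
Qed.

Lemma set_dist_mem x : A x -> set_dist x = 0.
Proof.
move=> Ax; apply/eqP; rewrite eq_le set_dist_ge0 andbT.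
by rewrite -(normr0 V) -(subrr x); exact: set_dist_le.
Qed.

Lemma open_set_dist_gt c : open [set x | c < set_dist x].
Proof.
have -> : [set x | c < set_dist x] = set_dist @^-1` [set y | c < y] by [].
by move: (@set_dist_continuous) => /continuousP; apply; exact: open_gt.
Qed.

Lemma closed_set_dist_ge c : closed [set x | c <= set_dist x].
Proof.
have -> : [set x | c <= set_dist x] = set_dist @^-1` [set y | c <= y] by [].
by move: (@set_dist_continuous) => /continuous_closedP; apply; exact: closed_ge.
Qed.

End set_distance.

Section compact_tools.
Context {R : realType} {V : normedModType R}.

(** On a compact set a positive threshold that can be chosen locally can be
    chosen globally. *)
Lemma compact_uniform (K : set V) (P : V -> R -> Prop) : compact K ->
  (forall x e e', P x e -> 0 < e' -> e' <= e -> P x e') ->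
  (forall x, K x -> exists2 e : R, 0 < e & \forall y \near x, P y e) ->
  exists2 e : R, 0 < e & forall x, K x -> P x e.
Proof.
move=> /compact_near_coveringP cK Pm h.
have := cK R (0^'+) (fun e x => 0 < e -> P x e) _.
case=> [x Kx|e /= e0 eP].
  have [e e0 eP] := h x Kx.
  exists ([set y | P y e], [set d | d <= e]); last first.
    by move=> [y d] /= [Py de] d0; exact: (Pm _ _ _ Py d0 de).
  by split=> //=; exact: nbhs_right_le.
exists (e / 2); first exact: divr_gt0.
move=> x Kx; have e2 : 0 < e / 2 by rewrite divr_gt0.
apply: (eP (e / 2)) => //=.
by rewrite sub0r normrN gtr0_norm// ltr_pdivrMr// ltr_pMr// ltr1n.
Qed.

(** A finite subcover by open neighbourhoods of points of the set. *)
Lemma compact_centers (K : set V) (B : V -> set V) : compact K ->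
  (forall x, K x -> open (B x)) -> (forall x, K x -> B x x) ->
  exists s : seq V, (forall y, y \in s -> K y) /\
    forall x, K x -> exists2 y, y \in s & B y x.
Proof.
rewrite compact_cover => cK oB Bx.
have [|D sD KD] := cK V K B oB; first by move=> x Kx; exists x => //; exact: Bx.
exists (finmap.enum_fset D); split=> [y yD|x Kx].
  exact: (set_mem (sD y yD)).
by have [y /= yD Byx] := KD x Kx; exists y.
Qed.

End compact_tools.

Section cutoff.
Context {R : realType} {n : nat}.
Local Notation E := 'rV[R]_n.+1.
Variables (Th : set E).
Hypothesis oTh : open Th.

(** A cutoff [eta], a truncated affine function of the distance [d], vanishes near
    the complement of [Th]; the product [eta * phi] then extends by zero. *)
Lemma locally_lipschitz_cutoff (d phi : E -> R) (s : R) :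
  lipschitz_by 1 setT d -> (forall x, ~ Th x -> d x <= 0) -> 0 < s ->
  locally_lipschitz Th phi ->
  exists f : E -> R, (forall O, locally_lipschitz O f) /\
    forall x, 2 * s < d x -> f x = phi x.
Proof.
move=> d1 d0 s0 /locally_lipschitzP lphi.
pose eta x := Num.min 1 (Num.max 0 (d x / s - 1)).
have aux (a b : R) : `|Num.min 1 (Num.max 0 a) - Num.min 1 (Num.max 0 b)| <= `|a - b|.
  rewrite ler_norml; have : - `|a - b| <= a - b <= `|a - b| by rewrite -ler_norml lexx.
  move=> /andP[h1 h2]; rewrite /Order.min /Order.max; apply/andP; split;
  by do 4 case: ifPn; rewrite -?leNgt; lra.
have eta01 x : 0 <= eta x <= 1.
  by rewrite /eta le_min ler01 le_max lexx ge_min lexx.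
have eta_lip x y : `|eta x - eta y| <= s^-1 * `|x - y|.
  apply: (le_trans (aux _ _)).
  rewrite opprB addrA subrK -mulrBl normrM (gtr0_norm (_ : 0 < s^-1)) ?invr_gt0//.
  rewrite mulrC; apply: ler_wpM2l; first by rewrite invr_ge0 ltW.
  by have := d1 x y I I; rewrite mul1r.
exists (fun x => if pselect (Th x) then eta x * phi x else 0); split; last first.
  move=> x dx; case: pselect => Tx; last first.
    by have := d0 x Tx; move: (lt_trans (mulr_gt0 (ltr0n R 2) s0) dx); lra.
  rewrite /eta; rewrite (_ : Num.min _ _ = 1) ?mul1r//.
  apply/min_idPl; rewrite le_max lerBrDl ler_pdivlMr//; apply/orP; right.
  by rewrite -natr1 in dx *; exact: ltW.
move=> O; apply/locally_lipschitzP => x Ox.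
have [Tx|nTx] := pselect (Th x); last first.
  exists s, 0; split=> // y z [yB _] [zB _].
  have h w : ball x s w -> (if pselect (Th w) then eta w * phi w else 0) = 0.
    rewrite -ball_normE /= => xw; case: pselect => // Tw.
    rewrite /eta max_l; first by rewrite min_r ?mul0r// ler01.
    rewrite subr_le0 ler_pdivrMr// mul1r; apply: ltW; apply: le_lt_trans xw.
    have := d1 w x I I; rewrite mul1r (distrC w x); have := ler_norm (d w - d x).
    by have := d0 x nTx; lra.
  by rewrite !h// subrr normr0 mul0r.
have [e [K [e0 K0 h]]] := lphi x Tx.
have /nbhs_ballP[e' /= e'0 e'T] : nbhs x Th by exact: open_nbhs_nbhs.
pose r := Num.min e e'.
have r0 : 0 < r by rewrite /r lt_min e0.
have rT w : ball x r w -> Th w.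
  by move=> /(le_ball (_ : r <= e')) xw; apply: e'T; apply: xw; rewrite ge_min lexx orbT.
have rE w : ball x r w -> (ball x e `&` Th) w.
  move=> xw; split; last exact: rT.
  by move: xw; apply: le_ball; rewrite ge_min lexx.
have r0x : ball x r x by exact: ballxx.
pose M := `|phi x| + K * r.
have phiM w : ball x r w -> `|phi w| <= M.
  move=> xw; have := h w x (rE _ xw) (rE _ r0x).
  have := ler_normD (phi w - phi x) (phi x); rewrite subrK /M.
  have : K * `|w - x| <= K * r.
    by apply: ler_wpM2l => //; move: xw; rewrite -ball_normE /= distrC => /ltW.
  by move=> ? ? ?; lra.
have M0 : 0 <= M by rewrite addr_ge0// mulr_ge0// ltW.
exists r, (K + s^-1 * M); split=> //.
  by rewrite addr_ge0// mulr_ge0// invr_ge0 ltW.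
move=> y z [yB _] [zB _].
case: pselect => [Ty|nT]; last by case: (nT (rT _ yB)).
case: pselect => [Tz|nT]; last by case: (nT (rT _ zB)).
have -> : eta y * phi y - eta z * phi z =
  eta y * (phi y - phi z) + (eta y - eta z) * phi z by ring.
apply: (le_trans (ler_normD _ _)); rewrite !normrM mulrDl; apply: lerD.
  have /andP[h0 h1] := eta01 y.
  rewrite (ger0_norm h0) -[leRHS]mul1r; apply: ler_pM => //.
  exact: (h y z (rE _ yB) (rE _ zB)).
rewrite mulrAC; by apply: ler_pM => //; exact: phiM.
Qed.

End cutoff.

(** * Coverings by quasimetric balls with bounded overlap *)

(** A greedy selection: a member is kept when it misses those kept before. *)
Lemma maximal_disjoint (T : eqType) (U : Type) (B : T -> set U) (s : seq T) :
  (forall y, y \in s -> B y !=set0) ->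
  exists (m : nat) (x : 'I_m -> T),
    [/\ forall i, x i \in s,
        forall i j, i != j -> B (x i) `&` B (x j) = set0 &
        forall y, y \in s -> exists i, (B y `&` B (x i)) !=set0].
Proof.
move=> Bs.
elim: s Bs => [_|y s IH Bs].
  by exists 0%N, (fun i : 'I_0 => False_rect T (not_false_is_true (valP i))); split=> // [[]|[]].
have [|m [x [xs xd xm]]] := IH; first by move=> z zs; apply: Bs; rewrite inE zs orbT.
have [[i yi]|h] := pselect (exists i, (B y `&` B (x i)) !=set0).
  exists m, x; split=> // [j|z]; first by rewrite inE xs orbT.
  by rewrite inE => /predU1P[->|/xm//]; exists i.
have yx i : B y `&` B (x i) = set0.
  by apply: contra_notP h => /eqP/set0P yi; exists i.
exists m.+1, (fun i => if unlift ord0 i is Some j then x j else y); split=> [i|i j|z].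
- by case: unliftP => [j|] _; rewrite inE ?eqxx// xs orbT.
- case: (unliftP ord0 i) => [i'|] ->; case: (unliftP ord0 j) => [j'|] -> ij.
  + by apply: xd; apply: contra ij => /eqP ->.
  + by rewrite setIC.
  + exact: yx.
  + by rewrite eqxx in ij.
rewrite inE => /predU1P[->|/xm[i zi]].
  by exists ord0; rewrite unlift_none setIid; apply: Bs; rewrite inE eqxx.
by exists (lift ord0 i); rewrite liftK.
Qed.

Section quasimetric_covering.
Context {R : realType} {n : nat}.
Local Notation E := 'rV[R]_n.+1.
Variables (Om : set E) (rho : E -> E -> R) (r1 : E -> R).
Local Notation qb := (qball Om rho).
Hypothesis oOm : open Om.
Variable kappa : R.
Hypothesis kappa1 : 1 <= kappa.
Hypothesis quasi : forall x y z : E, Om x -> Om y -> Om z ->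
    [/\ 0 <= rho x y, rho x y = 0 <-> x = y, rho x y = rho y x &
        rho x y <= kappa * (rho x z + rho z y)].
Hypothesis qb_open : forall x r, Om x -> 0 < r -> open (qb x r).
Hypothesis qb_small : forall x eps, Om x -> 0 < eps -> exists2 delta : R, 0 < delta &
  qb x delta `<=` [set y | Om y /\ enorm (x - y) < eps].

Lemma qb_center x r : Om x -> 0 < r -> qb x r x.
Proof. by move=> Ox r0; split=> //; have [_ h _ _] := quasi Ox Ox Ox; rewrite (h.2 erefl). Qed.

Lemma qb_trans x y r s : Om x -> qb x r y -> qb y s `<=` qb x (kappa * (r + s)).
Proof.
move=> Ox [Oy xy] z [Oz yz]; split=> //.
have [_ _ _ h] := quasi Ox Oz Oy; apply: (le_lt_trans h).
by rewrite ltr_pM2l ?(lt_le_trans ltr01)//; exact: ltrD.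
Qed.

Lemma qb_sym x y r : Om x -> qb x r y -> qb y r x.
Proof. by move=> Ox [Oy xy]; split=> //; have [_ _ <- _] := quasi Ox Oy Ox. Qed.

Lemma qb_le x r s : r <= s -> qb x r `<=` qb x s.
Proof. by move=> rs y [Oy xy]; split=> //; exact: lt_le_trans rs. Qed.

Let kappa0 : 0 < kappa := lt_le_trans ltr01 kappa1.
Let L := kappa * (1 + 2 * kappa).

Lemma qb_engulf x y r : Om x -> Om y -> (qb y r `&` qb x r) !=set0 ->
  qb y r `<=` qb x (kappa * (r + kappa * (r + r))).
Proof.
move=> Ox Oy [z [yz xz]]; have Oz := xz.1.
have h1 := qb_trans Oz (qb_sym Oy yz) (s := r).
have h2 := qb_trans Ox xz (s := kappa * (r + r)).
by move=> w /h1; exact: h2.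
Qed.

(** Small quasimetric balls are small for the norm, so near a compact subset of
    an open set one radius serves all centres. *)
Lemma qb_uniform (K W : set E) : compact K -> K `<=` W -> W `<=` Om -> open W ->
  {within Om, continuous r1} -> (forall x, Om x -> 0 < r1 x) ->
  exists2 r0 : R, 0 < r0 & forall x, K x -> qb x r0 `<=` W /\ r0 < r1 x.
Proof.
move=> cK KW WO oW; rewrite (continuous_open_subspace _ oOm) => cr1 r10.
apply: (@compact_uniform R E K (fun x e => qb x e `<=` W /\ e < r1 x)) => //.
  move=> x e e' [h1 h2] _ e'e; split; last exact: le_lt_trans h2.
  by apply: subset_trans h1; exact: qb_le.
move=> x Kx; have Wx := KW x Kx; have Ox := WO x Wx.
have /nbhs_ballP[e /= e0 eW] : nbhs x W by exact: open_nbhs_nbhs.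
have [d d0 dP] := qb_small Ox e0.
pose r := d / (2 * kappa).
have r0 : 0 < r by rewrite divr_gt0// mulr_gt0.
have rd : kappa * (r + r) = d by rewrite /r; field; rewrite gt_eqF.
have dW : qb x d `<=` W.
  move=> y /dP[_ xy]; apply: eW; apply/ball_rVE => // i.
  apply: le_lt_trans xy; rewrite -(ler_pXn2r (_ : (0 < 2)%N)) ?nnegrE ?sqrtr_ge0//.
  have := entry_le_dotv (x - y) i; rewrite enorm_sqr !mxE.
  by rewrite -normrX ger0_norm ?sqr_ge0.
have r1x := r10 x Ox.
exists (Num.min r (r1 x / 2)); first by rewrite lt_min r0 divr_gt0.
have cx : {for x, continuous r1} by exact: (cr1 x (mem_set Ox)).
have n1 : \forall y \near x, r1 x / 2 < r1 y.
  by apply: (cvgr_gt _ cx); rewrite ltr_pdivrMr// ltr_pMr// ltr1n.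
have n2 : nbhs x (qb x r).
  by apply: open_nbhs_nbhs; split; [exact: qb_open|exact: qb_center].
apply: filterS (filterI n1 n2) => y [h1 h2]; split; last first.
  by rewrite gt_min h1 orbT.
apply: subset_trans dW; rewrite -rd; apply: subset_trans (qb_trans Ox h2).
by apply: qb_le; rewrite ge_min lexx.
Qed.

Hypothesis doubling : locally_geometrically_doubling Om rho.

(** Balls of a maximal disjoint family, enlarged by a fixed factor, cover; and a
    point lies in few further enlarged balls, since the disjoint balls of those
    centres all sit in one ball around it. *)
Lemma controlled_covering (b : R) (Th : set E) : 1 <= b ->
  compact (closure Th) -> closure Th `<=` Om ->
  exists2 M : R, 0 <= M & forall (K W : set E) (eps : R),
    compact K -> K `<=` W -> W `<=` Th -> open W ->
    {within Om, continuous r1} -> (forall x, Om x -> 0 < r1 x) -> 0 < eps ->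
    exists (r : R) (m : nat) (x : 'I_m -> E),
    [/\ 0 < r <= eps,
        forall i, [/\ K (x i), b * r < r1 (x i) & qb (x i) (b * r) `<=` W],
        forall y, K y -> exists i, qb (x i) r y &
        forall z, Th z -> #|[pred i | `[< qb (x i) (b * r) z >]]|%:R <= M].
Proof.
move=> b1 cTh ThO; have [C CP] := doubling.
have [delta delta0 dP] := CP _ cTh ThO.
pose A := kappa * (b * L + 1).
have b0 : 0 < b := lt_le_trans ltr01 b1.
have L1 : 1 <= L.
  apply: (le_trans kappa1); rewrite /L ler_pMr// lerDl.
  exact: (mulr_ge0 (ler0n _ 2) (ltW kappa0)).
have A1 : 1 <= A.
  have := ler_pM ler01 ler01 b1 L1; rewrite mul1r => bL.
  have := ler_pM ler01 ler01 kappa1 bL; rewrite mul1r => h.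
  by apply: (le_trans h); rewrite /A ler_pM2l// lerDl.
have A0 : 0 < A := lt_le_trans ltr01 A1.
have L0 : 0 < L := lt_le_trans ltr01 L1.
exists (Num.max 0 (C A)); first by rewrite le_max lexx.
move=> K W eps cK KW WT oW cr1 r10 eps0.
have TO : Th `<=` Om by apply: subset_trans ThO; exact: subset_closure.
have WO : W `<=` Om by apply: subset_trans TO.
have KO y : K y -> Om y by move=> /KW/WO.
have [r0 r00 r0P] := qb_uniform cK KW WO oW cr1 r10.
(* The bounds serve, in this order, the radius [L * r'] of the covering balls, the
   enlarged balls, and the ball to which the doubling property is applied. *)
pose r' := Num.min (eps / L) (Num.min (r0 / (b * L)) (delta / (2 * A))).
have r'0 : 0 < r' by rewrite !lt_min !divr_gt0// mulr_gt0.
have r'1 : L * r' <= eps by rewrite -ler_pdivlMl// mulrC ge_min lexx.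
have r'2 : b * (L * r') <= r0.
  have : r' <= r0 / (b * L) by rewrite /r' !ge_min lexx orbT.
  by rewrite (ler_pdivlMr _ _ (mulr_gt0 b0 L0)) mulrC mulrA.
have r'3 : A * r' < delta.
  have : r' <= delta / (2 * A) by rewrite /r' !ge_min lexx !orbT.
  rewrite (ler_pdivlMr _ _ (mulr_gt0 (ltr0n R 2) A0)) mulrC => h.
  by apply: lt_le_trans h; rewrite (ltr_pM2r r'0) (ltr_pMl _ A0) ltr1n.
have [s [sK sP]] := compact_centers cK (fun x Kx => qb_open (KO x Kx) r'0)
  (fun x Kx => qb_center (KO x Kx) r'0).
have [|m [x [xs xd xm]]] := @maximal_disjoint _ _ (fun y => qb y r') s.
  by move=> y ys; exists y; apply: qb_center => //; exact/KO/sK.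
have xK i : K (x i) by exact: sK.
exists (L * r'), m, x; split.
- by rewrite mulr_gt0.
- move=> i; have [h1 h2] := r0P _ (xK i); split=> //; first exact: le_lt_trans h2.
  by apply: subset_trans h1; exact: qb_le.
- move=> y /sP[z zs zy]; have [i zi] := xm z zs; exists i.
  have := qb_engulf (KO _ (xK i)) (KO _ (sK z zs)) zi zy.
  by rewrite (_ : kappa * (r' + _) = L * r')// /L; ring.
move=> z Tz; rewrite le_max; apply/orP; right.
set D := [pred i | _].
have inD (i : 'I_#|D|) : qb (x (enum_val i)) (b * (L * r')) z.
  by apply/asboolP; exact: (enum_valP i).
have -> : A = (A * r') / r' by rewrite mulfK// gt_eqF.
apply: (dP z r' (A * r') _ r'0 _ r'3 _ (fun i => x (enum_val i))).
- exact: subset_closure.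
- by rewrite ler_pMl.
- move=> i; have Oi := KO _ (xK (enum_val i)); split=> //.
  have h := qb_trans (TO z Tz) (qb_sym Oi (inD i)) (s := r').
  apply: subset_trans h _; apply: qb_le.
  by rewrite (_ : kappa * _ = A * r')// /A; ring.
- by move=> i j ij; apply: xd; apply: contra ij => /eqP/enum_val_inj ->.
Qed.

End quasimetric_covering.

(** * The local Poincare inequality on one ball *)

Section averages.
Context d (T : measurableType d) (R : realType) (mu : {measure set T -> \bar R}).
Variables B D : set T.
Hypothesis mB : measurable B.
Hypothesis mD : measurable D.
Hypothesis BD : B `<=` D.
Implicit Types f g v : T -> R.

Lemma L1_subset f : mu.-integrable D (EFin \o f) -> mu.-integrable B (EFin \o f).
Proof. exact: integrableS. Qed.

Lemma L1_indic f : mu.-integrable D (EFin \o f) ->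
  mu.-integrable D (EFin \o (fun x => \1_B x * f x)) /\
  \int[mu]_(x in D) (\1_B x * f x) = \int[mu]_(x in B) f x.
Proof.
move=> Lf; have mf := L1_measurable Lf.
have mBf : measurable_fun D (fun x => (\1_B x : R) * f x).
  exact: (measurable_funM (measurable_indic mB) mf).
split.
  apply: (dominated_L1 mD mBf (integrable_norm Lf)) => x Dx /=.
  rewrite normrM indicE; case: (x \in B); rewrite ?normr1 ?mul1r//.
  by rewrite normr0 mul0r.
rewrite /Rintegral; congr fine.
have -> : (\int[mu]_(x in B) (f x)%:E = \int[mu]_(x in D `&` B) (f x)%:E)%E.
  by rewrite (_ : D `&` B = B)//; apply/setIidPr.
rewrite integral_mkcondr; apply: eq_integral => x _.
by rewrite /patch indicE; case: (x \in B); rewrite ?mul1r ?mul0r.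
Qed.

Hypothesis B0 : (0 < mu B)%E.
Hypothesis Boo : (mu B < +oo)%E.

Lemma fine_measure_gt0 : 0 < fine (mu B).
Proof. by apply: fine_gt0; rewrite B0. Qed.

(** The Poincare inequality bounds the mean square deviation from the average;
    what it leaves of the mean square is the square of the average, which is a
    functional of rank one. *)
Lemma variance v : measurable_fun B v -> mu.-integrable B (EFin \o (fun x => v x ^+ 2)) ->
  let a := (fine (mu B))^-1 * \int[mu]_(x in B) v x in
  [/\ mu.-integrable B (EFin \o v),
      mu.-integrable B (EFin \o (fun x => (v x - a) ^+ 2)) &
      \int[mu]_(x in B) (v x - a) ^+ 2 =
      \int[mu]_(x in B) v x ^+ 2 - (fine (mu B))^-1 * (\int[mu]_(x in B) v x) ^+ 2].
Proof.
move=> mv L2v a; have m0 := fine_measure_gt0.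
have Lc (c : R) : mu.-integrable B (EFin \o (fun=> c)).
  exact: (L1_cst mB c Boo).
have L1v : mu.-integrable B (EFin \o v).
  apply: (dominated_L1 mB mv (L1_D mB L2v (Lc 1))) => x _.
  rewrite -real_normK ?num_real//; move: (normr_ge0 (v x)) (sqr_ge0 (`|v x| - 1)).
  by move: `|v x| => y y0; rewrite sqrrB; nra.
have sqE x : (v x - a) ^+ 2 = (- 2 * a) * v x + (1 * v x ^+ 2 + a ^+ 2) by ring.
have Lr := L1_lin mB 1 L2v (Lc (a ^+ 2)).
have Ls := L1_lin mB (- 2 * a) L1v Lr.
split=> //.
  by rewrite (_ : EFin \o _ = EFin \o (fun x => (- 2 * a) * v x + (1 * v x ^+ 2 + a ^+ 2)));
    [exact: Ls|apply/funext => x /=; rewrite sqE].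
rewrite (@eq_Rintegral _ _ _ mu B (fun x => (- 2 * a) * v x + (1 * v x ^+ 2 + a ^+ 2)));
  last by move=> x _; exact: sqE.
rewrite (Rintegral_lin mB _ L1v Lr).
rewrite (Rintegral_lin mB 1 L2v (Lc _)) (Rintegral_cst _ mB) mul1r /a.
by field; rewrite gt_eqF.
Qed.

End averages.

Section local_estimate.
Context {R : realType} {n : nat}.
Local Notation E := 'rV[R]_n.+1.
Local Notation mu := (@lebesgue_rV R n).
Variables (Q : E -> 'M[R]_n.+1) (Th : set E).
Hypothesis oTh : open Th.
Hypothesis mQ : measurable_mx Th Q.
Hypothesis psdQ : forall x, Th x -> psdmx (Q x).
Local Notation ipQ := (ipQ Q Th).
Local Notation L2Q := (L2Q Q Th).
Let mTh := open_measurable_rV oTh.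

Definition Qenergy (phi : E -> R) (x : E) : R := dotv (grad phi x) (grad phi x *m Q x).

Lemma Qenergy_ge0 phi x : Th x -> 0 <= Qenergy phi x.
Proof. by move=> Tx; exact: (psdQ Tx).2. Qed.

Lemma L1_Qenergy phi : LipQ Q Th phi ->
  mu.-integrable Th (EFin \o Qenergy phi) /\
  \int[mu]_(x in Th) Qenergy phi x <= ipQ (graph phi) (graph phi).
Proof.
move=> hphi; have hL := LipQ_L2Q oTh mQ psdQ hphi; have [m1 m2 Lp] := hL.
have mh : measurable_fun Th (Qenergy phi).
  exact: (measurable_dotv m2 (measurable_vec_mulmx m2 mQ)).
have hle x : Th x -> `|Qenergy phi x| <= polar Q (graph phi) (graph phi) x.
  move=> Tx; rewrite (ger0_norm (Qenergy_ge0 phi Tx)) /polar lerDr.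
  by rewrite -expr2 sqr_ge0.
have Lh := dominated_L1 mTh mh Lp hle.
split; first exact: Lh.
apply: (le_Rintegral mTh Lh Lp) => x Tx.
by apply: le_trans (hle x Tx); exact: ler_norm.
Qed.

(** The Poincare inequality is applied to a function that is Lipschitz on all of
    [Om] and agrees with [phi] near the balls. *)
Lemma local_estimate (B bB W : set E) (f phi : E -> R) (c : R) :
  LipQ Q Th phi -> W `<=` Th -> open W -> (forall x, W x -> f x = phi x) ->
  open B -> open bB -> B !=set0 -> B `<=` bB -> bB `<=` W ->
  (mu bB < +oo)%E -> 0 <= c ->
  (eavg B (fun x => (`|f x - avg B f| `^ 2)%:E) `^ 2^-1
   <= c%:E * eavg bB (fun x => (enorm (sqrtQ Q (grad f) x) `^ 2)%:E) `^ 2^-1)%E ->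
  \int[mu]_(x in B) phi x ^+ 2 <=
    c ^+ 2 * \int[mu]_(x in bB) Qenergy phi x
    + (fine (mu B))^-1 * (\int[mu]_(x in B) phi x) ^+ 2.
Proof.
move=> hphi WT oW fphi oB obB [x0 Bx0] BbB bBW bBoo c0.
have bBT := subset_trans bBW WT; have BT := subset_trans BbB bBT.
have BW := subset_trans BbB bBW.
have mB := open_measurable_rV oB; have mbB := open_measurable_rV obB.
have hL := LipQ_L2Q oTh mQ psdQ hphi; have [m1 m2 _] := hL.
have L2phi : mu.-integrable B (EFin \o (fun x => phi x ^+ 2)).
  exact: (L1_subset mB mTh BT (L2Q_sqr oTh psdQ hL)).
have Lh : mu.-integrable bB (EFin \o Qenergy phi).
  exact: (L1_subset mbB mTh bBT (L1_Qenergy hphi).1).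
have B0 := open_lebesgue_gt0 oB Bx0.
have bB0 := open_lebesgue_gt0 obB (BbB _ Bx0).
have Bbb : (mu B <= mu bB)%E := le_measure mu (mem_set mB) (mem_set mbB) BbB.
have Boo : (mu B < +oo)%E by exact: le_lt_trans bBoo.
have b0 := fine_measure_gt0 B0 Boo; have bb0 := fine_measure_gt0 bB0 bBoo.
have mm : fine (mu B) <= fine (mu bB).
  by apply: fine_le => //; rewrite ge0_fin_numE ?measure_ge0.
have [L1phi Lv vE] := variance mB B0 Boo (measurable_funS mTh BT m1) L2phi.
have avgE : avg B f = (fine (mu B))^-1 * \int[mu]_(x in B) phi x.
  by rewrite /avg; congr (_ * _); apply: eq_Rintegral => x /set_mem/BW/fphi.
set a := (_ * _) in Lv vE avgE.
have e1 x : x \in B -> (`|f x - avg B f| `^ 2)%:E = ((phi x - a) ^+ 2)%:E.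
  move=> /set_mem/BW/fphi ->; rewrite avgE powR_mulrn// real_normK//.
  exact: num_real.
have e2 x : x \in bB -> (enorm (sqrtQ Q (grad f) x) `^ 2)%:E = (Qenergy phi x)%:E.
  move=> /set_mem bx; have Wx := bBW x bx.
  rewrite powR_mulrn ?sqrtr_ge0// (enorm_sqrtQ psdQ _ (WT x Wx)) /Qenergy.
  rewrite (@grad_near _ _ f phi)//.
  by apply: filterS (open_nbhs_nbhs (conj oW Wx)) => y Wy; exact: fphi.
rewrite /eavg (eq_integral _ _ e1) (eq_integral _ _ e2).
rewrite -(EFin_Rintegral mB Lv) -(EFin_Rintegral mbB Lh) -!EFinM !poweR_EFin lee_fin.
rewrite vE; set I2 := \int[mu]_(x in B) phi x ^+ 2.
set I1 := _ * _ ^+ 2; have : 0 <= I2 - I1.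
  by rewrite -vE; apply: Rintegral_ge0 => x _; exact: sqr_ge0.
move: (I2 - I1) (subrK I1 I2) => V <- V0; rewrite lerD2r.
have : 0 <= \int[mu]_(x in bB) Qenergy phi x.
  by apply: Rintegral_ge0 => x bx; exact/Qenergy_ge0/bBT.
move: (\int[mu]_(x in bB) _) => J J0.
have mi : 0 <= (fine (mu B))^-1 by rewrite invr_ge0 ltW.
have bi : 0 <= (fine (mu bB))^-1 by rewrite invr_ge0 ltW.
rewrite !powR12_sqrt ?mulr_ge0// -ler_sqr ?nnegrE ?mulr_ge0 ?sqrtr_ge0//.
rewrite exprMn !sqr_sqrtr ?mulr_ge0// => h.
have : V <= fine (mu B) * (c ^+ 2 * ((fine (mu bB))^-1 * J)).
  by rewrite -ler_pdivrMl.
move=> /le_trans; apply; rewrite mulrCA; apply: ler_wpM2l; first exact: sqr_ge0.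
rewrite mulrA -[leRHS]mul1r; apply: ler_wpM2r => //.
by rewrite ler_pdivrMr// mul1r.
Qed.

End local_estimate.

(** * The compactness inequality *)

Section ball_means.
Context {R : realType} {n : nat}.
Local Notation E := 'rV[R]_n.+1.
Local Notation mu := (@lebesgue_rV R n).
Variables (Q : E -> 'M[R]_n.+1) (Th : set E).
Hypothesis oTh : open Th.
Hypothesis mQ : measurable_mx Th Q.
Hypothesis psdQ : forall x, Th x -> psdmx (Q x).
Hypothesis Thoo : (mu Th < +oo)%E.
Local Notation ipQ := (ipQ Q Th).
Local Notation L2Q := (L2Q Q Th).
Local Notation QH1set := (QH1set Q Th).
Local Notation pairs := (@pairs R n).
Let mTh := open_measurable_rV oTh.

(** With this normalization the square of [ball_mean] is the integral over [B] of
    the square of the average, as in [variance]. *)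
Definition ball_mean (B : set E) (u : pairs) : R :=
  (Num.sqrt (fine (mu B)))^-1 * \int[mu]_(x in B) (u.1 x : R).

Variable B : set E.
Hypothesis oB : open B.
Hypothesis B0 : B !=set0.
Hypothesis BT : B `<=` Th.
Let mB := open_measurable_rV oB.

Let Bpos : (0 < mu B)%E.
Proof. by have [x Bx] := B0; exact: open_lebesgue_gt0 Bx. Qed.

Let Boo : (mu B < +oo)%E.
Proof. exact: le_lt_trans (le_measure mu (mem_set mB) (mem_set mTh) BT) Thoo. Qed.

Let variance_B u : L2Q u -> _ := fun hu => let: And3 mu1 _ _ := hu in
  variance mB Bpos Boo (measurable_funS mTh BT mu1)
    (L1_subset mB mTh BT (L2Q_sqr oTh psdQ hu)).

Lemma ball_mean_linear : linear_on L2Q (ball_mean B).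
Proof.
move=> a u v hu hv; have [Lu _ _] := variance_B hu; have [Lv _ _] := variance_B hv.
by rewrite /ball_mean (Rintegral_lin mB a Lu Lv); ring.
Qed.

Lemma ball_mean_sqr u : ball_mean B u ^+ 2 =
  (fine (mu B))^-1 * (\int[mu]_(x in B) (u.1 x : R)) ^+ 2.
Proof. by rewrite /ball_mean exprMn exprVn sqr_sqrtr// ltW// fine_measure_gt0. Qed.

Lemma ball_mean_le u : L2Q u -> ball_mean B u ^+ 2 <= ipQ u u.
Proof.
move=> hu; have [_ Lv vE] := variance_B hu; rewrite ball_mean_sqr.
apply: (@le_trans _ _ (\int[mu]_(x in B) (u.1 x : R) ^+ 2)).
  by rewrite -subr_ge0 -vE; apply: Rintegral_ge0 => x _; exact: sqr_ge0.
have L2u := L2Q_sqr oTh psdQ hu; have [LB <-] := L1_indic mB mTh BT L2u.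
have [_ _ Lu] := hu; apply: (le_Rintegral mTh LB Lu) => x Tx.
apply: (@le_trans _ _ ((u.1 x : R) ^+ 2)).
  by rewrite indicE; case: (x \in B); rewrite ?mul1r// mul0r sqr_ge0.
by rewrite /polar expr2 lerDl; exact: (psdQ Tx).2.
Qed.

End ball_means.

Section compactness.
Context {R : realType} {n : nat}.
Local Notation E := 'rV[R]_n.+1.
Local Notation mu := (@lebesgue_rV R n).
Variables (Om : set E) (rho : E -> E -> R) (Q : E -> 'M[R]_n.+1) (r1 : E -> R).
Variables (Th : set E) (omega : R).
Hypothesis hOm : geometric_homogeneous_space Om rho.
Hypothesis hQ : degenerate_matrix Om Q.
Hypothesis r1_continuous : {within Om, continuous r1}.
Hypothesis r1_gt0 : forall x, Om x -> 0 < r1 x.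
Hypothesis hlocal : local_Poincare Om rho Q r1 2.
Hypothesis oTh : open Th.
Hypothesis bTh : bounded_set Th.
Hypothesis ThO : closure Th `<=` Om.
Hypothesis omega_gt1 : 1 < omega.
Hypothesis hglobal : global_weak_Poincare Q Th omega.
Local Notation ipQ := (ipQ Q Th).
Local Notation L2Q := (L2Q Q Th).
Local Notation QH1set := (QH1set Q Th).
Local Notation pairs := (@pairs R n).
Let mTh := open_measurable_rV oTh.

Lemma psd_on_domain x : Th x -> psdmx (Q x).
Proof. by move=> Tx; have [_ h _] := hQ; exact/h/ThO/subset_closure. Qed.

Lemma measurable_on_domain : measurable_mx Th Q.
Proof.
have [h _ _] := hQ; have [[oOm _] _ _ _ _] := hOm; move=> i j.
apply: measurable_funS (h i j); first exact: open_measurable_rV.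
exact: subset_trans (@subset_closure _ _) ThO.
Qed.

Lemma domain_finite_measure : (mu Th < +oo)%E.
Proof. exact: bounded_lebesgue_lty. Qed.

Let bounded_subset (A B : set E) : A `<=` B -> bounded_set B -> bounded_set A.
Proof. by move=> AB [M [Mr h]]; exists M; split=> // y My x /AB; exact: h. Qed.

Lemma domain_closure_compact : compact (closure Th).
Proof.
apply: bounded_closed_compact; last exact: closed_closure.
have [[_ bO] _ _ _ _] := hOm; exact: (bounded_subset ThO bO).
Qed.

Lemma domain_complement_nonempty : (~` Th) !=set0.
Proof.
have [M [_ /(_ (M + 1))]] := bTh; rewrite ltrDl ltr01 => /(_ isT) h.
exists (const_mx (`|M| + 2)) => /h /(le_trans (entry_le_norm _ ord0)).
by rewrite mxE; have := ler_norm M; have := normr_ge0 M; move=> ? ?; rewrite ger0_norm; lra.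
Qed.

(** The part of [Th] near its boundary has little weight by the gain of
    integrability; the rest is covered by small balls of bounded overlap. *)
Lemma LipQ_compact (e : R) : 0 < e -> exists (m : nat) (B : 'I_m -> set E),
  (forall i, [/\ open (B i), B i !=set0 & B i `<=` Th]) /\
  forall phi, LipQ Q Th phi ->
    \int[mu]_(x in Th) phi x ^+ 2 <= e * ipQ (graph phi) (graph phi)
      + \sum_i ball_mean (B i) (graph phi) ^+ 2.
Proof.
move=> e0; have e2 : 0 < e / 2 by rewrite divr_gt0.
have psdQ := psd_on_domain; have mQ := measurable_on_domain.
have Thoo := domain_finite_measure.
have [C2 [b [C20 [b1 hloc]]]] := hlocal; have [C4 C40 hgl] := hglobal.
have [[oOm _] [kappa k1 quasi] qbo qbs dbl] := hOm.
have TO : Th `<=` Om by apply: subset_trans ThO; exact: subset_closure.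
have [M M0 cov] := controlled_covering r1 oOm k1 quasi qbo qbs dbl b1
  domain_closure_compact ThO.
have cne := domain_complement_nonempty.
pose d := set_dist (~` Th).
have cTc : closed (~` Th) by exact: open_closedC.
have d_out x : ~ Th x -> d x = 0 by move=> nT; exact: set_dist_mem.
have d_in x : Th x -> 0 < d x.
  by move=> Tx; apply: (set_dist_gt0 cne cTc) => /(_ Tx).
pose K (k : nat) : set E := [set x | 3 * k.+1%:R^-1 <= d x].
have cK k : closed (K k) by exact: (closed_set_dist_ge cne).
have kpos k : 0 < k.+1%:R^-1 :> R by rewrite invr_gt0 ltr0n.
pose w (k : nat) (x : E) : R := \1_(~` K k) x.
have mw k : measurable_fun Th (w k).
  by apply: measurable_indic; apply: measurableC; exact: closed_measurable_rV.
have w01 k x : 0 <= w k x <= 1 by rewrite /w indicE; case: (_ \in _); rewrite ?lexx ?ler01.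
have L1one : mu.-integrable Th (EFin \o (fun x : E => 1 `^ (omega / (omega - 1)) : R)).
  exact: (L1_cst mTh _ Thoo).
have m1 : measurable_fun Th ((fun=> 1) : E -> R) by exact: measurable_cst.
have [|k kP] := QH1_weighted_vanishing oTh mQ psdQ omega_gt1 C40 hgl (w := fun=> 1) (w_ := w)
  m1 L1one mw (fun k x _ => w01 k x) _ e2.
  move=> x /d_in dx; apply/cvgrPdist_le => c c0.
  have [|N NP] := @inv_nat_small R (d x / 3); first exact: divr_gt0.
  exists N => // j /= Nj; rewrite sub0r normrN /w indicE.
  have Kx : K j x.
    have := NP j Nj; rewrite (ler_pdivlMr _ _ (ltr0n R 3)) => h.
    by rewrite /K /= mulrC.
  by rewrite (memNset (fun h : (~` K j) x => h Kx)) normr0 ltW.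
pose s : R := k.+1%:R^-1; have s0 : 0 < s := kpos k.
(* A cutoff equals 1 on [W], which contains the enlarged balls that cover [K k]. *)
pose W : set E := [set x | 2 * s < d x].
have oW : open W by exact: (open_set_dist_gt cne).
have WT : W `<=` Th.
  move=> x; apply: contraPP => /d_out Wx; rewrite /W /= Wx; apply/negP.
  by rewrite -leNgt mulr_ge0// ltW.
have KW : K k `<=` W.
  move=> x; rewrite /K /W /= -/s => h; apply: lt_le_trans h.
  by rewrite ltr_pM2r// ltr_nat.
have compK : compact (K k).
  apply: bounded_closed_compact => //.
  exact: (bounded_subset (subset_trans KW WT) bTh).
(* With radii below [eps] the energies of the enlarged balls, each point of which
   is counted at most [M] times, cost no more than [e / 2]. *)
pose eps := Num.min 1 (e / 2 / (C2 ^+ 2 * M + 1)).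
have CM : 0 <= C2 ^+ 2 * M by rewrite mulr_ge0// sqr_ge0.
have CM1 : 0 < C2 ^+ 2 * M + 1 by rewrite ltr_wpDl.
have eps0 : 0 < eps by rewrite lt_min ltr01 divr_gt0.
have [r [m [x [/andP[r0 re] xP xcov xM]]]] :=
  cov (K k) W eps compK KW WT oW r1_continuous r1_gt0 eps0.
have b0 : 0 < b := lt_le_trans ltr01 b1.
pose B i := qball Om rho (x i) r; pose bB i := qball Om rho (x i) (b * r).
have xO i : Om (x i) by have [h _ _] := xP i; exact/TO/WT/KW.
have BbB i : B i `<=` bB i by apply: qb_le; rewrite ler_pMl.
have bBW i : bB i `<=` W by have [] := xP i.
have bBT i : bB i `<=` Th := subset_trans (bBW i) WT.
have BT i : B i `<=` Th := subset_trans (BbB i) (bBT i).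
have oB i : open (B i) by exact: qbo.
have obB i : open (bB i) by apply: qbo => //; exact: mulr_gt0.
have Bne i : B i !=set0 by exists (x i); exact: (qb_center quasi).
have mB i := open_measurable_rV (oB i); have mbB i := open_measurable_rV (obB i).
exists m, B; split=> [i|phi hphi]; first by split.
have hL := LipQ_L2Q oTh mQ psdQ hphi; have L2phi := L2Q_sqr oTh psdQ hL.
have [Lw Iw] := kP _ (QH1_graph oTh mQ psdQ hphi).
have [Lh Ih] := L1_Qenergy oTh mQ psdQ hphi.
have d1 : lipschitz_by 1 setT d := set_dist_lipschitz cne.
have d0 y : ~ Th y -> d y <= 0 by move=> /d_out ->.
have [f [flip fphi]] := locally_lipschitz_cutoff oTh d1 d0 s0 hphi.1.
have C2r : 0 <= C2 * r by rewrite mulr_ge0// ltW.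
have loc i : \int[mu]_(y in B i) phi y ^+ 2 <=
    (C2 * r) ^+ 2 * \int[mu]_(y in bB i) Qenergy Q phi y + ball_mean (B i) (graph phi) ^+ 2.
  have bBoo : (mu (bB i) < +oo)%E.
    exact: le_lt_trans (le_measure mu (mem_set (mbB i)) (mem_set mTh) (bBT i)) Thoo.
  rewrite (ball_mean_sqr oTh Thoo (oB i) (Bne i) (BT i)).
  apply: (local_estimate oTh mQ psdQ hphi WT oW fphi (oB i) (obB i) (Bne i) (BbB i) (bBW i)) => //.
  have [_ br _] := xP i; exact: (hloc (x i) r (xO i) r0 br f (flip Om)).
have LB i := (L1_indic (mB i) mTh (BT i) L2phi).1.
have LbB i := (L1_indic (mbB i) mTh (bBT i) Lh).1.
have LS := L1_sum mTh (index_enum 'I_m) LB.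
have LSb := L1_sum mTh (index_enum 'I_m) LbB.
have J1 : \int[mu]_(y in Th) phi y ^+ 2 <= e / 2 * ipQ (graph phi) (graph phi)
    + \sum_i \int[mu]_(y in B i) phi y ^+ 2.
  have -> : \sum_i \int[mu]_(y in B i) phi y ^+ 2 =
      \int[mu]_(y in Th) (\sum_i \1_(B i) y * phi y ^+ 2).
    rewrite (Rintegral_sum mTh _ LB); apply: eq_bigr => i _.
    by rewrite (L1_indic (mB i) mTh (BT i) L2phi).2.
  apply: le_trans (lerD Iw (lexx _)).
  rewrite -(RintegralD mTh Lw LS).
  apply: (le_Rintegral mTh L2phi (L1_D mTh Lw LS)) => y Ty.
  have terms i : true -> 0 <= (\1_(B i) y : R) * phi y ^+ 2.
    by move=> _; rewrite mulr_ge0 ?sqr_ge0// indicE.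
  have [Ky|nKy] := pselect (K k y); last first.
    rewrite /w indicE (mem_set (nKy : (~` K k) y)) mul1r lerDl.
    exact: sumr_ge0.
  have [i iy] := xcov y Ky.
  rewrite (bigD1 i)//= indicE (mem_set (iy : B i y)) mul1r addrCA lerDl.
  rewrite addr_ge0//; last by apply: sumr_ge0 => j _; exact: terms.
  by rewrite mulr_ge0 ?sqr_ge0//; have /andP[] := w01 k y.
have J2 : \sum_i \int[mu]_(y in bB i) Qenergy Q phi y <= M * ipQ (graph phi) (graph phi).
  apply: (@le_trans _ _ (M * \int[mu]_(y in Th) Qenergy Q phi y)); last exact: ler_wpM2l.
  have -> : \sum_i \int[mu]_(y in bB i) Qenergy Q phi y =
      \int[mu]_(y in Th) (\sum_i \1_(bB i) y * Qenergy Q phi y).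
    rewrite (Rintegral_sum mTh _ LbB); apply: eq_bigr => i _.
    by rewrite (L1_indic (mbB i) mTh (bBT i) Lh).2.
  rewrite -(RintegralZl M mTh Lh).
  apply: (le_Rintegral mTh LSb (L1_Z mTh M Lh)) => y Ty.
  rewrite -mulr_suml; apply: ler_wpM2r; first exact: (Qenergy_ge0 psdQ).
  apply: le_trans (xM y Ty); rewrite -sum1_card natr_sum [leRHS]big_mkcond /=.
  apply: ler_sum => i _; rewrite indicE.
  have [iy|niy] := pselect (bB i y); last by rewrite (memNset niy); case: ifP.
  by rewrite (mem_set iy) ifT//; apply/asboolP.
apply: (le_trans J1).
apply: (@le_trans _ _ (e / 2 * ipQ (graph phi) (graph phi)
  + \sum_i ((C2 * r) ^+ 2 * \int[mu]_(y in bB i) Qenergy Q phi y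
     + ball_mean (B i) (graph phi) ^+ 2))).
  by rewrite lerD2l; apply: ler_sum.
rewrite big_split /= addrA lerD2r -mulr_sumr.
have r21 : (C2 * r) ^+ 2 * M <= e / 2.
  rewrite exprMn mulrAC; apply: (@le_trans _ _ ((C2 ^+ 2 * M) * eps)).
    apply: ler_wpM2l => //; rewrite expr2.
    have re1 : r <= 1 by apply: le_trans re _; rewrite ge_min lexx.
    by apply: le_trans re; rewrite ler_piMr// ltW.
  apply: (@le_trans _ _ ((C2 ^+ 2 * M + 1) * eps)).
    by apply: ler_wpM2r; rewrite ?lerDl// ltW.
  by rewrite mulrC -ler_pdivlMr// ge_min lexx orbT.
have := ler_wpM2l (sqr_ge0 (C2 * r)) J2; rewrite mulrA.
have := ler_wpM2r (ipQ_ge0 psdQ (graph phi)) r21.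
move: (ipQ _ _) (\sum_i _) ((C2 * r) ^+ 2) => I0 S0 cr h1 h2.
have -> : e * I0 = e / 2 * I0 + e / 2 * I0 by field.
by rewrite lerD2l; exact: le_trans h1.
Qed.

(** An arbitrary element is a Lipschitz graph up to an error that both sides
    control. *)
Lemma QH1_compact (e : R) : 0 < e -> exists (m : nat) (l : 'I_m -> pairs -> R),
  [/\ forall i, linear_on L2Q (l i), forall i u, L2Q u -> l i u ^+ 2 <= 4 * ipQ u u &
  forall u, QH1set u ->
    \int[mu]_(x in Th) (u.1 x : R) ^+ 2 <= e * ipQ u u + \sum_i l i u ^+ 2].
Proof.
have sq2 (a b : R) : a ^+ 2 <= 2 * (a - b) ^+ 2 + 2 * b ^+ 2.
  by have := sqr_ge0 (a - 2 * b); rewrite !expr2; nra.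
have sq2' (a b : R) : (a - b) ^+ 2 <= 2 * a ^+ 2 + 2 * b ^+ 2.
  by have := sqr_ge0 (a + b); rewrite !expr2; nra.
have aux (J Jf Jv I0 If Iv S0 Sf c d : R) : 0 <= c -> J <= 2 * Jf + 2 * Jv ->
    Jf <= c / 4 * If + Sf -> If <= 2 * I0 + 2 * Iv ->
    Jv <= Iv -> Sf <= S0 / 2 + d * Iv -> J <= c * I0 + S0 + (c + 2 * d + 2) * Iv.
  move=> c0 h1 h2 h3 h4 h5; have := ler_wpM2l c0 h3; lra.
move=> e0; have e4 : 0 < e / 4 by rewrite divr_gt0.
have psdQ := psd_on_domain; have mQ := measurable_on_domain.
have Thoo := domain_finite_measure.
(* The factors 4 and 2 pay for splitting squares of sums twice. *)
have [m [B [hB BP]]] := LipQ_compact e4.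
have lin i : linear_on L2Q (ball_mean (B i)).
  by have [h1 h2 h3] := hB i; exact: ball_mean_linear.
have bnd i u : L2Q u -> ball_mean (B i) u ^+ 2 <= ipQ u u.
  by have [h1 h2 h3] := hB i; exact: ball_mean_le.
exists m, (fun i u => 2 * ball_mean (B i) u); split.
- by move=> i a u v hu hv; rewrite (lin i a u v hu hv); ring.
- move=> i u hu; rewrite exprMn (_ : 2 ^+ 2 = 4 :> R); last by ring.
  by apply: ler_wpM2l => //; exact: bnd.
move=> u /(QH1P oTh mQ psdQ)[hu happ].
apply/ler_addgt0Pr => d d0.
pose c : R := e + 2 * (2 * m%:R) + 2.
have c0 : 0 < c by rewrite ltr_wpDl// addr_ge0 ?(ltW e0)// !mulr_ge0.
have [phi hphi phiP] := happ _ (divr_gt0 d0 c0).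
have hf := LipQ_L2Q oTh mQ psdQ hphi.
pose v : pairs := u - graph phi.
have hv : L2Q v := submodB (L2Q_lin mTh mQ psdQ) hu hf.
have vP : ipQ v v <= d / c.
  by apply: le_trans phiP; rewrite le_eqVlt; apply/orP; left; apply/eqP;
    apply: eq_Rintegral => x _; exact: polarB_sym.
have fE : graph phi = u - v by rewrite /v opprB addrC subrK.
have L2u := L2Q_sqr oTh psdQ hu; have L2f := L2Q_sqr oTh psdQ hf.
have L2v := L2Q_sqr oTh psdQ hv.
have J1 : \int[mu]_(x in Th) (u.1 x : R) ^+ 2 <=
    2 * \int[mu]_(x in Th) phi x ^+ 2 + 2 * \int[mu]_(x in Th) (v.1 x : R) ^+ 2.
  rewrite -(RintegralZl 2 mTh L2v) -(Rintegral_lin mTh 2 L2f (L1_Z mTh 2 L2v)).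
  apply: (le_Rintegral mTh L2u (L1_lin mTh 2 L2f (L1_Z mTh 2 L2v))) => x _.
  by have := sq2 (u.1 x) (v.1 x); rewrite (_ : u.1 x - v.1 x = phi x)// opprB addrC subrK.
have J2 : \int[mu]_(x in Th) (v.1 x : R) ^+ 2 <= ipQ v v.
  have [_ _ Lv] := hv; apply: (le_Rintegral mTh L2v Lv) => x Tx.
  by rewrite /polar expr2 lerDl; exact: (psdQ x Tx).2.
have J3 : ipQ (graph phi) (graph phi) <= 2 * ipQ u u + 2 * ipQ v v.
  rewrite fE; exact: (ip_sub (L2Q0 Q Th) (L2Q_lin mTh mQ psdQ) (ipQ_bilin mTh mQ psdQ)
    (@ipQ_sym _ _ Q Th psdQ) (fun u _ => ipQ_ge0 psdQ u) hu hv).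
have J4 : \sum_i ball_mean (B i) (graph phi) ^+ 2 <=
    (\sum_i (2 * ball_mean (B i) u) ^+ 2) / 2 + 2 * m%:R * ipQ v v.
  have -> : 2 * m%:R * ipQ v v = \sum_(i < m) 2 * ipQ v v.
    by rewrite sumr_const card_ord -mulr_natr; ring.
  rewrite mulr_suml -big_split /=; apply: ler_sum => i _.
  rewrite fE (linear_onB (lin i) hu hv).
  apply: (le_trans (sq2' _ _)); apply: lerD; last by apply: ler_wpM2l => //; exact: bnd.
  by rewrite le_eqVlt; apply/orP; left; apply/eqP; field.
apply: (le_trans (aux _ _ _ _ _ _ _ _ _ _ (ltW e0) J1 (BP phi hphi) J3 J2 J4)).
by rewrite lerD2l mulrC -ler_pdivlMr.
Qed.

End compactness.

(** * The bilinear form of the operator *)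

Section admissible_weights.
Context {R : realType} {n : nat}.
Local Notation E := 'rV[R]_n.+1.
Local Notation mu := (@lebesgue_rV R n).
Variables (Q : E -> 'M[R]_n.+1) (Th : set E).
Hypothesis oTh : open Th.
Hypothesis mQ : measurable_mx Th Q.
Hypothesis psdQ : forall x, Th x -> psdmx (Q x).
Local Notation L1 f := (mu.-integrable Th (EFin \o f)).
Local Notation ipQ := (ipQ Q Th).
Local Notation QH1set := (QH1set Q Th).
Let mTh := open_measurable_rV oTh.

(** A zeroth order coefficient [w] is harmless when its quadratic form is
    infinitesimally bounded with respect to the norm of [QH1], modulo [L^2]. *)
Definition form_small (w : E -> R) : Prop :=
  [/\ measurable_fun Th w,
      forall u, QH1set u -> L1 (fun x => w x * (u.1 x : R) ^+ 2) &
      forall e : R, 0 < e -> exists2 k : R, 0 <= k & forall u, QH1set u ->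
        \int[mu]_(x in Th) (w x * (u.1 x : R) ^+ 2) <=
        e * ipQ u u + k * \int[mu]_(x in Th) (u.1 x : R) ^+ 2].

Lemma form_small_D w1 w2 : form_small w1 -> form_small w2 ->
  form_small (fun x => w1 x + w2 x).
Proof.
have aux (e i1 i2 I0 J k1 k2 : R) : i1 <= e / 2 * I0 + k1 * J ->
  i2 <= e / 2 * I0 + k2 * J -> i1 + i2 <= e * I0 + (k1 + k2) * J by lra.
move=> [m1 L1w s1] [m2 L2w s2].
have E12 u : (fun x => (w1 x + w2 x) * (u x : R) ^+ 2) =
    (fun x => w1 x * u x ^+ 2 + w2 x * u x ^+ 2).
  by apply/funext => x; rewrite mulrDl.
split; first exact: (measurable_funD m1 m2).
  by move=> u hu; rewrite E12; exact: (L1_D mTh (L1w u hu) (L2w u hu)).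
move=> e e0; have e2 : 0 < e / 2 by rewrite divr_gt0.
have [k1 k10 P1] := s1 _ e2; have [k2 k20 P2] := s2 _ e2.
exists (k1 + k2); first exact: addr_ge0.
move=> u hu; rewrite E12 (RintegralD mTh (L1w u hu) (L2w u hu)).
exact: (aux _ _ _ _ _ _ _ (P1 u hu) (P2 u hu)).
Qed.

Lemma form_small0 : form_small (fun=> 0).
Proof.
have E0 u : (fun x => (0 : R) * (u x : R) ^+ 2) = (fun=> 0).
  by apply/funext => x; rewrite mul0r.
split; first exact: measurable_cst.
  move=> u _; rewrite E0 (_ : EFin \o _ = cst 0%E)//; exact: integrable0.
move=> e e0; exists 0 => // u hu.
rewrite E0 (Rintegral_cst _ mTh) mul0r mul0r addr0.
by rewrite mulr_ge0 ?(ltW e0)// ipQ_ge0.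
Qed.

Lemma form_small_sum N (w : 'I_N -> E -> R) : (forall i, form_small (w i)) ->
  form_small (fun x => \sum_i w i x).
Proof.
move=> hw; elim: (index_enum 'I_N) => [|i s IH].
  rewrite (_ : (fun x => _) = (fun=> 0)); first exact: form_small0.
  by apply/funext => x; rewrite big_nil.
rewrite (_ : (fun x => _) = (fun x => w i x + \sum_(j <- s) w j x)).
  exact: form_small_D.
by apply/funext => x; rewrite big_cons.
Qed.

Variable omega : R.
Hypothesis omega_gt1 : 1 < omega.
Hypothesis hglobal : global_weak_Poincare Q Th omega.
Hypothesis Thoo : (mu Th < +oo)%E.
Local Notation omega' := (omega / (omega - 1)).

Lemma form_small_norm (F : E -> R) (t : \bar R) : (omega'%:E < t)%E -> Lp_on Th t F ->
  form_small (fun x => `|F x|).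
Proof.
move=> ht hF; have [mF LF] := Lp_on_lower mTh (omega'_gt0 omega_gt1) ht Thoo hF.
have [C4 C40 hg] := hglobal.
have mw : measurable_fun Th (fun x => `|F x|) by exact: (measurableT_comp _ mF).
have w0 x : Th x -> 0 <= `|F x| by [].
split; first exact: mw.
  by move=> u hu; exact: (QH1_weighted oTh mQ psdQ omega_gt1 C40 hg mw w0 LF hu).1.
exact: (QH1_weighted_small oTh mQ psdQ omega_gt1 C40 hg mw w0 LF).
Qed.

(** First order coefficients enter squared, after Young's inequality; hence the
    exponent twice as large as for the zeroth order coefficient. *)
Lemma form_small_sqr (H : E -> R) (q : \bar R) : ((2 * omega')%:E < q)%E -> Lp_on Th q H ->
  form_small (fun x => H x ^+ 2).
Proof.
move=> hq hH; have o2 : 0 < 2 * omega' by rewrite mulr_gt0// omega'_gt0.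
have [mH LH] := Lp_on_lower mTh o2 hq Thoo hH.
have [C4 C40 hg] := hglobal.
have mw : measurable_fun Th (fun x => H x ^+ 2) by exact: measurable_funX.
have w0 x : Th x -> 0 <= H x ^+ 2 by rewrite sqr_ge0.
have Lw : L1 (fun x => (H x ^+ 2) `^ omega').
  rewrite (_ : (fun x => _) = (fun x => `|H x| `^ (2 * omega')))//.
  by apply/funext => x; rewrite [RHS]powRrM powR_mulrn// real_normK// num_real.
split; first exact: mw.
  by move=> u hu; exact: (QH1_weighted oTh mQ psdQ omega_gt1 C40 hg mw w0 Lw hu).1.
exact: (QH1_weighted_small oTh mQ psdQ omega_gt1 C40 hg mw w0 Lw).
Qed.

End admissible_weights.

Section first_order_terms.
Context {R : realType} {n : nat}.
Local Notation E := 'rV[R]_n.+1.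

Lemma tuple_vf_lin K (g : 'I_K -> E -> R) (W : 'I_K -> E -> E) (U V : E -> E) (a : R) x :
  tuple_vf g W (fun y => a *: U y + V y) x = a * tuple_vf g W U x + tuple_vf g W V x.
Proof.
rewrite /tuple_vf mulr_sumr -big_split; apply: eq_bigr => i _.
by rewrite dotvDr dotvZr /=; ring.
Qed.

Lemma tuple_vf_Young K (g : 'I_K -> E -> R) (W : 'I_K -> E -> E) (U : E -> E)
    (A : 'M[R]_n.+1) (a d : R) x : 0 < d ->
  (forall i xi, dotv (W i x) xi ^+ 2 <= dotv xi (xi *m A)) ->
  `|a * tuple_vf g W U x| <=
    K%:R * d * dotv (U x) (U x *m A) + (4 * d)^-1 * ((\sum_i g i x ^+ 2) * a ^+ 2).
Proof.
have Young (c s d' : R) : 0 < d' -> `|c * s| <= d' * s ^+ 2 + (4 * d')^-1 * c ^+ 2.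
  move=> d0; have h1 := sqr_ge0 (2 * d' * s + c); have h2 := sqr_ge0 (2 * d' * s - c).
  have k : d' * s ^+ 2 + (4 * d')^-1 * c ^+ 2 =
    (4 * d')^-1 * ((2 * d' * s) ^+ 2 + c ^+ 2) by field; rewrite gt_eqF.
  rewrite k ler_pdivlMl ?mulr_gt0// -{1}(gtr0_norm (_ : 0 < 4 * d')) ?mulr_gt0//.
  by rewrite -normrM ler_norml; rewrite sqrrD in h1; rewrite sqrrB in h2; apply/andP; split; lra.
move=> d0 hW; rewrite /tuple_vf mulr_sumr.
apply: (le_trans (ler_norm_sum _ _ _)).
have -> : K%:R * d * dotv (U x) (U x *m A) + (4 * d)^-1 * ((\sum_i g i x ^+ 2) * a ^+ 2) =
    \sum_i (d * dotv (U x) (U x *m A) + (4 * d)^-1 * (g i x ^+ 2 * a ^+ 2)).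
  rewrite big_split /=; congr (_ + _); last by rewrite mulr_suml mulr_sumr.
  by rewrite sumr_const card_ord -mulrA mulr_natl.
apply: ler_sum => i _; rewrite mulrA; apply: (le_trans (Young _ _ _ d0)).
rewrite exprMn (mulrC (a ^+ 2)) lerD2r; apply: ler_wpM2l; [exact: ltW|exact: hW].
Qed.

End first_order_terms.

Section affine_bounds.
Variables (R : realType) (V : lmodType R) (S : set V) (ip : V -> V -> R).
Local Notation q u := (ip u u).
Hypothesis S0 : S 0.
Hypothesis Slin : forall a u v, S u -> S v -> S (a *: u + v).
Hypothesis ip_bilin : bilinear_on S ip.
Hypothesis ip_ge0 : forall u, S u -> 0 <= q u.

(** Scaling turns an affine bound of a linear functional into a bound by the
    norm. *)
Lemma linear_affine_bound (l : V -> R) (A : R) : linear_on S l ->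
  (forall v, S v -> `|l v| <= A * (1 + q v)) -> forall v, S v -> l v ^+ 2 <= 4 * A ^+ 2 * q v.
Proof.
move=> ll hA v Sv.
have A0 : 0 <= A.
  have := hA 0 S0; rewrite (linear_on0 S0 ll) normr0.
  have q0 : q 0 = 0 by exact: (linear_on0 S0 (ip_bilin.1 _ S0)).
  by rewrite q0 addr0 mulr1.
have q0 := ip_ge0 Sv.
have qZ s : q (s *: v) = s ^+ 2 * q v.
  rewrite (linear_onZ S0 (ip_bilin.1 _ (submodZ S0 Slin s Sv)))//.
  by rewrite (linear_onZ S0 (ip_bilin.2 _ Sv))// expr2 mulrA.
apply/ler_addgt0Pr => e e0.
pose d := e / (4 * A ^+ 2 + 1).
have c0 : 0 < 4 * A ^+ 2 + 1 by rewrite ltr_wpDl// mulr_ge0// sqr_ge0.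
have d0 : 0 < d by rewrite divr_gt0.
have Q0 : 0 < q v + d by rewrite ltr_wpDl.
pose s := (Num.sqrt (q v + d))^-1.
have s0 : 0 < s by rewrite invr_gt0 sqrtr_gt0.
have s2 : s ^+ 2 * (q v + d) = 1.
  by rewrite /s exprVn sqr_sqrtr ?(ltW Q0)// mulVf// gt_eqF.
have h : (s * l v) ^+ 2 <= (2 * A) ^+ 2.
  rewrite -(linear_onZ S0 ll s Sv) -real_normK ?num_real//.
  rewrite ler_sqr ?nnegrE ?mulr_ge0//.
  apply: (le_trans (hA _ (submodZ S0 Slin s Sv))); rewrite qZ mulrC.
  apply: ler_wpM2r => //; rewrite -[leRHS]/(1 + 1) lerD2l -s2.
  by apply: ler_wpM2l; rewrite ?sqr_ge0// lerDl ltW.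
have -> : l v ^+ 2 = (s * l v) ^+ 2 * (q v + d).
  by rewrite exprMn mulrAC s2 mul1r.
apply: (le_trans (ler_wpM2r (ltW Q0) h)).
rewrite mulrDr exprMn (_ : 2 ^+ 2 = 4 :> R); last by ring.
rewrite lerD2l; apply: (@le_trans _ _ ((4 * A ^+ 2 + 1) * d)).
  by apply: ler_wpM2r; rewrite ?(ltW d0)// lerDl.
by rewrite /d mulrC divfK// gt_eqF.
Qed.

End affine_bounds.

Section operator_form.
Context {R : realType} {n : nat}.
Local Notation E := 'rV[R]_n.+1.
Local Notation mu := (@lebesgue_rV R n).
Variables (Q : E -> 'M[R]_n.+1) (Th : set E).
Hypothesis oTh : open Th.
Hypothesis mQ : measurable_mx Th Q.
Hypothesis psdQ : forall x, Th x -> psdmx (Q x).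
Variables (P : E -> 'M[R]_n.+1) (N : nat).
Variables (Rv Sv : 'I_N -> E -> E) (G H : 'I_N -> E -> R) (F : E -> R).
Hypothesis hP : elliptic_matrix Q Th P.
Hypothesis hRv : forall i, subunit Q Th (Rv i).
Hypothesis hSv : forall i, subunit Q Th (Sv i).
Hypothesis mF : measurable_fun Th F.
Hypothesis mG : forall i, measurable_fun Th (G i).
Hypothesis mH : forall i, measurable_fun Th (H i).
Hypothesis sF : form_small Q Th (fun x => `|F x|).
Hypothesis sG : forall i, form_small Q Th (fun x => G i x ^+ 2).
Hypothesis sH : forall i, form_small Q Th (fun x => H i x ^+ 2).
Local Notation L1 f := (mu.-integrable Th (EFin \o f)).
Local Notation pairs := (@pairs R n).
Local Notation ipQ := (ipQ Q Th).
Local Notation L2Q := (L2Q Q Th).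
Local Notation QH1set := (QH1set Q Th).
Local Notation qf U x := (dotv (U x) (U x *m Q x)).
Local Notation bform := (bilinear_form Th P Rv Sv G H F).
Let mTh := open_measurable_rV oTh.

Definition form_density (u v : pairs) (x : E) : R :=
  dotv (v.2 x) (u.2 x *m P x) + v.1 x * tuple_vf H Rv u.2 x
  + u.1 x * tuple_vf G Sv v.2 x + F x * u.1 x * v.1 x.

Definition form_weight (x : E) : R :=
  `|F x| + \sum_i H i x ^+ 2 + \sum_i G i x ^+ 2.

Lemma form_weight_small : form_small Q Th form_weight.
Proof.
apply: (form_small_D oTh _ (form_small_sum oTh psdQ sG)).
exact: (form_small_D oTh sF (form_small_sum oTh psdQ sH)).
Qed.

Lemma form_weight_parts x : [/\ 0 <= \sum_i H i x ^+ 2, 0 <= \sum_i G i x ^+ 2,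
  0 <= `|F x| & form_weight x = `|F x| + \sum_i H i x ^+ 2 + \sum_i G i x ^+ 2].
Proof. by split=> //; apply: sumr_ge0 => i _; exact: sqr_ge0. Qed.

Lemma measurable_tuple_vf K (g : 'I_K -> E -> R) (W : 'I_K -> E -> E) (U : E -> E) :
  (forall i, measurable_fun Th (g i)) -> (forall i, measurable_vec Th (W i)) ->
  measurable_vec Th U -> measurable_fun Th (tuple_vf g W U).
Proof.
move=> mg mW mU; apply: measurable_sum => i.
exact: (measurable_funM (mg i) (measurable_dotv (mW i) mU)).
Qed.

Lemma measurable_form_density u v : L2Q u -> L2Q v -> measurable_fun Th (form_density u v).
Proof.
move=> [mu1 mu2 _] [mv1 mv2 _]; have [mP _ _ _] := hP.
have mR := measurable_tuple_vf mH (fun i => (hRv i).1) mu2.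
have mS := measurable_tuple_vf mG (fun i => (hSv i).1) mv2.
apply: (measurable_funD _ (measurable_funM (measurable_funM mF mu1) mv1)).
apply: (measurable_funD _ (measurable_funM mu1 mS)).
apply: (measurable_funD _ (measurable_funM mv1 mR)).
exact: (measurable_dotv mv2 (measurable_vec_mulmx mu2 mP)).
Qed.

Lemma ae_subunit K (W : 'I_K -> E -> E) : (forall i, subunit Q Th (W i)) ->
  {ae mu, forall x, Th x -> forall i xi, dotv (W i x) xi ^+ 2 <= dotv xi (xi *m Q x)}.
Proof.
move=> hW; have hi i : {ae mu, forall x, Th x -> forall xi,
    dotv (W i x) xi ^+ 2 <= dotv xi (xi *m Q x)} := (hW i).2.
by apply: filterS (filter_forall _ hi) => x hx Tx i; exact: hx.
Qed.

(** Arithmetic-geometric mean inequalities bound every term of the form by the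
    energy densities and by the weighted squares of [form_weight_small]. *)
Lemma form_density_bound : exists2 A : R, 0 <= A & forall u v,
  {ae mu, forall x, Th x -> `|form_density u v x| <=
     A * (polar Q u u x + polar Q v v x)
     + (form_weight x * (u.1 x : R) ^+ 2 + form_weight x * (v.1 x : R) ^+ 2)}.
Proof.
have aux (A1 A2 A3 A4 C1 NN qu qv pu pv h g f a2 b2 : R) :
  0 <= C1 -> 0 <= NN -> 0 <= h -> 0 <= g -> 0 <= f -> 0 <= a2 -> 0 <= b2 ->
  0 <= qu -> 0 <= qv -> pu = a2 + qu -> pv = b2 + qv ->
  `|A1| <= C1 * (qu + qv) -> `|A2| <= NN * 1 * qu + (4 * 1)^-1 * (h * b2) ->
  `|A3| <= NN * 1 * qv + (4 * 1)^-1 * (g * a2) -> `|A4| <= f * a2 + f * b2 ->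
  `|A1 + A2 + A3 + A4| <= (C1 + NN) * (pu + pv) + ((f + h + g) * a2 + (f + h + g) * b2).
  move=> C10 N0 h0 g0 f0 a0 b0 qu0 qv0 -> -> h1 h2 h3 h4.
  have n1 := ler_normD (A1 + A2 + A3) A4; have n2 := ler_normD (A1 + A2) A3.
  have n3 := ler_normD A1 A2.
  have p1 := mulr_ge0 h0 b0; have p2 := mulr_ge0 g0 a0.
  have p3 := mulr_ge0 h0 a0; have p4 := mulr_ge0 g0 b0.
  have p5 := mulr_ge0 C10 a0; have p6 := mulr_ge0 C10 b0.
  have p7 := mulr_ge0 N0 a0; have p8 := mulr_ge0 N0 b0.
  lra.
have prod (f a b : R) : `|f * a * b| <= `|f| * a ^+ 2 + `|f| * b ^+ 2.
  rewrite -mulrA normrM -mulrDr; apply: ler_wpM2l => //.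
  have h1 := sqr_ge0 (a - b); have h2 := sqr_ge0 (a + b).
  have h3 := sqr_ge0 a; have h4 := sqr_ge0 b.
  by rewrite sqrrB in h1; rewrite sqrrD in h2; rewrite ler_norml; apply/andP; split; lra.
have half (C a b pa pb : R) : pa <= C * a -> pb <= C * b -> (pb + pa) / 2 <= C / 2 * (a + b) by lra.
have [_ _ psdP [c1 [C1 [c10 [C10 ell]]]]] := hP.
exists (C1 / 2 + N%:R) => [|u v]; first by rewrite addr_ge0// divr_ge0// ltW.
have aR := ae_subunit hRv; have aS := ae_subunit hSv.
apply: filterS (filterI ell (filterI aR aS)) => x [he [hR hS]] Tx.
have [w1 w2 w3 wE] := form_weight_parts x.
rewrite wE /form_density; apply: (aux _ _ _ _ _ _ (qf u.2 x) (qf v.2 x)).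
- by rewrite divr_ge0// ltW.
- by [].
- exact: w1.
- exact: w2.
- exact: w3.
- exact: sqr_ge0.
- exact: sqr_ge0.
- exact: (psdQ Tx).2.
- exact: (psdQ Tx).2.
- by rewrite /polar expr2.
- by rewrite /polar expr2.
- apply: (le_trans (psd_AMGM (psdP x Tx) _ _)).
  have /andP[_ e1] := he Tx (u.2 x); have /andP[_ e2] := he Tx (v.2 x).
  exact: half.
- exact: (tuple_vf_Young _ _ _ ltr01 (hR Tx)).
- exact: (tuple_vf_Young _ _ _ ltr01 (hS Tx)).
- exact: prod.
Qed.

Lemma L1_form_density u v : QH1set u -> QH1set v -> L1 (form_density u v).
Proof.
move=> hu hv; have [A A0 hA] := form_density_bound.
have [_ Lw _] := form_weight_small.
have hu2 := QH1_L2Q oTh mQ psdQ hu; have hv2 := QH1_L2Q oTh mQ psdQ hv.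
have [_ _ Lu] := hu2; have [_ _ Lv] := hv2.
have LA := L1_Z mTh A (L1_D mTh Lu Lv).
exact: (ae_dominated_L1 mTh (measurable_form_density hu2 hv2)
  (L1_D mTh LA (L1_D mTh (Lw u hu) (Lw v hv))) (hA u v)).
Qed.

Lemma form_bilinear : bilinear_on QH1set bform.
Proof.
have hL := QH1_lin oTh mQ psdQ.
split=> [u hu a v w hv hw|v hv a u w hu hw].
  rewrite -(Rintegral_lin mTh a (L1_form_density hu hv) (L1_form_density hu hw)).
  apply: eq_Rintegral => x _; rewrite /form_density.
  rewrite (tuple_vf_lin G Sv v.2 w.2 a x) dotvDl dotvZl.
  rewrite -[(a *: v + w).1 x]/(a * (v.1 x : R) + w.1 x); ring.
rewrite -(Rintegral_lin mTh a (L1_form_density hu hv) (L1_form_density hw hv)).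
apply: eq_Rintegral => x _; rewrite /form_density.
rewrite (tuple_vf_lin H Rv u.2 w.2 a x) mulmxDl -scalemxAl dotvDr dotvZr.
rewrite -[(a *: u + w).1 x]/(a * (u.1 x : R) + w.1 x); ring.
Qed.

Lemma form_bounded : exists2 A : R, 0 <= A &
  forall u v, QH1set u -> QH1set v -> `|bform u v| <= A * (ipQ u u + ipQ v v).
Proof.
have aux (A k iu iv ju jv wu wv : R) : 0 <= k -> ju <= iu -> jv <= iv ->
  wu <= 1 * iu + k * ju -> wv <= 1 * iv + k * jv ->
  A * (iu + iv) + (wu + wv) <= (A + 1 + k) * (iu + iv).
  move=> k0 h1 h2 h3 h4; have := ler_wpM2l k0 h1; have := ler_wpM2l k0 h2; lra.
have [A A0 hA] := form_density_bound.
have [_ Lw /(_ 1 ltr01)[k k0 hk]] := form_weight_small.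
exists (A + 1 + k); first by rewrite !addr_ge0.
move=> u v hu hv; have Lf := L1_form_density hu hv.
have hu2 := QH1_L2Q oTh mQ psdQ hu; have hv2 := QH1_L2Q oTh mQ psdQ hv.
have [_ _ Lu] := hu2; have [_ _ Lv] := hv2.
have LA := L1_D mTh Lu Lv.
have LW := L1_D mTh (Lw u hu) (Lw v hv).
have LD := L1_lin mTh A LA LW.
have J w (hw : QH1set w) : \int[mu]_(x in Th) (w.1 x : R) ^+ 2 <= ipQ w w.
  have hw2 := QH1_L2Q oTh mQ psdQ hw; have [_ _ Lw2] := hw2.
  apply: (le_Rintegral mTh (L2Q_sqr oTh psdQ hw2) Lw2) => x Tx.
  by rewrite /polar expr2 lerDl; exact: (psdQ Tx).2.
have h : `|bform u v| <= \int[mu]_(x in Th) (A * (polar Q u u x + polar Q v v x)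
     + (form_weight x * (u.1 x : R) ^+ 2 + form_weight x * (v.1 x : R) ^+ 2)).
  apply: (le_trans (le_normr_Rintegral mTh Lf)).
  exact: (le_Rintegral_ae mTh (integrable_norm Lf) LD (hA u v)).
apply: (le_trans h).
rewrite (Rintegral_lin mTh A LA LW) (RintegralD mTh Lu Lv) (RintegralD mTh (Lw u hu) (Lw v hv)).
exact: (aux _ _ _ _ _ _ _ _ k0 (J u hu) (J v hv) (hk u hu) (hk v hv)).
Qed.

(** Absorbing the first order terms costs half of the ellipticity and a zeroth
    order term, which is infinitesimally bounded. *)
Lemma form_Garding : exists c0 k : R, [/\ 0 < c0, 0 <= k &
  forall u, QH1set u ->
    c0 * ipQ u u <= bform u u + k * \int[mu]_(x in Th) (u.1 x : R) ^+ 2].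
Proof.
have aux2 (c J b I0 Ck CW : R) : c / 2 * I0 + (- (c / 2) * J + - CW) <= b ->
  CW <= c / 4 * I0 + Ck * J -> c / 4 * I0 <= b + (c / 2 + Ck) * J by lra.
have [_ _ psdP [c1 [C1 [c10 [C10 ell]]]]] := hP.
have N1 : 0 < N%:R + 1 :> R by rewrite ltr_wpDl.
(* With this parameter in Young's inequality the first order terms of each kind
   cost at most a quarter of the ellipticity. *)
pose d := c1 / (4 * (N%:R + 1)).
have d0 : 0 < d by rewrite divr_gt0// mulr_gt0.
have Nd : N%:R * d <= c1 / 4.
  have -> : c1 / 4 = (N%:R + 1) * d by rewrite /d; field; rewrite gt_eqF.
  by apply: ler_wpM2r; [exact: ltW|rewrite lerDl].
pose C := (4 * d)^-1 + 1.
have C0 : 0 < C by rewrite ltr_wpDl// invr_ge0 mulr_ge0// ltW.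
have aux (A1 A2 A3 A4 p h g f a2 qu : R) : 0 <= qu -> 0 <= h -> 0 <= g -> 0 <= f -> 0 <= a2 ->
  p = a2 + qu -> c1 * qu <= A1 ->
  `|A2| <= N%:R * d * qu + (4 * d)^-1 * (h * a2) ->
  `|A3| <= N%:R * d * qu + (4 * d)^-1 * (g * a2) -> `|A4| <= f * a2 ->
  c1 / 2 * p + (- (c1 / 2) * a2 + - C * ((f + h + g) * a2)) <= A1 + A2 + A3 + A4.
  move=> q0 h0 g0 f0 a0 -> h1; rewrite /C.
  have := ler_wpM2r q0 Nd; have : 0 <= (4 * d)^-1 by rewrite invr_ge0 mulr_ge0// ltW.
  move: (N%:R * d) (4 * d)^-1 => Z Y Y0 hZ.
  rewrite !ler_norml => /andP[h2 _] /andP[h3 _] /andP[h4 _].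
  have p1 := mulr_ge0 h0 a0; have p2 := mulr_ge0 g0 a0.
  have p3 := mulr_ge0 Y0 (mulr_ge0 f0 a0); lra.
have [_ Lw hw] := form_weight_small.
have e0 : 0 < c1 / (4 * C) by rewrite divr_gt0// mulr_gt0.
have [k k0 hk] := hw _ e0.
exists (c1 / 4), (c1 / 2 + C * k); split=> [||u hu].
- by rewrite divr_gt0.
- by rewrite addr_ge0 ?divr_ge0 ?mulr_ge0// ltW.
have hu2 := QH1_L2Q oTh mQ psdQ hu; have [_ _ Lu] := hu2.
have Lf := L1_form_density hu hu; have L2u := L2Q_sqr oTh psdQ hu2.
have Lr := L1_lin mTh (- (c1 / 2)) L2u (L1_Z mTh (- C) (Lw u hu)).
have LD := L1_lin mTh (c1 / 2) Lu Lr.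
have aR := ae_subunit hRv; have aS := ae_subunit hSv.
have h : {ae mu, forall x, Th x -> c1 / 2 * polar Q u u x +
    (- (c1 / 2) * (u.1 x : R) ^+ 2 + - C * (form_weight x * (u.1 x : R) ^+ 2))
    <= form_density u u x}.
  apply: filterS (filterI ell (filterI aR aS)) => x [he [hR hS]] Tx.
  have [w1 w2 w3 wE] := form_weight_parts x.
  rewrite wE; apply: (aux _ _ _ _ _ _ _ _ _ (qf u.2 x)).
  - exact: (psdQ Tx).2.
  - exact: w1.
  - exact: w2.
  - exact: w3.
  - exact: sqr_ge0.
  - by rewrite /polar expr2.
  - by have /andP[] := he Tx (u.2 x).
  - exact: (tuple_vf_Young _ _ _ d0 (hR Tx)).
  - exact: (tuple_vf_Young _ _ _ d0 (hS Tx)).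
  - by rewrite -mulrA normrM -expr2 (ger0_norm (sqr_ge0 _)).
have := le_Rintegral_ae mTh LD Lf h.
rewrite (Rintegral_lin mTh (c1 / 2) Lu Lr).
rewrite (Rintegral_lin mTh (- (c1 / 2)) L2u (L1_Z mTh (- C) (Lw u hu))).
rewrite (RintegralZl (- C) mTh (Lw u hu)).
have -> : \int[mu]_(x in Th) form_density u u x = bform u u by [].
have := hk u hu.
have -> : \int[mu]_(x in Th) polar Q u u x = ipQ u u by [].
move: (\int[mu]_(x in Th) (form_weight x * _)) (\int[mu]_(x in Th) _ ^+ 2) (bform u u) (ipQ u u).
move=> W J b I0 h1 h2; have := ler_wpM2l (ltW C0) h1.
have -> : C * (c1 / (4 * C) * I0 + k * J) = c1 / 4 * I0 + C * k * J.
  by field; rewrite gt_eqF.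
move: (C * k) (C * W) (mulNr C W) h2 => Ck CW -> h2 h3.
exact: (aux2 _ _ _ _ _ _ h2 h3).
Qed.

End operator_form.

(** * The Neumann problem *)

Lemma Garding_shift (R : realFieldType) (c X bu k J Y : R) : 0 <= J ->
  c * X <= bu + k * J -> (k + 1) * J <= c / 2 * X + Y -> c / 2 * X <= bu + Y.
Proof. lra. Qed.

Lemma norm_prod_le (R : realFieldType) (x y X Y D : R) :
  y ^+ 2 <= D * Y -> x ^+ 2 <= D * X -> `|x * y| <= D * (X + Y).
Proof.
move=> h1 h2; have h3 := sqr_ge0 (x + y); have h4 := sqr_ge0 (x - y).
have h5 := sqr_ge0 x; have h6 := sqr_ge0 y.
rewrite sqrrD in h3; rewrite sqrrB in h4.
by rewrite ler_norml mulrDr; apply/andP; split; lra.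
Qed.

Section right_hand_side.
Context {R : realType} {n : nat}.
Local Notation E := 'rV[R]_n.+1.
Local Notation mu := (@lebesgue_rV R n).
Variables (Q : E -> 'M[R]_n.+1) (Th : set E).
Hypothesis oTh : open Th.
Hypothesis mQ : measurable_mx Th Q.
Hypothesis psdQ : forall x, Th x -> psdmx (Q x).
Variables (f : E -> R) (K : nat) (T : 'I_K -> E -> E) (g : 'I_K -> E -> R).
Hypothesis data : Neumann_data Q Th f T g.
Local Notation L1 f := (mu.-integrable Th (EFin \o f)).
Local Notation pairs := (@pairs R n).
Local Notation ipQ := (ipQ Q Th).
Local Notation L2Q := (L2Q Q Th).
Let mTh := open_measurable_rV oTh.

Let L2_sqr (h : E -> R) : Lp_on Th 2%:E h ->
  measurable_fun Th h /\ L1 (fun x => h x ^+ 2).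
Proof.
have two0 : 0 < 2 :> R by [].
move=> /(Lp_onP mTh _ two0)[mh Lh]; split=> //.
rewrite (_ : (fun x => _) = (fun x => `|h x| `^ 2))//.
by apply/funext => x; rewrite powR_mulrn// real_normK// num_real.
Qed.

Let rhs_density (v : pairs) x : R := f x * v.1 x + tuple_vf g T v.2 x.

Let rhs_bound v : {ae mu, forall x, Th x ->
  `|rhs_density v x| <= (f x ^+ 2 + \sum_i g i x ^+ 2) + (1 + K%:R) * polar Q v v x}.
Proof.
have aux (A1 A2 F2 S a2 q k : R) : 0 <= q -> 0 <= a2 -> 0 <= S -> 0 <= F2 -> 0 <= k ->
  `|A1| <= F2 + a2 -> `|1 * A2| <= k * 1 * q + (4 * 1)^-1 * (S * 1 ^+ 2) ->
  `|A1 + A2| <= F2 + S + (1 + k) * (a2 + q).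
  move=> q0 a0 S0 F0 k0 h1; rewrite mul1r => h2; have := ler_normD A1 A2.
  by have := mulr_ge0 k0 a0; rewrite expr1n in h2; lra.
have [_ hT _] := data.
apply: filterS (ae_subunit hT) => x hx Tx.
rewrite /polar -expr2; apply: (aux _ _ _ _ _ (dotv (v.2 x) (v.2 x *m Q x))).
- exact: (psdQ Tx).2.
- exact: sqr_ge0.
- by apply: sumr_ge0 => i _; exact: sqr_ge0.
- exact: sqr_ge0.
- by [].
- have h1 := sqr_ge0 (f x - v.1 x); have h2 := sqr_ge0 (f x + v.1 x).
  have h3 := sqr_ge0 (f x); have h4 := sqr_ge0 (v.1 x : R).
  rewrite sqrrB in h1; rewrite sqrrD in h2.
  by rewrite ler_norml; apply/andP; split; lra.
- exact: (tuple_vf_Young _ _ _ ltr01 (hx Tx)).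
Qed.

Let L1_data : L1 (fun x => f x ^+ 2 + \sum_i g i x ^+ 2).
Proof.
have [hf _ hg] := data.
exact: (L1_D mTh (L2_sqr hf).2 (L1_sum mTh _ (fun i => (L2_sqr (hg i)).2))).
Qed.

Let L1_rhs v : L2Q v -> L1 (rhs_density v).
Proof.
move=> [m1 m2 Lv]; have [hf hT hg] := data.
have mt : measurable_fun Th (tuple_vf g T v.2).
  exact: (measurable_tuple_vf (fun i => (L2_sqr (hg i)).1) (fun i => (hT i).1) m2).
have md := measurable_funD (measurable_funM (L2_sqr hf).1 m1) mt.
exact: (ae_dominated_L1 mTh md (L1_D mTh L1_data (L1_Z mTh _ Lv)) (rhs_bound v)).
Qed.

Lemma rhs_linear : linear_on L2Q (Neumann_rhs Th f T g).
Proof.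
move=> a u v hu hv; rewrite -(Rintegral_lin mTh a (L1_rhs hu) (L1_rhs hv)).
apply: eq_Rintegral => x _; rewrite /rhs_density (tuple_vf_lin g T u.2 v.2 a x).
rewrite -[(a *: u + v).1 x]/(a * (u.1 x : R) + v.1 x); ring.
Qed.

(** The data enter through their [L^2] norms, by Young's inequality for the
    subunit fields; scaling the test function gives the bound by its norm. *)
Lemma rhs_bounded : exists2 A : R, 0 <= A &
  forall v, L2Q v -> Neumann_rhs Th f T g v ^+ 2 <= A * ipQ v v.
Proof.
have aux (I q k : R) : 0 <= I -> 0 <= q -> 0 <= k -> I + (1 + k) * q <= (I + (1 + k)) * (1 + q).
  by move=> i0 q0 k0; have := mulr_ge0 i0 q0; lra.
pose I0 := \int[mu]_(x in Th) (f x ^+ 2 + \sum_i g i x ^+ 2).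
have I00 : 0 <= I0.
  apply: Rintegral_ge0 => x _; rewrite addr_ge0 ?sqr_ge0//.
  by apply: sumr_ge0 => i _; exact: sqr_ge0.
pose A := I0 + (1 + K%:R).
exists (4 * A ^+ 2); first by rewrite mulr_ge0 ?sqr_ge0.
apply: (linear_affine_bound (L2Q0 Q Th) (L2Q_lin mTh mQ psdQ) (ipQ_bilin mTh mQ psdQ)
  (fun u _ => ipQ_ge0 psdQ u) rhs_linear) => v hv.
have [_ _ Lv] := hv; have LD := L1_D mTh L1_data (L1_Z mTh (1 + K%:R) Lv).
apply: (le_trans (le_normr_Rintegral mTh (L1_rhs hv))).
apply: (le_trans (le_Rintegral_ae mTh (integrable_norm (L1_rhs hv)) LD (rhs_bound v))).
rewrite (RintegralD mTh L1_data (L1_Z mTh (1 + K%:R) Lv)) (RintegralZl (1 + K%:R) mTh Lv).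
have -> : \int[mu]_(x in Th) polar Q v v x = ipQ v v by [].
exact: (aux _ _ _ I00 (ipQ_ge0 psdQ v) (ler0n R K)).
Qed.

End right_hand_side.

Section dimension.
Context {R : realType} {n : nat}.
Local Notation E := 'rV[R]_n.+1.
Local Notation mu := (@lebesgue_rV R n).
Variables (Q : E -> 'M[R]_n.+1) (Th : set E).
Hypothesis oTh : open Th.
Hypothesis mQ : measurable_mx Th Q.
Hypothesis psdQ : forall x, Th x -> psdmx (Q x).
Local Notation pairs := (@pairs R n).
Local Notation ipQ := (ipQ Q Th).
Local Notation L2Q := (L2Q Q Th).
Let mTh := open_measurable_rV oTh.

Lemma QHeqP (u v : pairs) : L2Q u -> L2Q v -> QHeq Q Th u v <-> ipQ (u - v) (u - v) = 0.
Proof.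
move=> hu hv; rewrite (ipQ_eq0 mTh psdQ (submodB (L2Q_lin mTh mQ psdQ) hu hv)).
split=> -[h1 h2]; split.
- by apply: filterS h1 => x hx Tx; apply/eqP; rewrite subr_eq0; apply/eqP/hx.
- by apply: filterS h2 => x hx Tx; rewrite /sqrtQ subr0; exact: hx.
- by apply: filterS h1 => x hx Tx; apply/eqP; rewrite -subr_eq0; apply/eqP/hx.
- by apply: filterS h2 => x hx Tx; have := hx Tx; rewrite /sqrtQ subr0.
Qed.

Lemma QHlincombE d (c : 'I_d -> R) (e : 'I_d -> pairs) :
  QHlincomb c e = \sum_i c i *: e i :> pairs.
Proof.
rewrite [LHS](_ : _ = ((\sum_i c i *: e i).1, (\sum_i c i *: e i).2)); last first.
  congr (_, _); apply/funext => x.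
    by rewrite (raddf_sum fst) fct_sumE.
  by rewrite (raddf_sum snd) fct_sumE.
by case: (\sum_i _).
Qed.

Lemma has_dim_QHdim (S : set pairs) d : S `<=` L2Q -> has_dim ipQ S d -> QHdim Q Th S d.
Proof.
move=> SL [e [eS e_free e_span]]; exists e.
have hsum c : L2Q (\sum_i c i *: e i).
  by apply: (submod_sum (L2Q0 Q Th) (L2Q_lin mTh mQ psdQ)) => i; exact/SL/eS.
split; first exact: eS.
  move=> c; rewrite QHlincombE => /(ipQ_eq0 mTh psdQ (hsum c)); exact: e_free.
move=> u Su; have [c hc] := e_span u Su; exists c; rewrite QHlincombE.
exact/(QHeqP (SL _ Su) (hsum c)).
Qed.

End dimension.
Theorem theorem2p11 (R : realType) (n : nat)
    (Om : set 'rV[R]_n.+1) (rho : 'rV[R]_n.+1 -> 'rV[R]_n.+1 -> R)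
    (Q : 'rV[R]_n.+1 -> 'M[R]_n.+1) (r1 : 'rV[R]_n.+1 -> R)
    (Th : set 'rV[R]_n.+1) (omega : R)
    (P : 'rV[R]_n.+1 -> 'M[R]_n.+1) (N : nat)
    (Rv Sv : 'I_N -> 'rV[R]_n.+1 -> 'rV[R]_n.+1)
    (G H : 'I_N -> 'rV[R]_n.+1 -> R) (F : 'rV[R]_n.+1 -> R) (t q : \bar R)
    (hOm : geometric_homogeneous_space Om rho)
    (hQ : degenerate_matrix Om Q)
    (r1_continuous : {within Om, continuous r1})
    (r1_gt0 : forall x, Om x -> 0 < r1 x)
    (hlocal : local_Poincare Om rho Q r1 2)
    (Th_open : open Th) (Th_connected : connected Th) (Th_nonempty : Th !=set0)
    (Th_bounded : bounded_set Th) (Th_Om : closure Th `<=` Om)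
    (omega_gt1 : 1 < omega)
    (hglobal : global_weak_Poincare Q Th omega)
    (hP : elliptic_matrix Q Th P)
    (hRv : forall i, subunit Q Th (Rv i))
    (hSv : forall i, subunit Q Th (Sv i))
    (ht : ((omega / (omega - 1))%:E < t)%E) (hF : Lp_on Th t F)
    (hq : ((2 * (omega / (omega - 1)))%:E < q)%E)
    (hG : forall i, Lp_on Th q (G i)) (hH : forall i, Lp_on Th q (H i)) :
  let I := uniquely_solvable Q Th P Rv Sv G H F in
  let II := has_nontrivial_solution Q Th P Rv Sv G H F in
  [/\ (I \/ II) /\ ~ (I /\ II),
      II -> exists d : nat,
        QHdim Q Th (homogeneous_solutions Q Th P Rv Sv G H F) d /\
        QHdim Q Th (adjoint_solutions Q Th P Rv Sv G H F) d &
      II -> forall (f : 'rV[R]_n.+1 -> R) (K : nat)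
          (T : 'I_K -> 'rV[R]_n.+1 -> 'rV[R]_n.+1)
          (g : 'I_K -> 'rV[R]_n.+1 -> R),
        Neumann_data Q Th f T g ->
        (exists u, weak_solution Q Th P Rv Sv G H F f T g u) <->
        (forall w, adjoint_solutions Q Th P Rv Sv G H F w ->
          Neumann_rhs Th f T g w = 0)].

Proof.
move=> I II.
have psdQ := psd_on_domain hQ Th_Om; have mQ := measurable_on_domain hOm hQ Th_Om.
have Thoo := domain_finite_measure Th_open Th_bounded.
have mTh := open_measurable_rV Th_open.
have o'0 := omega'_gt0 omega_gt1.
have o2 : 0 < 2 * (omega / (omega - 1)) by rewrite mulr_gt0.
have mF := (Lp_on_lower mTh o'0 ht Thoo hF).1.
have mG i := (Lp_on_lower mTh o2 hq Thoo (hG i)).1.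
have mH i := (Lp_on_lower mTh o2 hq Thoo (hH i)).1.
have sF := form_small_norm Th_open mQ psdQ omega_gt1 hglobal Thoo ht hF.
have sG i := form_small_sqr Th_open mQ psdQ omega_gt1 hglobal Thoo hq (hG i).
have sH i := form_small_sqr Th_open mQ psdQ omega_gt1 hglobal Thoo hq (hH i).
pose S := QH1set Q Th; pose ip := ipQ Q Th.
pose b := bilinear_form Th P Rv Sv G H F.
have SL u : S u -> L2Q Q Th u by exact: QH1_L2Q.
have S0 : S 0 by exact: QH10.
have Slin : forall a u v, S u -> S v -> S (a *: u + v) by exact: QH1_lin.
have ip_bilin : bilinear_on S ip.
  have [h1 h2] := ipQ_bilin mTh mQ psdQ.
  split=> [u /SL hu a v w /SL hv /SL hw|v /SL hv a u w /SL hu /SL hw].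
    exact: (h1 u hu a v w hv hw).
  exact: (h2 v hv a u w hu hw).
have ip_sym u v : S u -> S v -> ip u v = ip v u.
  by move=> /SL hu /SL hv; exact: (ipQ_sym psdQ).
have ip_ge0 u : S u -> 0 <= ip u u by move=> _; exact: (ipQ_ge0 psdQ u).
have compl : semi_complete S ip by exact: QH1_complete.
have b_bilin : bilinear_on S b :=
  form_bilinear Th_open mQ psdQ hP hRv hSv mF mG mH sF sG sH.
have [A A0 bA] := form_bounded Th_open mQ psdQ hP hRv hSv mF mG mH sF sG sH.
have [c0 [k [c00 k0 gard]]] := form_Garding Th_open mQ psdQ hP hRv hSv mF mG mH sF sG sH.
have k1 : 0 < k + 1 by rewrite ltr_wpDl.
have e0 : 0 < c0 / (2 * (k + 1)) by rewrite divr_gt0// mulr_gt0.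
have [m [l [l_lin l_bnd l_cpt]]] := QH1_compact hOm hQ r1_continuous r1_gt0 hlocal
  Th_open Th_bounded Th_Om omega_gt1 hglobal e0.
(* The weight [s] makes the squares of the functionals absorb the multiple of the
   L2 norm that the Garding inequality costs. *)
pose s := Num.sqrt (k + 1); have s2 : s ^+ 2 = k + 1 by rewrite sqr_sqrtr// ltW.
pose l' i u := s * l i u.
have l'_lin i : linear_on S (l' i).
  by move=> a u v /SL hu /SL hv; rewrite /l' (l_lin i a u v hu hv); ring.
have l'_bnd i u : S u -> l' i u ^+ 2 <= (4 * (k + 1)) * ip u u.
  move=> /SL hu; rewrite /l' exprMn s2 (mulrC 4) -mulrA.
  by apply: ler_wpM2l; [exact: ltW|exact: l_bnd].
pose a u v := b u v + \sum_i l' i u * l' i v.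
have a_coer u : S u -> c0 / 2 * ip u u <= a u u.
  move=> hu; rewrite /a (eq_bigr (fun i => (k + 1) * l i u ^+ 2)); last first.
    by move=> i _; rewrite /l' -s2; ring.
  have h1 := gard u hu; have h2 := ler_wpM2l (ltW k1) (l_cpt u hu).
  rewrite mulrDr mulr_sumr in h2.
  have J0 : 0 <= \int[lebesgue_rV (n:=n)]_(x in Th) (u.1 x : R) ^+ 2.
    by apply: Rintegral_ge0 => x _; exact: sqr_ge0.
  have e1 : (k + 1) * (c0 / (2 * (k + 1)) * ip u u) = c0 / 2 * ip u u.
    by field; rewrite gt_eqF.
  rewrite e1 in h2.
  exact: (Garding_shift J0 h1 h2).
have a_bilin : bilinear_on S a := perturbed_bilin b_bilin l'_lin.
pose B := A + m%:R * (4 * (k + 1)) + 1.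
have B0 : 0 < B by rewrite ltr_wpDl// addr_ge0// mulr_ge0// mulr_ge0// ltW.
have a_add u v : S u -> S v -> `|a u v| <= B * (ip u u + ip v v).
  move=> hu hv; have h1 : `|b u v| <= A * (ip u u + ip v v) := bA u v hu hv.
  have Z0 : 0 <= ip u u + ip v v := addr_ge0 (ip_ge0 u hu) (ip_ge0 v hv).
  have h2 : `|\sum_i l' i u * l' i v| <= m%:R * (4 * (k + 1)) * (ip u u + ip v v).
    apply: (le_trans (ler_norm_sum _ _ _)).
    have -> : m%:R * (4 * (k + 1)) * (ip u u + ip v v) =
        \sum_(i < m) 4 * (k + 1) * (ip u u + ip v v).
      by rewrite sumr_const card_ord -mulrA mulr_natl.
    by apply: ler_sum => i _; exact: norm_prod_le (l'_bnd i v hv) (l'_bnd i u hu).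
  apply: (le_trans (ler_normD (b u v) _)); apply: (le_trans (lerD h1 h2)).
  by rewrite -mulrDl; apply: (ler_wpM2r Z0); rewrite lerDl.
have a_bnd := scaled_bound S0 Slin ip_bilin ip_ge0 a_bilin B0 a_add.
pose M := 4 * B ^+ 2 + 4 * (k + 1).
have B2 : 0 <= 4 * B ^+ 2 by rewrite mulr_ge0// sqr_ge0.
have k4 : 0 < 4 * (k + 1) by rewrite mulr_gt0.
have M0 : 0 < M by rewrite ltr_wpDl.
have l'_M i u : S u -> l' i u ^+ 2 <= M * ip u u.
  move=> hu; apply: (le_trans (l'_bnd i u hu)); apply: ler_wpM2r; first exact: ip_ge0.
  by rewrite lerDr.
have a_M u v : S u -> S v -> a u v ^+ 2 <= M * ip u u * ip v v.
  move=> hu hv; apply: (le_trans (a_bnd u v hu hv)); apply: ler_wpM2r; first exact: ip_ge0.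
  by apply: ler_wpM2r; [exact: ip_ge0|rewrite lerDl ltW].
have c2 : 0 < c0 / 2 by rewrite divr_gt0.
have [[d [dN dN']] solv] := finite_rank_Fredholm S0 Slin ip_bilin ip_sym ip_ge0 compl
  b_bilin l'_lin c2 M0 l'_M a_M a_coer.
have eqP0 u v : S u -> S v -> QHeq Q Th u v <-> ip (u - v) (u - v) = 0.
  by move=> /SL hu /SL hv; exact: (QHeqP Th_open mQ psdQ hu hv).
have solvable f K T g : Neumann_data Q Th f T g ->
    (forall w, adjoint_solutions Q Th P Rv Sv G H F w -> Neumann_rhs Th f T (K := K) g w = 0) ->
    exists u, weak_solution Q Th P Rv Sv G H F f T g u.
  move=> data orth.
  have [D D0 hD] := rhs_bounded Th_open mQ psdQ data.
  have lin := rhs_linear Th_open psdQ data.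
  have [u Su hu] := solv (Neumann_rhs Th f T g) D
    (fun c v w hv hw => lin c v w (SL v hv) (SL w hw)) D0 (fun v hv => hD v (SL v hv)) orth.
  by exists u; split.
have trivial_d0 : ~ II -> d = 0%N.
  case: d dN dN' => // d [e [eN e_free _]] _ nII; exfalso; apply: nII.
  exists (e ord0); split; first exact: eN.
  move=> /(ipQ_eq0 mTh psdQ (SL _ (eN ord0).1)) q0.
  have sE : \sum_i ((i == ord0)%:R : R) *: e i = e ord0.
    rewrite (bigD1 ord0)//= scale1r big1 ?addr0// => i /negbTE ->.
    by rewrite scale0r.
  have := e_free (fun i => (i == ord0)%:R); rewrite sE => /(_ q0 ord0)/eqP.
  by rewrite eqxx oner_eq0.
split.
- split.
    have [hII|nII] := pselect II; [by right|left].
    have d0 := trivial_d0 nII; rewrite {}d0 in dN dN'.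
    move=> f K T g data; split.
      apply: (solvable f K T g data) => w hw.
      have [D D0 hD] := rhs_bounded Th_open mQ psdQ data.
      have [e [_ _ span]] := dN'; have [c] := span w hw; rewrite big_ord0 subr0 => q0.
      have := hD w (SL w hw.1); rewrite -/ip q0 mulr0 => h.
      by apply/eqP; rewrite -sqrf_eq0 eq_le h sqr_ge0.
    move=> u u' [Su hu] [Su' hu']; apply/(eqP0 u u' Su Su').
    have [e [_ _ span]] := dN; have [|c] := span (u - u' : pairs).
      split; first exact: (submodB Slin Su Su').
      move=> v hv; rewrite (linear_onB (b_bilin.2 v hv) Su Su').
      by rewrite /b hu// hu'// subrr.
    by rewrite big_ord0 subr0.
  move=> [hI [u [[Su hu] nu]]]; apply: nu.
  have data0 : Neumann_data Q Th (fun=> 0) (fun (i : 'I_0) (x : 'rV[R]_n.+1) => x)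
      (fun (i : 'I_0) (x : 'rV[R]_n.+1) => 0).
    split=> [|[]//|[]//]; have [h _ _] := (L2Q_components Th_open mQ psdQ 0).1 (SL 0 S0).
    exact: h.
  have rhs0 v : Neumann_rhs Th (fun=> 0) (fun (i : 'I_0) (x : 'rV[R]_n.+1) => x)
      (fun (i : 'I_0) (x : 'rV[R]_n.+1) => 0) v = 0.
    rewrite /Neumann_rhs (@eq_Rintegral _ _ _ _ Th (fun=> 0)).
      by rewrite Rintegral_cst// mul0r.
    by move=> x _; rewrite mul0r add0r /tuple_vf big_ord0.
  apply: ((hI _ _ _ _ data0).2 u (QH0 : pairs)).
    by split=> // v hv; rewrite rhs0; exact: hu.
  split; first exact: S0.
  move=> v hv; rewrite rhs0; exact: (linear_on0 S0 (b_bilin.2 v hv)).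
- move=> _; exists d; split.
    by apply: (has_dim_QHdim Th_open mQ psdQ _ dN) => u [/SL].
  by apply: (has_dim_QHdim Th_open mQ psdQ _ dN') => u [/SL].
move=> _ f K T g data; split=> [[u [Su hu]] w [Sw hw]|]; last exact: solvable.
by rewrite -(hu w Sw); exact: hw.
Qed.
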